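(* Let $P\in\mathcal{P}(\mathbb{R}^d)$ have Lebesgue density $p$, let $K$, $h=h_N$ and $p$ satisfy the conditions (i)--(iii) of the context, and let $Z_1,\dots,Z_N$ be generated by a Markov chain satisfying the Markov chain and kernel conditions of the context (including (SSC), (DC) and (KMC)). Then the kernel density estimator $\hat q_N=\frac1N\sum_{k=1}^NK_h(Z_k,\cdot)$, $K_h(x,y)=h^{-d}K((x-y)/h)$, satisfies $$\mathrm{MIAE}(\hat q_N)=\mathcal{O}\Bigl(\frac1{\sqrt{Nh^{2d}}}+h^2\Bigr)\quad\text{and}\quad\mathrm{MISE}(\hat q_N)=\mathcal{O}\Bigl(\frac1{Nh^{2d}}+h^4\Bigr).$$ Balancing the two terms in these upper bounds yields the asymptotically optimal bandwidth (with respect to these bounds) $h_N\asymp N^{-1/(2d+4)}$, and for this choice of bandwidth $$\mathrm{MIAE}(\hat q_N)=\mathcal{O}\bigl(N^{-1/(d+2)}\bigr)\quad\text{and}\quad\mathrm{MISE}(\hat q_N)=\mathcal{O}\bigl(N^{-2/(d+2)}\bigr).$$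
   Context: Conditions on kernel, bandwidth and density: (i) $K:\mathbb{R}^d\to[0,\infty)$, $K\in L^1(\mathbb{R}^d)\cap L^2(\mathbb{R}^d)$, $\int K(u)\,\mathrm{d}u=1$, $\int uK(u)\,\mathrm{d}u=0$, $\int\|u\|^2|K(u)|\,\mathrm{d}u<\infty$. (ii) The bandwidth $h=h_N>0$ satisfies $h_N\to0$ and $Nh_N^d\to\infty$ as $N\to\infty$. (iii) $p\in W^{2,1}(\mathbb{R}^d)\cap W^{2,2}(\mathbb{R}^d)$, i.e. $p$ and its weak derivatives up to order 2 are integrable and square-integrable. Standing assumption: $p$ is strictly positive. $\mathrm{MIAE}(\hat q_N)=\mathbb{E}\int_{\mathbb{R}^d}|\hat q_N(x)-p(x)|\,\mathrm{d}x$ and $\mathrm{MISE}(\hat q_N)=\mathbb{E}\int_{\mathbb{R}^d}(\hat q_N(x)-p(x))^2\,\mathrm{d}x$. $\mathcal{O}(\cdot)$ is as $N\to\infty$; $a_N\asymp b_N$ means that $a_N/b_N$ is bounded above and below by positive constants. For a transition kernel $T$ and measurable $g$, $T[g](x)=\int g(y)\,T(x,\mathrm{d}y)$. $\mathbb{E}_\mu[g]=\int g\,\mathrm{d}\mu$. Markov chain and kernel conditions: $(Z_k)_{k\in\mathbb{N}}$ is a Markov chain in $\mathbb{R}^d$ with $Z_1\sim\mu_1\in\mathcal{P}(\mathbb{R}^d)$, time-homogeneous transition kernel $T$ and invariant distribution $P$ such that $T$ is $P$-irreducible, aperiodic and Harris recurrent. Moreover: (SSC) Small set condition: there exist a Borel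 set $J$ with $P(J)>0$, a constant $\beta>0$ and $\nu\in\mathcal{P}(\mathbb{R}^d)$ such that $T(x,A)\ge\beta\nu(A)$ for all $x\in J$ and all Borel sets $A\subseteq\mathbb{R}^d$. (DC) Drift condition: there exist $V:\mathbb{R}^d\to[1,\infty)$ and constants $\lambda\in(0,1)$, $b>0$ such that for all $x\in\mathbb{R}^d$, $T[V](x)\le\lambda V(x)\mathbf{1}_{\{x\notin J\}}+b\,\mathbf{1}_{\{x\in J\}}$, with $J$ from (SSC). Moreover $\mathbb{E}_{\mu_1}[V]\le\frac b{1-\lambda}$. (KMC) Kernel moment condition: $K\in L^4(\mathbb{R}^d)$, and for all $r\in\{1,2,4\}$ there is a constant $B_r=B_r(V,K)>0$ such that for every $0<h\le1$, $$\int_{\mathbb{R}^d}\sup_{y\in\mathbb{R}^d}|K_h(x,y)|^rV^{-r/2}(y)\,\mathrm{d}x\le\frac{B_r}{h^{rd}}.$$ *)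

(* Defs.v *)
From HB Require Import structures.
From mathcomp Require Import all_boot all_order all_algebra.
From mathcomp Require Import all_classical all_reals all_analysis.
From mathcomp Require Import measurable_realfun.

Set Implicit Arguments.
Unset Strict Implicit.
Unset Printing Implicit Defensive.

Import Order.TTheory GRing.Theory Num.Theory.
Import numFieldNormedType.Exports.

Local Open Scope classical_set_scope.
Local Open Scope ring_scope.

(* R^d is 'rV[R]_d, measured by its Borel sigma-algebra. *)
HB.instance Definition _ (R : realType) (d : nat) :=
  Measurable.copy 'rV[R]_d (g_sigma_algebraType (@open 'rV[R]_d)).

Section lebesgue_rV.
Context {R : realType}.

Lemma open_measurable_rV d (U : set 'rV[R]_d) : open U -> measurable U.
Proof. exact: sub_sigma_algebra. Qed.

Lemma measurable_coord_rV d (i : 'I_d) :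
  measurable_fun [set: 'rV[R]_d] (fun v : 'rV[R]_d => v 0 i).
Proof.
apply: (measurability _ (RGenOpens.measurableE R)) => //.
move=> _ [_ [a [b ->] <-]]; rewrite setTI.
apply: open_measurable_rV.
by apply: open_comp; [move=> v _; exact: coord_continuous|exact: interval_open].
Qed.

Let rat_box d (k : 'rV[rat]_d * nat) : set 'rV[R]_d :=
  [set v | forall i, `|v 0 i - ratr (k.1 0 i)| < k.2.+1%:R^-1].

Let open_rat_box d (U : set 'rV[R]_d) : open U ->
  U = \bigcup_(k in [set k | rat_box k `<=` U]) rat_box k.
Proof.
move=> oU; apply/seteqP; split => [v Uv|v [k kU /kU//]].
have /nbhs_ballP[e /= e0 veU] : nbhs v U by exact: open_nbhs_nbhs.
pose n := Num.truncn (2 / e).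
have ne : n.+1%:R^-1 < e / 2.
  rewrite -[ltRHS]invrK ltf_pV2 ?posrE ?invr_gt0 ?divr_gt0//.
  by rewrite invf_div truncnS_gt.
have n0 : 0 < n.+1%:R^-1 :> R by rewrite invr_gt0.
have /choice[q vq] i : exists q : rat, `|v 0 i - ratr q| < n.+1%:R^-1.
  have [|x [vx [q _ qx]]] :=
      @dense_rat R (ball (v 0 i) n.+1%:R^-1) _ (ball_open _ _).
    by exists (v 0 i); exact: ballxx.
  by exists q; rewrite qx; move: vx; rewrite -ball_normE.
exists (\row_i q i, n) => /=.
- move=> w /= wq; apply: veU; split => // j i; rewrite (ord1 j).
  rewrite -ball_normE /=.
  have := wq i; have := vq i; rewrite mxE => vqi wqi.
  rewrite -(subrKA (ratr (q i))) (le_lt_trans (ler_normD _ _))//.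
  by rewrite (distrC _ (w 0 i)) (splitr e) ltrD// (lt_trans _ ne).
- by move=> i; rewrite mxE.
Unshelve. all: by []. Qed.

Lemma measurable_fun_rVP d0 (T : measurableType d0) d (f : T -> 'rV[R]_d) :
  measurable_fun setT f <-> forall i, measurable_fun setT (fun x => f x 0 i).
Proof.
split=> [mf i|mf].
  exact: (measurableT_comp (@measurable_coord_rV d i)).
apply: (measurability _ (erefl (@measurable _ 'rV[R]_d))) => //.
move=> _ [U /open_rat_box -> <-]; rewrite setTI preimage_bigcup bigcup_mkcond.
apply: countable_bigcupT_measurable => [|k]; first exact: countableP.
case: ifPn => // _.
rewrite [X in measurable X](_ : _ = \bigcap_(i in [set: 'I_d])
    [set x | `|f x 0 i - ratr (k.1 0 i)| < k.2.+1%:R^-1]); last first.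
  by apply/seteqP; split=> [x fx i _|x fx i]; exact: fx.
apply: fin_bigcap_measurable => // i _.
rewrite -[X in measurable X]setTI.
have mg : measurable_fun setT (fun x => `|f x 0 i - ratr (k.1 0 i)| : R).
  by apply: measurableT_comp => //; exact: measurable_funB.
rewrite [X in measurable (_ `&` X)](_ : _ = (fun x => `|f x 0 i - ratr (k.1 0 i)|) @^-1` `]-oo, k.2.+1%:R^-1[%classic).
  by apply: mg => //; exact: measurable_itv.
by apply/seteqP; split=> x; rewrite /= in_itv.
Qed.


Definition rV_cons d (xv : R * 'rV[R]_d) : 'rV[R]_d.+1 :=
  row_mx (const_mx xv.1 : 'rV_1) xv.2.

Let rV_uncons d (v : 'rV[R]_d.+1) : R * 'rV[R]_d :=
  (v 0 0, rsubmx (v : 'rV_(1 + d))).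

Let rV_consK d : cancel (@rV_cons d) (@rV_uncons d).
Proof.
move=> [x v]; rewrite /rV_uncons /rV_cons /= row_mxKr; congr pair.
rewrite -[RHS](mxE const_mx_key (fun _ _ => x) (0 : 'I_1) (0 : 'I_1)).
rewrite -[RHS](row_mxEl (const_mx x : 'rV_1) v).
by congr (row_mx _ _ _ _); exact: val_inj.
Qed.

Let measurable_rV_uncons d : measurable_fun setT (@rV_uncons d).
Proof.
apply/measurable_fun_pair; first exact: measurable_coord_rV.
apply/measurable_fun_rVP => i; under eq_fun do rewrite mxE.
exact: measurable_coord_rV.
Qed.

Lemma measurable_rV_cons d : measurable_fun setT (@rV_cons d).
Proof.
apply/measurable_fun_rVP => i.
have [j ij|j ij] := split_ordP (i : 'I_(1 + d)).
  rewrite (_ : (fun _ => _) = fst)//; apply/funext => -[x v].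
  by rewrite ij; apply: etrans (row_mxEl _ _ _ _) _; rewrite mxE.
rewrite (_ : (fun _ => _) = (fun v : 'rV_d => v 0 j) \o snd).
  exact: (measurableT_comp (@measurable_coord_rV d j)).
by apply/funext => -[x v]; rewrite ij; exact: row_mxEr.
Qed.

Section lebesgue_cons.
Variables (d : nat) (m : {sigma_finite_measure set 'rV[R]_d -> \bar R}).

Definition lebesgue_cons : set 'rV[R]_d.+1 -> \bar R :=
  pushforward (lebesgue_measure \x m)%E (@rV_cons d).

Let measurable_preimage_cons A : measurable A -> measurable (@rV_cons d @^-1` A).
Proof. by move=> mA; rewrite -[X in measurable X]setTI; exact: measurable_rV_cons. Qed.

Let lebesgue_cons0 : lebesgue_cons set0 = 0%E.
Proof. by rewrite /lebesgue_cons /pushforward preimage_set0 measure0. Qed.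

Let lebesgue_cons_ge0 A : (0 <= lebesgue_cons A)%E.
Proof. by rewrite /lebesgue_cons /pushforward measure_ge0. Qed.

Let lebesgue_cons_sigma_additive : semi_sigma_additive lebesgue_cons.
Proof.
move=> F mF tF mUF; rewrite /lebesgue_cons /pushforward preimage_bigcup.
apply: measure_semi_sigma_additive => [n||].
- exact: measurable_preimage_cons.
- apply/trivIsetP => i j _ _ ij; rewrite -preimage_setI.
  by move/trivIsetP : tF => /(_ _ _ _ _ ij) ->//; rewrite preimage_set0.
- by rewrite -preimage_bigcup; exact: measurable_preimage_cons.
Qed.

HB.instance Definition _ := isMeasure.Build _ _ _ lebesgue_cons
  lebesgue_cons0 lebesgue_cons_ge0 lebesgue_cons_sigma_additive.

Let lebesgue_cons_sigma_finite : sigma_finite setT lebesgue_cons.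
Proof.
have /sigma_finiteP[F [TF ndF Foo]] := sigma_finiteT (@lebesgue_measure R).
have /sigma_finiteP[G [TG ndG Goo]] := sigma_finiteT m.
exists (fun n => @rV_uncons d @^-1` (F n `*` G n)).
  rewrite -preimage_bigcup (_ : \bigcup_i _ = setT) ?preimage_setT//.
  apply/seteqP; split=> // -[x y] _.
  have [n _ Fnx] : (\bigcup_i F i) x by rewrite -TF.
  have [k _ Gky] : (\bigcup_i G i) y by rewrite -TG.
  exists (maxn n k) => //; split => /=.
  - by move: x Fnx; exact/subsetPset/ndF/leq_maxl.
  - by move: y Gky; exact/subsetPset/ndG/leq_maxr.
move=> k; have [? ?] := Foo k; have [? ?] := Goo k; split.
  rewrite -[X in measurable X]setTI; apply: measurable_rV_uncons => //.
  exact: measurableX.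
rewrite /lebesgue_cons /pushforward -comp_preimage.
rewrite (_ : _ \o _ = id); last by apply/funext => x /=; rewrite rV_consK.
by rewrite preimage_id product_measure1E// lte_mul_pinfty// ge0_fin_numE.
Qed.

HB.instance Definition _ := Measure_isSigmaFinite.Build _ _ _ lebesgue_cons
  lebesgue_cons_sigma_finite.

End lebesgue_cons.

(* Lebesgue measure on R^d, as the d-fold product of Lebesgue measure on R. *)
Fixpoint lebesgue_rV (d : nat) : {sigma_finite_measure set 'rV[R]_d -> \bar R} :=
  if d is d'.+1 then lebesgue_cons (lebesgue_rV d') else \d_(0 : 'rV[R]_0).

Lemma lebesgue_rV_box d (A : 'I_d -> set R) : (forall i, measurable (A i)) ->
  lebesgue_rV d [set v | forall i, A i (v 0 i)] =
  (\prod_(i < d) (@lebesgue_measure R) (A i))%E.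
Proof.
elim: d A => [|d IH] A mA; first by rewrite big_ord0 /= diracE mem_set//= => -[].
rewrite big_ord_recl -IH//.
pose B := [set v : 'rV[R]_d | forall i, A (lift ord0 i) (v 0 i)].
have mB : measurable B.
  rewrite (_ : B = \bigcap_(i in [set: 'I_d])
      (fun v : 'rV[R]_d => v 0 i) @^-1` A (lift ord0 i)).
    apply: fin_bigcap_measurable => // i _; rewrite -[X in measurable X]setTI.
    exact: measurable_coord_rV.
  by apply/seteqP; split => v Bv i; [move=> _|]; exact: Bv.
apply: etrans (product_measure1E lebesgue_measure (lebesgue_rV d) (mA ord0) mB).
rewrite /=.
rewrite /lebesgue_cons /pushforward; congr (_ \x _)%E.
have cons0 x (v : 'rV[R]_d) : rV_cons (x, v) 0 ord0 = x.
  by have := rV_consK (x, v) => /(congr1 fst).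
have consS x (v : 'rV[R]_d) i : rV_cons (x, v) 0 (lift ord0 i) = v 0 i.
  have /(congr1 (fun u : R * 'rV[R]_d => u.2 0 i)) := rV_consK (x, v); rewrite /= mxE => <-.
  by congr (rV_cons _ _ _); exact: val_inj.
apply/seteqP; split=> -[x v] /=.
  by move=> Axv; split => [|i]; [rewrite -[x](cons0 x v)|rewrite -(consS x v)].
move=> [Ax Bv] i; have [j ->|->] := unliftP ord0 i; last by rewrite cons0.
by rewrite consS; exact: Bv.
Qed.

End lebesgue_rV.

Section analysis_rV.
Context {R : realType} {d : nat}.
Notation Rd := 'rV[R]_d.
Implicit Types (f g K p : Rd -> R).

Definition enorm (u : Rd) : R := Num.sqrt (\sum_(i < d) u 0 i ^+ 2).

(* partials [:: i; j; k] f is the iterated derivative d_i d_j d_k f. *)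
Definition partials (s : seq 'I_d) f : Rd -> R :=
  foldr (fun i g x => 'D_(delta_mx 0 i) g x) f s.

Definition test_function f : Prop :=
  (forall s, continuous (partials s f)) /\
  (forall s i x, derivable (partials s f) x (delta_mx 0 i)) /\
  compact (closure [set x | f x != 0]).

Definition weak_partial (s : seq 'I_d) f g : Prop :=
  forall phi, test_function phi ->
    (\int[lebesgue_rV d]_x (f x * partials s phi x)%:E =
     ((-1) ^+ size s)%:E * \int[lebesgue_rV d]_x (g x * phi x)%:E)%E.

Definition sobolev (k : nat) (q : \bar R) f : Prop :=
  f \in Lfun (lebesgue_rV d) q /\
  forall s, (size s <= k)%N ->
    exists2 g, g \in Lfun (lebesgue_rV d) q & weak_partial s f g.

Definition kernel_condition K : Prop :=
  [/\ forall u, 0 <= K u,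
      K \in Lfun (lebesgue_rV d) 1 /\ K \in Lfun (lebesgue_rV d) 2%:E,
      (\int[lebesgue_rV d]_u (K u)%:E = 1)%E,
      forall i, (\int[lebesgue_rV d]_u (u 0 i * K u)%:E = 0)%E &
      (\int[lebesgue_rV d]_u (enorm u ^+ 2 * `|K u|)%:E < +oo)%E].

Definition density_condition p : Prop := sobolev 2 1 p /\ sobolev 2 2%:E p.

Definition has_density (P : probability Rd R) p : Prop :=
  forall A, measurable A -> (P A = \int[lebesgue_rV d]_(x in A) (p x)%:E)%E.

Definition Kh K (h : R) (x y : Rd) : R := (h ^+ d)^-1 * K (h^-1 *: (x - y)).

End analysis_rV.

Section bandwidth.
Context {R : realType}.
Implicit Types (a b h : nat -> R) (u : nat -> \bar R).

(* Sequences indexed by the sample size N are only considered for N >= 1. *)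
Definition positive_seq a : Prop := forall N, (0 < N)%N -> 0 < a N.

Definition bandwidth_condition (d : nat) h : Prop :=
  [/\ positive_seq h, h @ \oo --> 0 &
      (fun N => N%:R * h N ^+ d) @ \oo --> +oo].

Definition asymp a b : Prop :=
  exists c C, [/\ 0 < c, 0 < C &
    forall N, (0 < N)%N -> c <= a N / b N <= C].

Definition bigO_ereal u b : Prop :=
  (\forall N \near \oo, u N \is a fin_num) /\
  (fun N => fine (u N)) =O_\oo b.

(* h attains, up to a constant factor, the smallest order of magnitude of
   B N (h N) among all bandwidth sequences. *)
Definition rate_optimal (B : nat -> R -> R) h : Prop :=
  forall h', positive_seq h' ->
    (fun N => B N (h N)) =O_\oo (fun N => B N (h' N)).

End bandwidth.

Section markov.
Context {d} {E : measurableType d} {R : realType}.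
Implicit Types (T : R.-pker E ~> E) (P mu : probability E R).

Definition invariant_distribution T P : Prop :=
  forall A, measurable A -> (P A = \int[P]_x T x A)%E.

Fixpoint kernel_iter T (n : nat) (x : E) (A : set E) : \bar R :=
  if n is m.+1 then (\int[T x]_y kernel_iter T m y A)%E else \d_x A.

Definition irreducible_kernel T P : Prop :=
  forall A, measurable A -> (0 < P A)%E ->
  forall x, exists n, (0 < kernel_iter T n.+1 x A)%E.

(* No n-cycle of disjoint sets of positive measure with n >= 2; ordS is the
   successor modulo n. *)
Definition aperiodic_kernel T P : Prop :=
  ~ exists n (D : 'I_n -> set E),
    [/\ (1 < n)%N,
        forall i, measurable (D i),
        trivIset setT D,
        forall i, (0 < P (D i))%E &
        forall i x, D i x -> T x (D (ordS i)) = 1%E].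

(* The probability that the chain started at x (at time 0) lies in the k-th set
   of As at time k, for all k from 1 to size As. *)
Fixpoint path_prob T (As : seq (set E)) (x : E) : \bar R :=
  if As is A :: As' then (\int[T x]_(y in A) path_prob T As' y)%E else 1%E.

(* From every starting point, A is almost surely reached at some time >= 1: the
   probability of avoiding A during the first n steps vanishes as n grows. *)
Definition harris_recurrent T P : Prop :=
  forall A, measurable A -> (0 < P A)%E ->
  forall x, path_prob T (nseq n (~` A)) x @[n --> \oo] --> 0%E.

Definition small_set T P (J : set E) (beta : R) (nu : probability E R) : Prop :=
  [/\ measurable J, (0 < P J)%E, 0 < beta &
      forall x, J x -> forall A, measurable A -> (beta%:E * nu A <= T x A)%E].

Definition drift T mu1 (J : set E) (V : E -> R) (lambda b : R) : Prop :=
  [/\ measurable_fun setT V /\ (forall x, 1 <= V x),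
      0 < lambda < 1, 0 < b,
      forall x, (\int[T x]_y (V y)%:E <=
        (lambda * V x * \1_(~` J) x + b * \1_J x)%:E)%E &
      (\int[mu1]_x (V x)%:E <= (b / (1 - lambda))%:E)%E].

(* Z k stands for Z_(k+1): the time index starts at 0 instead of 1. *)
Context {d'} {Omega : measurableType d'} (Pr : probability Omega R).

(* The sigma-algebra generated by Z 0, Z 1, up to Z n. *)
Definition past (Z : nat -> {RV Pr >-> E}) (n : nat) : set (set Omega) :=
  <<s \bigcup_(k in [set k | (k <= n)%N])
        preimage_set_system setT (Z k) measurable >>.

(* The second clause says that T (Z n) A is a version of the conditional
   probability of {Z n.+1 \in A} given the past up to time n. *)
Definition markov_chain (Z : nat -> {RV Pr >-> E}) mu1 T : Prop :=
  (forall A, measurable A -> distribution Pr (Z 0) A = mu1 A) /\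
  (forall n F A, past Z n F -> measurable A ->
    Pr (F `&` Z n.+1 @^-1` A) = \int[Pr]_(w in F) T (Z n w) A)%E.

End markov.

(* The supremum need not be measurable in x; the library then reads the outer
   integral as a lower integral (supremum over simple functions below). *)
Definition kernel_moment_condition {R : realType} {d : nat}
    (K V : 'rV[R]_d -> R) : Prop :=
  K \in Lfun (lebesgue_rV d) 4%:E /\
  forall r : nat, r \in [:: 1; 2; 4]%N -> exists2 B : R, 0 < B &
    forall h : R, 0 < h <= 1 ->
      (\int[lebesgue_rV d]_x ereal_sup
         (range (fun y => (`|Kh K h x y| ^+ r * V y `^ (- (r%:R / 2)))%:E))
       <= (B / h ^+ (r * d))%:E)%E.

Section kde.
Context {R : realType} {d : nat} {d'} {Omega : measurableType d'}.
Context {Pr : probability Omega R}.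
Variables (K p : 'rV[R]_d -> R) (h : nat -> R) (Z : nat -> {RV Pr >-> 'rV[R]_d}).

Definition kde (N : nat) (w : Omega) (x : 'rV[R]_d) : R :=
  N%:R^-1 * \sum_(k < N) Kh K (h N) (Z k w) x.

Definition MIAE (N : nat) : \bar R :=
  (\int[Pr]_w \int[lebesgue_rV d]_x `|kde N w x - p x|%:E)%E.

Definition MISE (N : nat) : \bar R :=
  (\int[Pr]_w \int[lebesgue_rV d]_x ((kde N w x - p x) ^+ 2)%:E)%E.

End kde.

Definition MIAE_bound {R : realType} (d N : nat) (h : R) : R :=
  (Num.sqrt (N%:R * h ^+ (2 * d)))^-1 + h ^+ 2.

Definition MISE_bound {R : realType} (d N : nat) (h : R) : R :=
  (N%:R * h ^+ (2 * d))^-1 + h ^+ 4.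

Definition optimal_rate {R : realType} (d N : nat) : R :=
  N%:R `^ (- (2 * d + 4)%:R^-1).

(* Main.v *)
(* Write W = sqrt V. The r = 1, h = 1 case of the moment condition makes the
   suprema of K and of 1/W over unit cells summable, which yields envelopes
   K ((y - x) / h) <= Phi_h x * W y with Phi_h bounded and integrable uniformly
   in h <= 1; at a fixed point x the estimator thus averages along the chain a
   function dominated by a multiple of W.
   Variance: by drift and small set conditions the resolvent of the kernel
   T - beta 1_J nu is bounded in the W-norm, hence the Poisson equation
   g - T g = f - P f has a solution dominated by W, and expanding the square of
   the partial sums with it bounds their second moment linearly in N.
   Bias: testing against products of bump functions shows that functions with
   weak derivatives satisfy the fundamental theorem of calculus along almost
   every segment, so the first order Taylor remainder of p in direction v has
   L^q norm of order |v|^2; the first moment of K vanishes, and its second moment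
   is finite.
   Bandwidth: with rho_N = N^(-1/(2d+4)) and q = h_N / rho_N both bounds equal
   rho_N^k (q^(-m) + q^n) for fixed exponents, which is of least order exactly
   when q stays between two positive constants. *)
Require Import Defs.
From HB Require Import structures.
From mathcomp Require Import all_boot all_order all_algebra.
From mathcomp Require Import all_classical all_reals all_analysis.
From mathcomp Require Import measurable_realfun.
From mathcomp Require Import ring lra zify.

Set Implicit Arguments.
Unset Strict Implicit.
Unset Printing Implicit Defensive.

Import Order.TTheory GRing.Theory Num.Theory.
Import numFieldNormedType.Exports.

Local Open Scope classical_set_scope.
Local Open Scope ring_scope.

(** * Integration *)

(** The weight is the square root of [V] because squares of functions dominated by [W] are dominated
    by [V], whose mean along the chain stays below [b / (1 - lambda)], while Jensen's inequality
    preserves a drift inequality for [W]. The supremum in the moment condition may be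
    non-measurable. It is therefore used only as an upper bound under a lower integral, and a
    measurable envelope is rebuilt as a countable series over unit cells. This envelope explains the
    power h^(2d) in the variance term: Phi_h is bounded and integrable uniformly in h, with no gain
    of a factor h^d, so both factors h^(-d) of the squared kernel survive the integration over x.
    The chain may start from a law other than P. Variance thus means second moment around the mean
    under P, and this already contains the effect of the initial law. The bias is estimated once for
    an exponent q in {1, 2}; q = 1 serves the MIAE and q = 2 the MISE. *)

Section toolkit.
Context {R : realType}.
Import HBNNSimple.
Local Open Scope ereal_scope.

(** Every such function is an increasing limit of simple functions, which are nonnegative
    combinations of indicators. Identities known on sets (density, invariance, Markov property) are
    extended to integrals through this principle. *)
Lemma ge0_measurable_ind d (T : measurableType d) (P : (T -> \bar R) -> Prop) :
  (forall A, measurable A -> P (fun x => (\1_A x)%:E)) ->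
  (forall (k : R) f, (0 <= k)%R -> measurable_fun setT f -> (forall x, 0 <= f x) ->
    P f -> P (fun x => k%:E * f x)) ->
  (forall f g, measurable_fun setT f -> measurable_fun setT g ->
    (forall x, 0 <= f x) -> (forall x, 0 <= g x) -> P f -> P g ->
    P (fun x => f x + g x)) ->
  (forall f : (T -> \bar R)^nat, (forall n, measurable_fun setT (f n)) ->
    (forall n x, 0 <= f n x) ->
    (forall x, {homo f ^~ x : n m / (n <= m)%N >-> n <= m}) ->
    (forall n, P (f n)) -> P (fun x => limn (f ^~ x))) ->
  forall f, measurable_fun setT f -> (forall x, 0 <= f x) -> P f.
Proof.
move=> P1 PZ PD Plim f mf f0.
have P0 : P (fun=> 0).
  rewrite (_ : (fun=> 0) = (fun x => (\1_(@set0 T) x)%:E)); first exact: P1.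
  by apply/funext => x; rewrite indic0.
have Psum (s : seq R) (h : {nnsfun T >-> R}) :
    P (fun x => \sum_(r <- s) (r * \1_(h @^-1` [set r]) x)%:E).
  have mi r : measurable_fun setT (fun x => (r * \1_(h @^-1` [set r]) x)%:E).
    by apply/measurable_EFinP; apply: measurable_funM => //; exact: measurable_indic.
  have i0 r x : 0 <= (r * \1_(h @^-1` [set r]) x)%:E.
    rewrite lee_fin indicE; have [xr|] := boolP (x \in _); last by rewrite mulr0.
    by rewrite mulr1; move: xr; rewrite inE /= => <-.
  elim: s => [|r s IH]; first by under eq_fun do rewrite big_nil.
  under eq_fun do rewrite big_cons.
  apply: (PD (fun x => (r * \1_(h @^-1` [set r]) x)%:E) _) => //.
  - by apply: emeasurable_sum => i; exact: mi.
  - by move=> x; apply: sume_ge0.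
  (* A negative [r] is not a value of the nonnegative [h], so its term is zero. *)
  - have [r0|r0] := leP 0%R r.
      under eq_fun do rewrite EFinM.
      apply: PZ; [by []|by apply/measurable_EFinP; exact: measurable_indic|by move=> x; rewrite lee_fin|exact: P1].
    rewrite (_ : (fun _ => _) = fun=> 0)//; apply/funext => x.
    apply/eqP; rewrite eq_le i0 andbT lee_fin.
    by rewrite nmulr_rle0.
pose g := nnsfun_approx measurableT mf.
have -> : f = (fun x => limn (fun n => (g n x)%:E)).
  apply/funext => x; apply/esym/cvg_lim => //.
  exact: (cvg_nnsfun_approx measurableT mf).
apply: Plim => [n|n x|x m n mn|n].
- exact/measurable_EFinP.
- by rewrite lee_fin.
- by rewrite lee_fin; exact/lefP/nd_nnsfun_approx.
- rewrite (_ : (fun _ => _) = (fun x => \sum_(r <- finmap.enum_fset (fset_set (range (g n))))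
      (r * \1_(g n @^-1` [set r]) x)%:E)); first exact: Psum.
  apply/funext => x; rewrite fimfunE sumEFin; congr (_%:E).
  by rewrite fsbig_finite.
Qed.

(* A supremum of simple functions below: no measurability of [g] is needed. *)
Lemma ge0_le_integral_nonmeas d (T : measurableType d)
    (mu : {measure set T -> \bar R}) (f g : T -> \bar R) :
  (forall x, 0 <= f x) -> (forall x, f x <= g x) ->
  \int[mu]_x f x <= \int[mu]_x g x.
Proof.
move=> f0 fg; have g0 x : 0 <= g x by exact: le_trans (f0 x) (fg x).
rewrite !ge0_integralTE//; apply: ereal_sup_le => _ [h hf <-].
by exists h => // x; exact: le_trans (hf x) (fg x).
Qed.

(** Trivial for q = 1. For q = 2 it is the Cauchy-Schwarz inequality, obtained by optimising a
    quadratic inequality in a free parameter. *)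
Lemma weighted_jensen q d (Y : measurableType d)
    (m : {measure set Y -> \bar R}) (g w : Y -> R) (M : R) :
  q \in [:: 1; 2]%N ->
  measurable_fun setT g -> measurable_fun setT w ->
  (forall y, 0 <= g y)%R -> (forall y, 0 <= w y)%R ->
  \int[m]_y (w y)%:E <= M%:E ->
  (\int[m]_y (g y * w y)%:E) ^+ q <=
    (M ^+ q.-1)%:E * \int[m]_y (g y ^+ q * w y)%:E.
Proof.
move=> hq mg mw g0 w0 wM.
have M0 : (0 <= M)%R.
  by rewrite -lee_fin; apply: le_trans wM; apply: integral_ge0 => y _; rewrite lee_fin.
move: hq; rewrite !inE => /orP[/eqP ->|/eqP ->] /=.
  by rewrite expr0 mul1e; exact: lexx.
rewrite expr1.
set I := \int[m]_y (g y * w y)%:E; set B := \int[m]_y _.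
have I0 : 0 <= I by apply: integral_ge0 => y _; rewrite lee_fin mulr_ge0.
have B0 : 0 <= B by apply: integral_ge0 => y _; rewrite lee_fin mulr_ge0// exprn_ge0.
(* This is 2 c g <= c^2 + g^2 integrated against [w]. The choice c = I / M made below gives the
   claim. *)
have key (c : R) : (0 <= c)%R -> (2 * c)%:E * I <= (c ^+ 2 * M)%:E + B.
  move=> c0; rewrite -ge0_integralZl//; last 3 first.
    - by apply/measurable_EFinP; exact: measurable_funM.
    - by move=> y _; rewrite lee_fin mulr_ge0.
    - by rewrite lee_fin mulr_ge0.
  apply: (@le_trans _ _ (\int[m]_y ((c ^+ 2)%:E * (w y)%:E + (g y ^+ 2 * w y)%:E))).
    apply: ge0_le_integral_nonmeas => y.
      by rewrite -EFinM lee_fin !mulr_ge0.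
    rewrite -!EFinM -EFinD lee_fin mulrA -mulrDl ler_wpM2r//.
    by rewrite -subr_ge0 (_ : _ - _ = (c - g y) ^+ 2)%R ?sqr_ge0//; ring.
  rewrite ge0_integralD//; last 4 first.
    - by move=> y _; rewrite -EFinM lee_fin mulr_ge0// sqr_ge0.
    - by apply/measurable_EFinP; exact: measurable_funM.
    - by move=> y _; rewrite lee_fin mulr_ge0// sqr_ge0.
    - apply/measurable_EFinP; apply: measurable_funM => //.
      exact: measurable_funX.
  rewrite leeD2r// ge0_integralZl//; last 3 first.
    - exact/measurable_EFinP.
    - by move=> y _; rewrite lee_fin.
    - by rewrite lee_fin sqr_ge0.
  by rewrite [leRHS]EFinM lee_wpmul2l// lee_fin sqr_ge0.
(* If B is infinite, M = 0 must be treated apart since 0 times infinity is 0: then [w] vanishes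
   almost everywhere and so does I. *)
have [Boo|Bfin] := eqVneq B +oo.
  have [M00|M00] := eqVneq M 0%R.
    rewrite (_ : I = 0) ?expe2 ?mul0e ?mule_ge0// ?lee_fin//.
    rewrite /I; have mw0 : {ae m, forall y, setT y -> (w y)%:E = 0}.
      apply/(ae_eq_integral_abs m measurableT) => //; first exact/measurable_EFinP.
      under eq_integral do rewrite gee0_abs ?lee_fin//.
      apply/eqP; rewrite eq_le; apply/andP; split; first by have := wM; rewrite M00.
      by apply: integral_ge0 => y _; rewrite lee_fin.
    rewrite (ae_eq_integral (cst 0)) ?integral0//.
      by apply/measurable_EFinP; exact: measurable_funM.
    by apply: filterS mw0 => y wy0 _; rewrite EFinM (wy0 Logic.I) mule0.
  by rewrite Boo gt0_muley ?leey// lte_fin lt0r M00.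
have {}Bfin : B \is a fin_num by rewrite ge0_fin_numE// ltey.
have Ifin : I \is a fin_num.
  rewrite ge0_fin_numE//; have := key 1%R ler01.
  rewrite ltey; apply: contraTneq => ->.
  rewrite gt0_muley ?lte_fin ?mulr1// -ltNge.
  by rewrite expr1n mul1r -(fineK Bfin) ltry.
rewrite -(fineK Bfin) -(fineK Ifin) -!EFinM lee_fin -expr2.
have i0 : (0 <= fine I)%R by exact: fine_ge0.
have b0 : (0 <= fine B)%R by exact: fine_ge0.
have kk c : (0 <= c -> 2 * c * fine I <= c ^+ 2 * M + fine B)%R.
  by move=> /key; rewrite -(fineK Bfin) -(fineK Ifin) -EFinM -EFinD lee_fin.
move: kk i0 b0; move: (fine I) (fine B) => i b kk i0 b0.
have [M00|M00] := eqVneq M 0%R.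
  have [->|in0] := eqVneq i 0%R; first by rewrite expr0n/= mulr_ge0.
  (* With M = 0 the inequality says 2 c i <= b for all c >= 0; this c turns the left side into b +
     1, a contradiction. *)
  have := kk ((b + 1) / (2 * i))%R; rewrite divr_ge0 ?mulr_ge0 ?addr_ge0// => /(_ isT).
  rewrite M00 mulr0 add0r.
  rewrite (_ : 2 * _ * i = b + 1)%R; last by field.
  by rewrite gerDl ler10.
have Mp : (0 < M)%R by rewrite lt0r M00.
have := kk (i / M)%R; rewrite divr_ge0// => /(_ isT).
rewrite -(ler_pM2r Mp) [leRHS]mulrDl.
rewrite (_ : 2 * (i / M) * i * M = 2 * i ^+ 2)%R; last by field.
rewrite (_ : (i / M) ^+ 2 * M * M = i ^+ 2)%R; last by field.
by rewrite (mulrC b); lra.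
Qed.

(** A substitute for Minkowski's integral inequality: Jensen for the inner integral, then Tonelli.
    It serves twice, with the weight [w] the indicator of [0, 1] and with [w u] = K(u) |u|^2. *)
Lemma integral_weighted_pow_le q d1 d2 (X : measurableType d1) (Y : measurableType d2)
    (mu : {sigma_finite_measure set X -> \bar R})
    (m : {sigma_finite_measure set Y -> \bar R})
    (g : X * Y -> R) (w C : Y -> R) (M : R) :
  q \in [:: 1; 2]%N ->
  measurable_fun setT g -> measurable_fun setT w ->
  (forall z, 0 <= g z)%R -> (forall y, 0 <= w y)%R ->
  \int[m]_y (w y)%:E <= M%:E ->
  (forall y, \int[mu]_x (g (x, y) ^+ q)%:E <= (C y)%:E) ->
  \int[mu]_x (\int[m]_y (g (x, y) * w y)%:E) ^+ q <=
    (M ^+ q.-1)%:E * \int[m]_y (C y * w y)%:E.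
Proof.
move=> hq mg mw g0 w0 wM gC.
have M0 : (0 <= M)%R.
  by rewrite -lee_fin; apply: le_trans wM; apply: integral_ge0 => y _; rewrite lee_fin.
pose F (z : X * Y) := (g z ^+ q * w z.2)%:E.
have mF : measurable_fun setT F.
  apply/measurable_EFinP; apply: measurable_funM; first exact: measurable_funX.
  exact: measurableT_comp.
have F0 z : 0 <= F z by rewrite lee_fin mulr_ge0// exprn_ge0.
apply: (@le_trans _ _ (\int[mu]_x ((M ^+ q.-1)%:E * \int[m]_y F (x, y)))).
  apply: ge0_le_integral_nonmeas => x.
    by apply: expe_ge0; apply: integral_ge0 => y _; rewrite lee_fin mulr_ge0.
  apply: weighted_jensen => //.
  exact: measurableT_comp.
rewrite ge0_integralZl//; last 3 first.
- exact: (measurable_fun_fubini_tonelli_F F).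
- by move=> x _; exact: integral_ge0.
- by rewrite lee_fin exprn_ge0.
apply: lee_wpmul2l; first by rewrite lee_fin exprn_ge0.
rewrite (fubini_tonelli F)//.
apply: ge0_le_integral_nonmeas => y; first exact: integral_ge0.
rewrite /F /=; under eq_integral do rewrite EFinM.
rewrite ge0_integralZr//; last 3 first.
- apply/measurable_EFinP; apply: measurable_funX.
  exact: measurableT_comp.
- by move=> x _; rewrite lee_fin exprn_ge0.
- by rewrite lee_fin.
by rewrite EFinM lee_wpmul2r// lee_fin.
Qed.

(** Both sides integrate [u] against the image under [X1] or [X2] of a measure with density [G1] or
    [G2]. Agreement of these images on sets is the hypothesis, and [ge0_measurable_ind] does the
    rest. *)
Lemma eq_integral_weighted d d1 d2 (E : measurableType d) (Y1 : measurableType d1)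
    (Y2 : measurableType d2) (m1 : {measure set Y1 -> \bar R})
    (m2 : {measure set Y2 -> \bar R}) (X1 : Y1 -> E) (X2 : Y2 -> E)
    (G1 : Y1 -> R) (G2 : Y2 -> R) (u : E -> \bar R) :
  measurable_fun setT X1 -> measurable_fun setT X2 ->
  measurable_fun setT G1 -> measurable_fun setT G2 ->
  (forall w, 0 <= G1 w)%R -> (forall w, 0 <= G2 w)%R ->
  (forall B, measurable B ->
    \int[m1]_(w in X1 @^-1` B) (G1 w)%:E = \int[m2]_(w in X2 @^-1` B) (G2 w)%:E) ->
  measurable_fun setT u -> (forall x, 0 <= u x) ->
  \int[m1]_w (u (X1 w) * (G1 w)%:E) = \int[m2]_w (u (X2 w) * (G2 w)%:E).
Proof.
move=> mX1 mX2 mG1 mG2 G10 G20 H; move: u.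
have muG d' (Y : measurableType d') (X : Y -> E) (h : E -> \bar R) (G : Y -> R) :
    measurable_fun setT X -> measurable_fun setT h ->
    measurable_fun setT G -> measurable_fun setT (fun w => h (X w) * (G w)%:E).
  move=> mX mh mG; apply: emeasurable_funM; first exact: measurableT_comp.
  exact/measurable_EFinP.
have uG0 (Y : Type) (X : Y -> E) (h : E -> \bar R) (G : Y -> R) : (forall x, 0 <= h x) ->
    (forall w, 0 <= G w)%R -> forall w, 0 <= h (X w) * (G w)%:E.
  by move=> h0 G0 w; rewrite mule_ge0// lee_fin.
apply: (@ge0_measurable_ind _ _ (fun u => _ = _)).
- move=> B mB; have e d' (Y : measurableType d') (m : {measure set Y -> \bar R})
      (X : Y -> E) (G : Y -> R) :
    \int[m]_w ((\1_B (X w))%:E * (G w)%:E) = \int[m]_(w in X @^-1` B) (G w)%:E.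
    rewrite [RHS]integral_mkcond; apply: eq_integral => w _.
    rewrite patchE indicE; have [wB|wB] := boolP (w \in X @^-1` B).
      by move: wB; rewrite inE => wB; rewrite mem_set// mul1e.
    by rewrite memNset ?mul0e// => h; move: wB; rewrite mem_set.
  by rewrite !e H.
- move=> c f c0 mf f0 IH.
  under eq_integral do rewrite -muleA.
  under [RHS]eq_integral do rewrite -muleA.
  rewrite (ge0_integralZl m1 measurableT (muG _ _ _ _ _ mX1 mf mG1) (fun w _ => uG0 _ _ _ _ f0 G10 w)) ?lee_fin// IH.
  by rewrite (ge0_integralZl m2 measurableT (muG _ _ _ _ _ mX2 mf mG2) (fun w _ => uG0 _ _ _ _ f0 G20 w)) ?lee_fin.
- move=> f g mf mg f0 g0 IHf IHg.
  under eq_integral do rewrite ge0_muleDl//.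
  under [RHS]eq_integral do rewrite ge0_muleDl//.
  rewrite (ge0_integralD m1 measurableT (fun w _ => uG0 _ _ _ _ f0 G10 w) (muG _ _ _ _ _ mX1 mf mG1)
    (fun w _ => uG0 _ _ _ _ g0 G10 w) (muG _ _ _ _ _ mX1 mg mG1)) IHf IHg.
  by rewrite (ge0_integralD m2 measurableT (fun w _ => uG0 _ _ _ _ f0 G20 w) (muG _ _ _ _ _ mX2 mf mG2)
    (fun w _ => uG0 _ _ _ _ g0 G20 w) (muG _ _ _ _ _ mX2 mg mG2)).
- move=> f mf f0 nd IH.
  have e d' (Y : measurableType d') (m : {measure set Y -> \bar R}) (X : Y -> E) (G : Y -> R) :
      measurable_fun setT X -> measurable_fun setT G -> (forall w, 0 <= G w)%R ->
    \int[m]_w (limn (f ^~ (X w)) * (G w)%:E) =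
     limn (fun n => \int[m]_w (f n (X w) * (G w)%:E)).
    move=> mX mG G0; rewrite -monotone_convergence//; last 3 first.
    + by move=> n; exact: (muG _ _ _ _ _ mX (mf n) mG).
    + by move=> n w _; exact: (uG0 _ _ _ _ (f0 n) G0).
    + by move=> w _ p n pn; rewrite lee_wpmul2r ?lee_fin//; exact: nd.
    apply: eq_integral => w _; apply/esym/cvg_lim => //.
    apply: cvgeZr => //; apply: ereal_nondecreasing_is_cvgn => p n pn; exact: nd.
  by rewrite (e _ _ _ _ _ mX1 mG1 G10) (e _ _ _ _ _ mX2 mG2 G20); under eq_fun do rewrite IH.
Qed.

Lemma measurable_section_integral d1 d2 (X : measurableType d1) (Y : measurableType d2)
    (m : {sigma_finite_measure set Y -> \bar R}) (k : X * Y -> R) : measurable_fun setT k ->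
  measurable_fun setT (fun x => fine (\int[m]_t (k (x, t))%:E)).
Proof.
move=> mk; apply: measurableT_comp => //; rewrite (_ : (fun x => _) = (fun x =>
  \int[m]_t (EFin \o k)^\+ (x, t) - \int[m]_t (EFin \o k)^\- (x, t))); last first.
  apply/funext => x; rewrite integralE; congr (_ - _).
    by apply: eq_integral => t _; rewrite !funeposE.
  by apply: eq_integral => t _; rewrite !funenegE.
have mek : measurable_fun setT (EFin \o k) by exact/measurable_EFinP.
apply: emeasurable_funB.
  exact: (measurable_fun_fubini_tonelli_F (m2 := m) _ (measurable_funepos mek) (funepos_ge0 _)).
exact: (measurable_fun_fubini_tonelli_F (m2 := m) _ (measurable_funeneg mek) (funeneg_ge0 _)).
Qed.

End toolkit.

(** * Boxes and affine substitutions *)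

Section box.
Context {R : realType} {d : nat}.
Notation Rd := 'rV[R]_d.
Local Notation leb := (lebesgue_rV d : {measure set Rd -> \bar R}).

Definition box (a b : 'I_d -> R) : set Rd :=
  [set v | forall i, v 0 i \in `]a i, b i[].

Lemma measurable_forall_coord (A : 'I_d -> set R) :
  (forall i, measurable (A i)) -> measurable [set v : Rd | forall i, A i (v 0 i)].
Proof.
move=> mA; rewrite (_ : [set _ | _] = \bigcap_(i in [set: 'I_d])
    (fun v : Rd => v 0 i) @^-1` A i).
  apply: fin_bigcap_measurable => // i _; rewrite -[X in measurable X]setTI.
  exact: measurable_coord_rV.
by apply/seteqP; split => v Bv i; [move=> _|]; exact: Bv.
Qed.

Lemma measurable_box a b : measurable (box a b).
Proof. exact: (measurable_forall_coord (A := fun i => `]a i, b i[%classic)). Qed.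

Definition boxes : set (set Rd) := [set B | exists a b, B = box a b].

Lemma setI_closed_boxes : setI_closed boxes.
Proof.
move=> _ _ [a [b ->]] [a' [b' ->]].
exists (fun i => Num.max (a i) (a' i)), (fun i => Num.min (b i) (b' i)).
apply/seteqP; split=> v.
  move=> [h1 h2] i; move: (h1 i) (h2 i); rewrite !in_itv/= => /andP[? ?] /andP[? ?].
  by rewrite gt_max lt_min; apply/andP; split; apply/andP.
move=> h; split=> i; move: (h i); rewrite !in_itv/= gt_max lt_min => /andP[/andP[? ?] /andP[? ?]];
  exact/andP.
Qed.

Lemma bigcup_box : \bigcup_n box (fun=> - n%:R) (fun=> n%:R) = setT.
Proof.
apply/seteqP; split => // v _.
exists (\max_(i < d) (Num.truncn `|v 0%R i|).+1)%N => //= i.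
rewrite in_itv/= -ltr_norml.
apply: (lt_le_trans (truncnS_gt _)).
by rewrite ler_nat (@leq_bigmax _ (fun i : 'I_d => (Num.truncn `|v 0 i|).+1)).
Qed.

Lemma measurable_rV_boxes : @measurable _ Rd = <<s boxes >>.
Proof.
apply/seteqP; split; last first.
  apply: smallest_sub; first exact: sigma_algebra_measurable.
  by move=> _ [a [b ->]]; exact: measurable_box.
move=> A mA.
have : measurable_fun [set: g_sigma_algebraType boxes] (id : _ -> Rd).
  apply/measurable_fun_rVP => i.
  apply: (measurability _ (RGenOpens.measurableE R)) => //.
  move=> _ [_ [a [b ->] <-]]; rewrite setTI.
  (* A slab is unbounded in all directions but one; it is the union of its intersections with the
     cubes of half side n, which are boxes. *)
  rewrite (_ : _ @^-1` _ = \bigcup_n box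
      (fun j => if j == i then Num.max a (- n%:R) else - n%:R)
      (fun j => if j == i then Num.min b n%:R else n%:R)); last first.
    apply/seteqP; split=> v.
      move=> /= vi; have [n _ vn] : (\bigcup_n box (fun=> - n%:R) (fun=> n%:R)) v.
        by rewrite bigcup_box.
      exists n => // j; have := vn j; case: eqVneq => // ->.
      move: vi; rewrite /= !in_itv/= gt_max lt_min.
      by move=> /andP[-> ->] /andP[-> ->].
    move=> [n _ /(_ i)]; rewrite eqxx /= !in_itv/= gt_max lt_min.
    by move=> /andP[/andP[-> _] /andP[-> _]].
  apply: bigcupT_measurable => n; apply: sub_sigma_algebra.
  by eexists; eexists.
by move=> /(_ measurableT A mA); rewrite setTI.
Qed.

Lemma box_measure_unique (m1 m2 : {measure set Rd -> \bar R}) :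
  (forall a b, m1 (box a b) = m2 (box a b)) ->
  (forall n : nat, (m1 (box (fun=> - n%:R)%R (fun=> n%:R)%R) < +oo)%E) ->
  forall A, measurable A -> m1 A = m2 A.
Proof.
move=> m12 m1oo; apply: (measure_unique boxes (fun n => box (fun=> - n%:R : R) (fun=> n%:R : R))).
- exact: measurable_rV_boxes.
- exact: setI_closed_boxes.
- by move=> n; eexists; eexists.
- exact: bigcup_box.
- by move=> _ [a [b ->]].
- exact: m1oo.
Qed.

Lemma lebesgue_box a b :
  leb (box a b) = (\prod_(i < d) Num.max 0 (b i - a i))%:E.
Proof.
apply: etrans (lebesgue_rV_box (A := fun i => `]a i, b i[%classic) _) _ => //.
rewrite -prodEFin.
apply: eq_bigr => i _; rewrite lebesgue_measure_itv/= lte_fin.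
case: ifPn => [ab|]; first by rewrite max_r// subr_ge0 ltW.
by rewrite -leNgt => ba; rewrite max_l// subr_le0.
Qed.

Lemma measurable_fun_addrV d0 (T : measurableType d0) (f g : T -> Rd) :
  measurable_fun setT f -> measurable_fun setT g ->
  measurable_fun setT (fun x => f x + g x).
Proof.
move=> /measurable_fun_rVP mf /measurable_fun_rVP mg; apply/measurable_fun_rVP => i.
by under eq_fun do rewrite mxE; exact: measurable_funD.
Qed.

Lemma measurable_fun_opprV d0 (T : measurableType d0) (f : T -> Rd) :
  measurable_fun setT f -> measurable_fun setT (fun x => - f x).
Proof.
move=> /measurable_fun_rVP mf; apply/measurable_fun_rVP => i.
by under eq_fun do rewrite mxE; exact: measurable_funN.
Qed.

Lemma measurable_fun_scalerV d0 (T : measurableType d0) (c : T -> R) (f : T -> Rd) :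
  measurable_fun setT c -> measurable_fun setT f ->
  measurable_fun setT (fun x => c x *: f x).
Proof.
move=> mc /measurable_fun_rVP mf; apply/measurable_fun_rVP => i.
by under eq_fun do rewrite mxE; exact: measurable_funM.
Qed.

Lemma measurable_fun_affine (s : R) (c : Rd) :
  measurable_fun setT (fun x : Rd => s *: x + c).
Proof.
apply: measurable_fun_addrV; last exact: measurable_cst.
by apply: measurable_fun_scalerV; [exact: measurable_cst|exact: measurable_id].
Qed.

(** Preimages of boxes are boxes, so the two measures can be compared there; both are finite on
    cubes. *)
Lemma lebesgue_affine (s : R) (c : Rd) : 0 < s ->
  forall A, measurable A ->
  pushforward leb (fun x : Rd => s *: x + c) A = ((s ^+ d)^-1%:E * leb A)%E.
Proof.
move=> s0; have sd0 : 0 <= (s ^+ d)^-1 by rewrite invr_ge0 exprn_ge0// ltW.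
have mphi := measurable_fun_affine s c.
pose phi : {mfun Rd >-> Rd} := HB.pack (fun x : Rd => s *: x + c)
  (isMeasurableFun.Build _ _ _ _ _ mphi).
move=> A mA.
have boxE a b : (fun x : Rd => s *: x + c) @^-1` box a b =
    box (fun i => (a i - c 0 i) / s) (fun i => (b i - c 0 i) / s).
  by apply/seteqP; split => v h i; have := h i;
    rewrite !in_itv/= !mxE ltr_pdivrMr// ltr_pdivlMr// ltrBlDr ltrBrDr (mulrC s).
apply: (@box_measure_unique (pushforward leb phi)
  (mscale (NngNum sd0) leb)) A mA => [a b|n].
  rewrite /= /mscale/= /pushforward boxE !lebesgue_box -EFinM; congr (_%:E).
  rewrite -exprVn -[X in s^-1 ^+ X](card_ord d) -prodr_const -big_split/=.
  apply: eq_bigr => i _; rewrite -mulrBl opprB addrA subrK.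
  by rewrite maxr_pMr ?invr_ge0 ?(ltW s0)// mulr0 mulrC.
by rewrite /= /pushforward boxE lebesgue_box ltry.
Qed.

Lemma ge0_integral_affine (s : R) (c : Rd) (f : Rd -> \bar R) : 0 < s ->
  measurable_fun setT f -> (forall x, 0 <= f x)%E ->
  (\int[leb]_x f (s *: x + c)%R = (s ^+ d)^-1%:E * \int[leb]_x f x)%E.
Proof.
move=> s0 mf f0; have sd0 : 0 <= (s ^+ d)^-1 by rewrite invr_ge0 exprn_ge0// ltW.
have mphi := measurable_fun_affine s c.
pose phi : {mfun Rd >-> Rd} := HB.pack (fun x : Rd => s *: x + c)
  (isMeasurableFun.Build _ _ _ _ _ mphi).
rewrite -[LHS](ge0_integral_pushforward mphi leb (D := setT) (f := f))//.
rewrite -(ge0_integral_mscale leb measurableT (NngNum sd0))//.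
by apply: eq_measure_integral => A mA _; exact: (lebesgue_affine c s0).
Qed.

Lemma integral_translate (c : Rd) (f : Rd -> \bar R) : measurable_fun setT f ->
  (\int[leb]_x f (x + c)%R = \int[leb]_x f x)%E.
Proof.
move=> mf; have t (g : Rd -> \bar R) : measurable_fun setT g ->
    (forall x, 0 <= g x)%E -> (\int[leb]_x g (x + c)%R = \int[leb]_x g x)%E.
  move=> mg g0; have := ge0_integral_affine c ltr01 mg g0.
  by rewrite expr1n invr1 mul1e => <-; under [RHS]eq_integral do rewrite scale1r.
rewrite integralE [RHS]integralE; congr (_ - _)%E.
  have e := t (f^\+)%E (measurable_funepos mf) (fun x => funepos_ge0 f x).
  by rewrite -e; apply: eq_integral => x _; rewrite !funeposE.
have e := t (f^\-)%E (measurable_funeneg mf) (fun x => funeneg_ge0 f x).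
by rewrite -e; apply: eq_integral => x _; rewrite !funenegE.
Qed.

End box.

(** * Envelopes of rescaled kernels *)

Section cells.
Context {R : realType} {d : nat}.
Notation Rd := 'rV[R]_d.
Local Notation leb := (lebesgue_rV d : {measure set Rd -> \bar R}).

Definition cell (u : Rd) : 'rV[int]_d := \row_k Num.floor (u 0 k).

(** Numbers the unit cells, so that sums over cells become series. The numbering is injective but
    not onto: some numbers name no cell. *)
Definition cell_index (u : Rd) : nat := pickle (cell u).

Lemma cell_index_dist u v k : cell_index u = cell_index v -> `|u 0 k - v 0 k| < 1.
Proof.
move=> /(pcan_inj pickleK) /rowP /(_ k); rewrite !mxE => uv.
have := floor_itv (u 0 k); have := floor_itv (v 0 k).
rewrite uv => /andP[h1 h2] /andP[h3 h4]; rewrite rmorphD/= in h2 h4.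
by rewrite ltr_norml; lra.
Qed.

Section selection.
Variables (A B : Rd -> R) (F : Rd -> \bar R) (M : R).
Hypotheses (mB : measurable_fun setT B) (A0 : forall x, 0 <= A x).
Hypothesis Bpos : (0 < leb [set y | (0 < B y)%R])%E.
Hypothesis ABF : forall x y, ((A (x - y) * B y)%:E <= F x)%E.
Hypothesis F0 : forall x, (0 <= F x)%E.
Hypothesis FM : (\int[leb]_x F x <= M%:E)%E.

(** A bounded set, of positive measure for some n, on which [B] is at least 1/(n+1). If x - u lies
    in it, the hypothesis [ABF] at y = x - u yields A u <= (n+1) F x. *)
Let E (n : nat) := [set y | n.+1%:R^-1 <= B y] `&` box (fun=> - n%:R) (fun=> n%:R).

Let mE n : measurable (E n).
Proof.
apply: measurableI; last exact: measurable_box.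
rewrite -[X in measurable X]setTI.
rewrite [X in measurable X](_ : _ = setT `&` B @^-1` `[n.+1%:R^-1, +oo[); last first.
  by apply/seteqP; split=> y; rewrite /= in_itv/= andbT.
exact: mB.
Qed.

Let E_pos : exists n, (0 < leb (E n))%E.
Proof.
apply: contrapT => /forallNP h.
have : leb.-negligible (\bigcup_n E n).
  apply: negligible_bigcup => n; apply/negligibleP => //.
  by apply/eqP; rewrite eq_le measure_ge0 andbT leNgt; apply/negP/h.
have sub : [set y | 0 < B y] `<=` \bigcup_n E n.
  move=> y /= By.
  have [m _ ym] : (\bigcup_n box (fun=> - n%:R) (fun=> n%:R)) y.
    by rewrite bigcup_box.
  pose n := Num.truncn (B y)^-1.
  exists (maxn m n) => //; split => /=.
    rewrite -[leRHS]invrK lef_pV2 ?posrE ?invr_gt0//.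
    apply: (le_trans (ltW (truncnS_gt _))).
    by rewrite ler_nat ltnS leq_maxr.
  move=> i; have := ym i; rewrite !in_itv/= => /andP[h1 h2].
  have : (m%:R : R) <= (maxn m n)%:R by rewrite ler_nat leq_maxl.
  by move=> mmn; apply/andP; split; lra.
move=> /(negligibleS sub) /negligibleP; move: Bpos => /[swap] ->//; rewrite ?ltxx//.
rewrite -[X in measurable X]setTI.
rewrite [X in measurable X](_ : _ = setT `&` B @^-1` `]0, +oo[); last first.
  by apply/seteqP; split=> y; rewrite /= in_itv/= andbT.
exact: mB.
Qed.

(** If x - u k lies in the cube of half side n, each coordinate of the cell of u k is one of the
    2n+1 consecutive integers starting at floor(x_i - n). The condition on [cell_index] makes
    different k use different cells, so k can be recovered from these offsets. *)
Let overlap (n N : nat) (u : nat -> Rd) x :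
  (count (fun k => (cell_index (u k) == k) && (x - u k \in E n)%R) (iota 0 N)
   <= #|{ffun 'I_d -> 'I_(2 * n).+1}|)%N.
Proof.
pose c (i : 'I_d) : int := Num.floor (x 0 i - n%:R).
pose phi k : {ffun 'I_d -> 'I_(2 * n).+1} := [ffun i => inord (absz (cell (u k) 0 i - c i)%R)].
set a := (fun k => _).
have ca k i : a k -> exists2 m : nat, (m < (2 * n).+1)%N & cell (u k) 0 i = c i + m%:Z.
  move=> /andP[_ /set_mem[_ /(_ i)]]; rewrite in_itv/= !mxE => /andP[h1 h2].
  have h3 : (c i <= Num.floor (u k 0 i))%R by apply: le_floor; lra.
  exists (absz (Num.floor (u k 0 i) - c i)%R); last by rewrite gez0_abs ?subr_ge0// addrC subrK.
  rewrite ltnS -lez_nat gez0_abs ?subr_ge0//.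
  have := floor_le (u k 0 i); have := floor_itv (x 0 i - n%:R) => /andP[_].
  rewrite -/(c i) => h4 h5.
  have : (Num.floor (u k 0 i))%:~R < (c i + 1 + (2 * n)%N%:Z)%:~R :> R.
    by rewrite rmorphD/= -pmulrn natrM (le_lt_trans h5)//; lra.
  by rewrite ltr_int; lia.
have phi_inj : {in [seq k <- iota 0 N | a k] &, injective phi}.
  move=> k l; rewrite !mem_filter => /andP[ak _] /andP[al _] /ffunP kl.
  have cc : cell (u k) = cell (u l).
    apply/rowP => i; have [mk mk1 mk2] := ca k i ak; have [ml ml1 ml2] := ca l i al.
    have := kl i; rewrite !ffunE mk2 ml2 !(addrC (c i)) !addrK !absz_nat => /(congr1 (@nat_of_ord _)).
    by rewrite !inordK// => ->.
  move: ak al => /andP[/eqP <- _] /andP[/eqP <- _].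
  by rewrite /cell_index cc.
rewrite -size_filter -(size_map phi).
rewrite -(card_uniqP _); first exact: max_card.
by rewrite map_inj_in_uniq// filter_uniq// iota_uniq.
Qed.

(** Here [u] selects one point per cell; a [u k] outside cell k counts as zero. Each A (u k) is
    bounded by a multiple of the integral of [F] over the translate u k + E n, and these translates
    overlap boundedly often. *)
Lemma selection_sum_le : exists2 C : R, 0 <= C & forall (u : nat -> Rd) N,
  \sum_(k < N) (if cell_index (u k) == k then A (u k) else 0) <= C.
Proof.
have [n En0] := E_pos.
pose D : R := #|{ffun 'I_d -> 'I_(2 * n).+1}|%:R.
have Dpos : 0 < D by rewrite ltr0n; apply/card_gt0P; exists [ffun=> ord0].
have Efin : leb (E n) \is a fin_num.
  rewrite ge0_fin_numE//; apply: (@le_lt_trans _ _ (leb (box (fun=> - n%:R) (fun=> n%:R)))).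
    by rewrite le_measure ?inE//; [exact: measurable_box|move=> x []].
  by rewrite lebesgue_box ltry.
pose e := fine (leb (E n)).
have e0 : 0 < e by rewrite fine_gt0// En0/= -ge0_fin_numE.
have M0 : 0 <= M.
  by rewrite -lee_fin; apply: le_trans FM; apply: integral_ge0.
pose c : R := n.+1%:R^-1.
have c0 : 0 < c by rewrite invr_gt0.
exists (M * D / (c * e)); first by rewrite divr_ge0 ?mulr_ge0// ltW.
move=> u N.
pose t k := if cell_index (u k) == k then A (u k) else 0.
have t0 k : 0 <= t k by rewrite /t; case: ifP.
have cD0 : 0 <= c / D by rewrite divr_ge0// ltW.
rewrite -(big_mkord xpredT t) ler_pdivlMr ?mulr_gt0// mulrC.
(* At a given x at most D terms are nonzero, and each is at most F x / c before scaling by c / D. *)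
have key x : ((\sum_(0 <= k < N) (c / D * t k)%:E * (\1_(E n) (x - u k)%R)%:E)%E <= F x)%E.
  have [Foo|Foo] := eqVneq (F x) +oo%E; first by rewrite Foo leey.
  have Ff : F x \is a fin_num by rewrite ge0_fin_numE// ltey.
  rewrite -(fineK Ff); under eq_bigr do rewrite -EFinM.
  rewrite sumEFin lee_fin.
  under eq_bigr => k _ do rewrite -(mulrA (c / D)) (mulrC (t k)).
  rewrite -mulr_sumr -ler_pdivlMl ?divr_gt0//.
  rewrite invf_div.
  set a := (fun k => (cell_index (u k) == k) && (x - u k \in E n)).
  rewrite (bigID a)/= [X in _ + X]big1 ?addr0; last first.
    move=> k; rewrite /a negb_and => /orP[ck|xk].
      by rewrite /t (negbTE ck) mulr0.
    by rewrite indicE (negbTE xk) mul0r.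
  apply: (@le_trans _ _ (\sum_(0 <= k < N | a k) fine (F x) / c)).
    apply: ler_sum => k /andP[ck xk]; rewrite indicE xk mul1r /t ck.
    rewrite ler_pdivlMr//.
    have := ABF x (x - u k); rewrite subKr -[in leRHS](fineK Ff) lee_fin.
    apply: le_trans; apply: ler_wpM2l => //.
    by move: xk => /set_mem[].
  rewrite big_const_seq iter_addr_0 /index_iota subn0 -mulr_natl mulrAC.
  rewrite -mulrA; apply: ler_wpM2r; first by rewrite divr_ge0 ?fine_ge0// ltW.
  by rewrite ler_nat; exact: overlap.
rewrite -lee_fin; apply: (@le_trans _ _ (D%:E * \int[leb]_x F x)%E); last first.
  by rewrite mulrC EFinM lee_wpmul2l// lee_fin ltW.
apply: (@le_trans _ _ (D%:E * \int[leb]_x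
    (\sum_(0 <= k < N) (c / D * t k)%:E * (\1_(E n) (x - u k)%R)%:E)%E)%E); last first.
  rewrite lee_wpmul2l//; first by rewrite lee_fin ltW.
  apply: ge0_le_integral_nonmeas => x; last exact: key.
  by apply: sume_ge0 => k _; rewrite -EFinM lee_fin mulr_ge0// mulr_ge0.
have mI k : measurable_fun setT (fun x : Rd => (\1_(E n) (x - u k)%R)%:E : \bar R).
  apply/measurable_EFinP.
  apply: (measurableT_comp (f := \1_(E n) : Rd -> R)); first exact: measurable_indic.
  apply: measurable_fun_addrV => //; exact: measurable_id.
have I0 k x : (0 <= (c / D * t k)%:E * (\1_(E n) (x - u k)%R)%:E :> \bar R)%E.
  by rewrite -EFinM lee_fin mulr_ge0// mulr_ge0.
rewrite ge0_integral_sum//; last first.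
  by move=> k; apply: emeasurable_funM => //; exact: measurable_cst.
under [X in (_ <= _ * X)%E]eq_bigr => k _.
  rewrite (ge0_integralZl leb measurableT (mI k))//; last by rewrite lee_fin mulr_ge0.
  rewrite (integral_translate (- u k) (f := fun x => (\1_(E n) x)%:E)); last first.
    by apply/measurable_EFinP; exact: measurable_indic.
  rewrite integral_indic// setIT -(fineK Efin) -EFinM.
  over.
rewrite sumEFin -EFinM lee_fin -/e !mulr_sumr.
by apply: ler_sum => k _; rewrite le_eqVlt; apply/orP; left; apply/eqP; field; rewrite gt_eqF.
Qed.

(** Choosing in every cell a point where [A] reaches half of its supremum reduces the sum of the
    suprema to a selection sum. Only a sequence of suprema appears, so their measurability is no
    issue. *)
Lemma cell_majorant : exists (a : nat -> R) (S : R),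
  [/\ forall n, 0 <= a n, forall u, A u <= a (cell_index u) &
      forall N, \sum_(k < N) a k <= S].
Proof.
have [C C0 AC] := selection_sum_le.
(* The constant selection has a single nonzero term, namely A u. *)
have AleC u : A u <= C.
  apply: le_trans (AC (fun=> u) (cell_index u).+1).
  rewrite (bigD1 ord_max)//= eqxx lerDl; apply: sumr_ge0 => k _.
  by case: ifP.
pose cls n := [set A u | u in [set u | cell_index u = n]].
have ubc n : has_ubound (cls n) by exists C => _ [u _ <-].
pose a n := sup (cls n).
have Aa u : A u <= a (cell_index u).
  by apply: ub_le_sup; [exact: ubc|exists u].
have /choice[u hu] n : exists u, a n <= 2 * (if cell_index u == n then A u else 0).
  have [/eqP cn|/set0P cn] := boolP (cls n == set0).
    by exists 0; rewrite /a cn sup0; case: ifP; rewrite ?mulr0 ?mulr_ge0.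
  have [a0|a0] := leP (a n) 0.
    by exists 0; apply: (le_trans a0); case: ifP; rewrite ?mulr0 ?mulr_ge0.
  have [|_ [v <- <-]] := @sup_gt _ (cls n) (a n / 2) cn; first by rewrite -/(a n); lra.
  by move=> h; exists v; rewrite eqxx; lra.
exists a, (2 * C); split => [n||N] //.
- have [/eqP cn|/set0P[x [v <- _]]] := boolP (cls n == set0).
    by rewrite /a cn sup0.
  exact: le_trans (A0 v) (Aa v).
- apply: le_trans (ler_wpM2l _ (AC u N)) => //.
  by rewrite mulr_sumr; apply: ler_sum => k _; exact: hu.
Qed.

End selection.

(** [Phi] is the double series of a m * b n times the indicator of [B m n]: measurable as a
    countable sum, and at least each of its terms. *)
Lemma double_series_envelope (a b : nat -> R) (Sa Sb : R) (B : nat -> nat -> set Rd) (c : R) :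
  (forall n, 0 <= a n) -> (forall n, 0 <= b n) ->
  (forall N, \sum_(k < N) a k <= Sa) -> (forall N, \sum_(k < N) b k <= Sb) ->
  (forall m n, measurable (B m n)) -> (forall m n, (leb (B m n) <= c%:E)%E) ->
  exists Phi : Rd -> R,
    [/\ measurable_fun setT Phi, forall x, 0 <= Phi x, forall x, Phi x <= Sa * Sb,
        (\int[leb]_x (Phi x)%:E <= (Sa * Sb * c)%:E)%E &
        forall m n x, B m n x -> a m * b n <= Phi x].
Proof.
move=> a0 b0 aS bS mB Bc.
have Sa0 : 0 <= Sa by have := aS 0%N; rewrite big_ord0.
have Sb0 : 0 <= Sb by have := bS 0%N; rewrite big_ord0.
have c0 : 0 <= c by rewrite -lee_fin; apply: le_trans (Bc 0%N 0%N).
pose t m n x : \bar R := ((a m * b n)%:E * (\1_(B m n) x)%:E)%E.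
have t0 m n x : (0 <= t m n x)%E by rewrite /t -EFinM lee_fin !mulr_ge0.
pose F x : \bar R := (\sum_(m <oo) \sum_(n <oo) t m n x)%E.
have hser (f : nat -> \bar R) (s : R) : (forall n, 0 <= f n)%E ->
    (forall N, (\sum_(k < N) f k <= s%:E)%E) -> (\sum_(k <oo) f k <= s%:E)%E.
  move=> f0 fs; apply: lime_le; first by apply: is_cvg_nneseries.
  by apply: nearW => N; rewrite big_mkord.
(* Used with k = 1 for the values of the series and with k = c for its integral. *)
have double_le (f : nat -> nat -> \bar R) (k : R) : 0 <= k -> (forall m n, 0 <= f m n)%E ->
    (forall m n, (f m n <= (a m * b n * k)%:E)%E) ->
    (\sum_(m <oo) \sum_(n <oo) f m n <= (Sa * Sb * k)%:E)%E.
  move=> k0 f0 fk; apply: (hser) => [m|N]; first by apply: nneseries_ge0.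
  apply: (@le_trans _ _ (\sum_(m < N) (a m * (Sb * k))%:E)%E).
    apply: lee_sum => m _; apply: (hser) => // M.
    apply: (@le_trans _ _ (\sum_(n < M) (a m * b n * k)%:E)%E).
      by apply: lee_sum => n _; exact: fk.
    rewrite sumEFin lee_fin -mulr_suml -mulr_sumr -mulrA.
    by apply: ler_wpM2l => //; apply: ler_wpM2r.
  rewrite sumEFin lee_fin -mulr_suml -mulrA.
  by apply: ler_wpM2r => //; exact: mulr_ge0.
have F0 x : (0 <= F x)%E by apply: nneseries_ge0 => m _ _; apply: nneseries_ge0.
have FS x : (F x <= (Sa * Sb)%:E)%E.
  rewrite -[X in (X)%:E]mulr1; apply: (double_le) => // m n.
  rewrite /t -EFinM lee_fin; apply: ler_wpM2l; first exact: mulr_ge0.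
  by rewrite indicE; case: (_ \in _).
have Ff x : F x \is a fin_num.
  by rewrite ge0_fin_numE//; apply: le_lt_trans (FS x) (ltry _).
have mt m n : measurable_fun setT (t m n).
  apply: emeasurable_funM; first exact: measurable_cst.
  by apply/measurable_EFinP; exact: measurable_indic.
have mt' m : measurable_fun setT (fun x => (\sum_(n <oo) t m n x)%E).
  by apply: ge0_emeasurable_sum => n x *; [exact: t0|exact: mt].
have mF : measurable_fun setT F.
  by apply: ge0_emeasurable_sum => m *; [apply: nneseries_ge0|exact: mt'].
exists (fun x => fine (F x)); split.
- exact: (measurableT_comp (fine_measurable _) mF).
- by move=> x; exact: fine_ge0.
- by move=> x; rewrite -lee_fin fineK.
- under eq_integral do rewrite fineK//.
  rewrite integral_nneseries//; last by move=> m x _; apply: nneseries_ge0.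
  under eq_eseriesr do rewrite integral_nneseries//.
  apply: (double_le) => // [m n|m n]; first exact: integral_ge0.
  have mI : measurable_fun setT (fun x : Rd => (\1_(B m n) x)%:E : \bar R).
    by apply/measurable_EFinP; exact: measurable_indic.
  rewrite /t (ge0_integralZl leb measurableT mI)//; last by rewrite lee_fin mulr_ge0.
  rewrite integral_indic// setIT [leRHS]EFinM lee_wpmul2l// lee_fin.
  exact: mulr_ge0.
- move=> m n x Bx; rewrite -lee_fin fineK//.
  have -> : (a m * b n)%:E = t m n x by rewrite /t indicE mem_set// mule1.
  apply: (@le_trans _ _ (\sum_(n <oo) t m n x)%E).
    rewrite (@nneseriesD1 _ (fun n => t m n x) n)// leeDl//.
    exact: nneseries_ge0.
  rewrite /F (@nneseriesD1 _ (fun m => (\sum_(n <oo) t m n x)%E) m)//; last first.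
    by move=> k _; apply: nneseries_ge0.
  by rewrite leeDl//; apply: nneseries_ge0 => k _ _; apply: nneseries_ge0.
Qed.

End cells.

Section envelope.
Context {R : realType} {d : nat}.
Notation Rd := 'rV[R]_d.
Local Notation leb := (lebesgue_rV d : {measure set Rd -> \bar R}).

Lemma lebesgue_rV_setT_gt0 : (0 < leb setT)%E.
Proof.
apply: (@lt_le_trans _ _ (leb (box (fun=> 0) (fun=> 1)))); last first.
  by rewrite le_measure ?inE//; exact: measurable_box.
by rewrite lebesgue_box lte_fin; apply: prodr_gt0 => i _; rewrite subr0 lt_max ltr01 orbT.
Qed.

(* [F] controls [K (x - y)] at scale 1 only. Applied once with [K] and once with
   [1 / W] on the cells, [cell_majorant] gives bounds that depend neither on [h]
   nor on the sign of [x - y]. *)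
Lemma kernel_envelope (K W : Rd -> R) (F : Rd -> \bar R) (M : R) :
  measurable_fun setT K -> measurable_fun setT W ->
  (forall x, 0 <= K x) -> (forall x, 0 < W x) ->
  (0 < leb [set u | (0 < K u)%R])%E ->
  (forall x y, ((K (x - y) / W y)%:E <= F x)%E) -> (\int[leb]_x F x <= M%:E)%E ->
  exists2 C : R, 0 <= C & forall h, 0 < h <= 1 -> exists Phi : Rd -> R,
    [/\ measurable_fun setT Phi, forall x, 0 <= Phi x, forall x, Phi x <= C,
        (\int[leb]_x (Phi x)%:E <= C%:E)%E &
        forall x y, K (h^-1 *: (y - x)) <= Phi x * W y].
Proof.
move=> mK mW K0 W0 Kpos KWF FM.
have F0 x : (0 <= F x)%E.
  by apply: le_trans (KWF x 0); rewrite lee_fin divr_ge0// ltW.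
have mWi : measurable_fun setT (fun y => (W y)^-1).
  rewrite (_ : (fun y => _) = (fun y => W y `^ (-1))); last first.
    by apply/funext => y; rewrite powR_inv1// ltW.
  by apply: (measurableT_comp (f := @powR R ^~ (-1))); [exact: measurable_powR|exact: mW].
have [|a [Sa [a0 Ka aS]]] :=
  @cell_majorant _ _ K (fun y => (W y)^-1) F M mWi K0 _ KWF F0 FM.
  by rewrite (_ : [set y | _] = setT) ?lebesgue_rV_setT_gt0//;
    apply/seteqP; split => // y _ /=; rewrite invr_gt0.
(* The substitution of x - y for y exchanges the two factors and keeps the bound [F]. *)
have [x|x y|b [Sb [b0 Wb bS]]] :=
  @cell_majorant _ _ (fun y => (W y)^-1) K F M mK _ Kpos _ F0 FM.
- by rewrite invr_ge0 ltW.
- by have := KWF x (x - y); rewrite subKr mulrC.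
have Sa0 : 0 <= Sa by have := aS 0%N; rewrite big_ord0.
have Sb0 : 0 <= Sb by have := bS 0%N; rewrite big_ord0.
exists (Sa * Sb * (1 + 4 ^+ d)) => [|h /andP[h0 h1]].
  by rewrite !mulr_ge0// addr_ge0// exprn_ge0.
(* A representative of cell n, with default 0 when n names no cell. *)
pose rep n : Rd := xget 0 [set u : Rd | cell_index u = n].
have repP (u : Rd) : cell_index (rep (cell_index u)) = cell_index u.
  by apply: (xgetPex 0 (P := [set v : Rd | cell_index v = cell_index u])); exists u.
(* If u = (y - x)/h is in cell m and y in cell n, then x = y - h u differs from this centre by less
   than 2 in each coordinate, because h <= 1. Hence boxes of side 4. *)
pose c m n k := rep n 0 k - h * rep m 0 k.
have [| |Phi [mPhi Phi0 PhiS PhiI PhiB]] := @double_series_envelope _ _ a b Sa Sb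
  (fun m n => box (fun k => c m n k - 2) (fun k => c m n k + 2)) (4 ^+ d) a0 b0 aS bS.
- by move=> m n; exact: measurable_box.
- move=> m n; rewrite lebesgue_box lee_fin.
  rewrite -[X in _ <= _ ^+ X](card_ord d) -prodr_const; apply: ler_prod => k _.
  by rewrite le_max lexx/= ge_max; apply/andP; split; lra.
exists Phi; split => //.
- by move=> x; apply: (le_trans (PhiS x)); rewrite ler_peMr ?mulr_ge0// lerDl exprn_ge0.
- apply: (le_trans PhiI); rewrite lee_fin; apply: ler_wpM2l; first exact: mulr_ge0.
  by rewrite lerDr.
- move=> x y; set u := h^-1 *: _.
  have xE k : x 0 k = y 0 k - h * u 0 k.
    by rewrite /u !mxE mulrA divff ?gt_eqF// mul1r opprB addrC subrK.
  have := PhiB (cell_index u) (cell_index y) x.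
  rewrite -ler_pdivrMr// => H; apply: le_trans (H _).
    apply: ler_pM => //; first by rewrite invr_ge0 ltW.
  move=> k; rewrite in_itv/= /c xE.
  have := cell_index_dist k (repP u); have := cell_index_dist k (repP y).
  rewrite !ltr_norml => /andP[h3 h4] /andP[h5 h6].
  have : `|h * (rep (cell_index u) 0 k - u 0 k)| < 1.
    rewrite normrM (gtr0_norm h0).
    apply: (@le_lt_trans _ _ (1 * `|rep (cell_index u) 0 k - u 0 k|)).
      by apply: ler_wpM2r.
    by rewrite mul1r ltr_norml h5 h6.
  rewrite ltr_norml mulrBr => /andP[h7 h8].
  by apply/andP; split; lra.
Qed.

End envelope.

(** * Poisson equation *)

Section dominated.
Context {R : realType} d (E : measurableType d).
Variable W : E -> R.

(** The ball of radius [c] in the measurable functions with [W]-weighted supremum norm. *)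
Definition dominated (f : E -> R) (c : R) : Prop :=
  measurable_fun setT f /\ forall x, `|f x| <= c * W x.

Lemma dominated_integrable (m : {measure set E -> \bar R}) f c :
  m.-integrable setT (EFin \o W) -> dominated f c -> m.-integrable setT (EFin \o f).
Proof.
move=> iW [mf fc]; apply: (le_integrable _ _ _ (integrableZl measurableT c iW)) => //.
  exact/measurable_EFinP.
by move=> x _ /=; rewrite lee_fin (le_trans (fc x))// ler_norm.
Qed.

Lemma dominatedD f g c c' : dominated f c -> dominated g c' ->
  dominated (fun x => f x + g x) (c + c').
Proof.
move=> [mf fc] [mg gc]; split; first exact: measurable_funD.
by move=> x; rewrite mulrDl (le_trans (ler_normD _ _))// lerD.
Qed.

Lemma dominatedZ f c k : dominated f c -> dominated (fun x => k * f x) (`|k| * c).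
Proof.
move=> [mf fc]; split; first exact: measurable_funM.
by move=> x; rewrite normrM -mulrA ler_wpM2l.
Qed.

Lemma dominatedB f g c c' : dominated f c -> dominated g c' ->
  dominated (fun x => f x - g x) (c + c').
Proof.
move=> hf hg; have := dominatedD hf (dominatedZ (-1) hg).
rewrite normrN1 mul1r; congr (dominated _ _).
by apply/funext => x; rewrite mulN1r.
Qed.

Lemma le_dominated f c c' : (forall x, 0 <= W x) -> c <= c' ->
  dominated f c -> dominated f c'.
Proof.
move=> W0 cc [mf fc]; split => // x.
by rewrite (le_trans (fc x))// ler_wpM2r.
Qed.

Lemma dominated_funrpos f c : dominated f c -> dominated f^\+ c.
Proof.
move=> [mf fc]; split; first exact: measurable_funrpos.
move=> x; apply: le_trans (fc x).
by rewrite ger0_norm ?funrpos_ge0// /funrpos ge_max ler_norm normr_ge0.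
Qed.

Lemma dominated_funrneg f c : dominated f c -> dominated f^\- c.
Proof.
move=> [mf fc]; split; first exact: measurable_funrneg.
move=> x; apply: le_trans (fc x).
by rewrite ger0_norm ?funrneg_ge0// /funrneg ge_max -normrN ler_norm normr_ge0.
Qed.

End dominated.

Section kernel_dominated.
Context {R : realType} d (E : measurableType d).
Variables (T : R.-pker E ~> E) (W : E -> R) (kappa : R).
Hypotheses (mW : measurable_fun setT W) (W1 : forall x, 1 <= W x).
Hypothesis TW : forall x, (\int[T x]_y (W y)%:E <= (kappa * W x)%:E)%E.

Let W0 x : 0 <= W x. Proof. exact: le_trans (W1 x). Qed.

Lemma kernel_integrable x : (T x).-integrable setT (EFin \o W).
Proof.
apply/integrableP; split; first exact/measurable_EFinP.
by under eq_integral do rewrite /= ger0_norm//; exact: le_lt_trans (TW x) (ltry _).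
Qed.

Lemma EFin_kernel_Rintegral x f c : dominated W f c ->
  (\int[T x]_y f y)%:E = (\int[T x]_y (f y)%:E)%E.
Proof.
move=> fc; rewrite fineK//; apply: integrable_fin_num => //.
by apply: dominated_integrable fc; exact: kernel_integrable.
Qed.

Lemma measurable_kernel_Rintegral f c : dominated W f c -> measurable_fun setT (fun x => \int[T x]_y f y).
Proof.
move=> fc; have [mf _] := fc.
have h g : dominated W g c -> (forall y, 0 <= g y) -> measurable_fun setT (fun x => \int[T x]_y g y).
  move=> gc g0; apply/measurable_EFinP; rewrite (_ : _ \o _ = fun x => (\int[T x]_y (g y)%:E)%E).
    apply: measurable_fun_integral_kernel => //.
    - by move=> A mA; exact: measurable_kernel.
    - by apply/measurable_EFinP; case: gc.
  by apply/funext => x /=; rewrite (EFin_kernel_Rintegral x gc).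
have fp := dominated_funrpos fc.
have fn := dominated_funrneg fc.
have -> : (fun x => \int[T x]_y f y) =
    (fun x => \int[T x]_y f^\+ y - \int[T x]_y f^\- y).
  apply/funext => x; rewrite -RintegralB//; last 2 first.
  - exact: dominated_integrable (kernel_integrable x) fp.
  - exact: dominated_integrable (kernel_integrable x) fn.
  by apply: eq_Rintegral => y _; rewrite -[in LHS](funrposBneg f).
by apply: measurable_funB; [apply: h => // y; exact: funrpos_ge0|apply: h => // y; exact: funrneg_ge0].
Qed.

Lemma dominated_kernel f c : dominated W f c ->
  dominated W (fun x => \int[T x]_y f y) (c * kappa).
Proof.
move=> fc; have [mf fW] := fc; split; first exact: measurable_kernel_Rintegral fc.
move=> x; have c_ge0 : 0 <= c.
  by have := le_trans (normr_ge0 _) (fW x); rewrite pmulr_lge0// (lt_le_trans ltr01).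
have fi := dominated_integrable (kernel_integrable x) fc.
apply: (le_trans (le_normr_Rintegral _ _)) => //.
have ic : (T x).-integrable setT (EFin \o (fun y => c * W y)).
  exact: (integrableZl measurableT c (kernel_integrable x)).
apply: (@le_trans _ _ (\int[T x]_y (c * W y))).
  by apply: le_Rintegral => //; exact: integrable_norm.
rewrite RintegralZl//; last exact: kernel_integrable.
rewrite -mulrA; apply: ler_wpM2l => //.
have dW : dominated W W 1 by split => // y; rewrite mul1r ger0_norm.
by rewrite -lee_fin (EFin_kernel_Rintegral x dW) TW.
Qed.

End kernel_dominated.

Section poisson.
Context {R : realType} d (E : measurableType d).
Variables (T : R.-pker E ~> E) (P nu : probability E R) (J : set E).
Variables (W : E -> R) (beta gamma c0 : R).
Hypotheses (mW : measurable_fun setT W) (W1 : forall x, 1 <= W x).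
Hypotheses (gamma0 : 0 <= gamma) (gamma1 : gamma < 1) (c00 : 0 <= c0).
Hypothesis TW : forall x,
  (\int[T x]_y (W y)%:E <= (gamma * W x + c0 * \1_J x)%:E)%E.
Hypothesis SSC : small_set T P J beta nu.
Hypothesis T_inv : invariant_distribution T P.

Let beta0 : 0 < beta. Proof. by case: SSC. Qed.
Let mJ : measurable J. Proof. by case: SSC. Qed.
Let W0 x : 0 <= W x. Proof. exact: le_trans (W1 x). Qed.
Let dW : dominated W W 1. Proof. by split => // x; rewrite mul1r ger0_norm. Qed.

Let integrableW (m : {measure set E -> \bar R}) :
  (\int[m]_x (W x)%:E < +oo)%E -> m.-integrable setT (EFin \o W).
Proof.
move=> h; apply/integrableP; split; first exact/measurable_EFinP.
by under eq_integral do rewrite /= ger0_norm//.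
Qed.

Let TWi x : (T x).-integrable setT (EFin \o W).
Proof. by apply: integrableW; apply: le_lt_trans (TW x) (ltry _). Qed.

Let smallE x (f : E -> R) : J x -> measurable_fun setT f -> (forall y, 0 <= f y)%R ->
  (beta%:E * \int[nu]_y (f y)%:E <= \int[T x]_y (f y)%:E)%E.
Proof.
move=> Jx mf f0; case: SSC => _ _ _ /(_ _ Jx) h.
rewrite -(ge0_integral_mscale nu measurableT (NngNum (ltW beta0)))//; last first.
- by move=> y _; rewrite lee_fin.
- exact/measurable_EFinP.
apply: ge0_le_measure_integral => //.
exact/measurable_EFinP.
Qed.

(** As P J > 0, [J] contains a point x, and the minorisation there gives beta nu(W) <= T W(x) <
    +oo. *)
Let nuWi : nu.-integrable setT (EFin \o W).
Proof.
have [_ PJ _ _] := SSC.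
have [x Jx] : exists x, J x.
  apply: contrapT => /forallNP J0; move: PJ.
  by rewrite (_ : J = set0) ?measure0 ?ltxx//; apply/seteqP; split => // x /J0.
apply: integrableW; have := smallE Jx mW W0.
rewrite -lee_pdivlMl// => /le_lt_trans; apply.
rewrite lte_mul_pinfty ?lee_fin ?invr_ge0 ?(ltW beta0)//.
exact: le_lt_trans (TW x) (ltry _).
Qed.

Let ETf x f c : dominated W f c ->
  (\int[T x]_y f y)%:E = (\int[T x]_y (f y)%:E)%E.
Proof. by move=> fc; rewrite fineK//; apply: integrable_fin_num => //; exact: dominated_integrable fc. Qed.

Let Enuf f c : dominated W f c -> (\int[nu]_y f y)%:E = (\int[nu]_y (f y)%:E)%E.
Proof. by move=> fc; rewrite fineK//; apply: integrable_fin_num => //; exact: dominated_integrable fc. Qed.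

Let U (f : E -> R) x : R := \int[T x]_y f y - beta * \1_J x * \int[nu]_y f y.

Let TWk x : (\int[T x]_y (W y)%:E <= ((gamma + c0) * W x)%:E)%E.
Proof.
apply: (le_trans (TW x)); rewrite lee_fin mulrDl lerD2l.
by apply: ler_wpM2l => //; rewrite indicE (le_trans _ (W1 x))//; case: (_ \in _).
Qed.

Let mT f c : dominated W f c -> measurable_fun setT (fun x => \int[T x]_y f y).
Proof. exact: measurable_kernel_Rintegral TWk f c. Qed.

Let domT f c : dominated W f c -> dominated W (fun x => \int[T x]_y f y) (c * (gamma + c0)).
Proof. exact: dominated_kernel TWk f c. Qed.

Let U_ge0 f c x : dominated W f c -> (forall y, 0 <= f y) -> 0 <= U f x.
Proof.
move=> fc f0; rewrite /U subr_ge0 indicE.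
have [xJ|xJ] := boolP (x \in J); last by rewrite mulr0 mul0r Rintegral_ge0.
rewrite mulr1 -lee_fin EFinM (Enuf fc) (ETf x fc).
by apply: smallE => //; [exact: set_mem|case: fc].
Qed.

Let UD f g c c' x : dominated W f c -> dominated W g c' ->
  U (fun y => f y + g y) x = U f x + U g x.
Proof.
move=> fc gc; rewrite /U !RintegralD//;
  [ring | exact: dominated_integrable fc | exact: dominated_integrable gc
  | exact: dominated_integrable fc | exact: dominated_integrable gc].
Qed.

Let U_le f g c c' x : dominated W f c -> dominated W g c' ->
  (forall y, f y <= g y) -> U f x <= U g x.
Proof.
move=> fc gc fg; have gfc := dominatedB gc fc.
have := UD x fc gfc.
rewrite (_ : (fun y => f y + (g y - f y)) = g); last first.
  by apply/funext => y; rewrite addrC subrK.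
move=> ->; rewrite lerDl; apply: (U_ge0 _ gfc) => y.
by rewrite subr_ge0.
Qed.

(** Chosen so that beta * kappa = c0: subtracting beta 1_J nu from [T] lowers the image of the
    constant kappa by exactly the drift term c0 1_J. *)
Let kappa := c0 / beta.

Let kappa0 : 0 <= kappa. Proof. by rewrite divr_ge0// ltW. Qed.

(** With H = (W + kappa) / (1 - gamma) this says U H <= H - W. So H is a supersolution of h = W + U
    h and bounds the Neumann series of every f between 0 and [W]. *)
Let U_super x : U (fun y => (W y + kappa) / (1 - gamma)) x <=
  (gamma * W x + kappa) / (1 - gamma).
Proof.
have g1 : 0 < 1 - gamma by rewrite subr_gt0.
have dk : dominated W (cst kappa) kappa.
  by split => // y; rewrite ger0_norm// ler_peMr.
have iT : (T x).-integrable setT (EFin \o cst kappa) by exact: dominated_integrable dk.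
have inu : nu.-integrable setT (EFin \o cst kappa) by exact: dominated_integrable dk.
rewrite /U.
rewrite !RintegralZr//; last 2 first.
- exact: (integrableD measurableT nuWi inu).
- exact: (integrableD measurableT (TWi x) iT).
rewrite mulrA -mulrBl; apply: ler_wpM2r; first by rewrite invr_ge0 ltW.
rewrite !(RintegralD (f2 := cst kappa))// !Rintegral_cst//.
have -> : fine (nu [set: E]) = 1 by exact: (congr1 fine (@probability_setT _ _ _ nu)).
have -> : fine (T x [set: E]) = 1 by exact: (congr1 fine (@prob_kernel _ _ _ _ _ T x)).
rewrite !mulr1.
have nuW0 : 0 <= \int[nu]_y W y by apply: Rintegral_ge0.
have h : \int[T x]_y W y <= gamma * W x + c0 * \1_J x.
  by rewrite -lee_fin (ETf x dW) TW.
have J0 : 0 <= \1_J x :> R by rewrite indicE.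
have e : beta * kappa = c0 by rewrite /kappa mulrC divfK// gt_eqF.
have := mulr_ge0 (mulr_ge0 (ltW beta0) J0) nuW0.
rewrite -{}e in h *; lra.
Qed.

(** The partial sums of the Neumann series of f increase because [U] is positive, stay below the
    supersolution, and their limit satisfies the equation by monotone convergence. The constant uses
    W + kappa <= (1 + kappa) W, as W >= 1. *)
Lemma resolvent (f : E -> R) : measurable_fun setT f -> (forall x, 0 <= f x <= W x) ->
  exists g, [/\ dominated W g ((1 + kappa) / (1 - gamma)), forall x, 0 <= g x &
    forall x, g x = f x + \int[T x]_y g y - beta * \1_J x * \int[nu]_y g y].
Proof.
move=> mf fW.
have g1 : 0 < 1 - gamma by rewrite subr_gt0.
have g1' := ltW g1.
pose S := fix S n : E -> R := if n is m.+1 then fun x => f x + U (S m) x else fun=> 0.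
pose C := (1 + kappa) / (1 - gamma).
have C0 : 0 <= C by apply: divr_ge0; [exact: addr_ge0|exact: ltW].
have f0 x : 0 <= f x by have /andP[] := fW x.
have mU h c : dominated W h c -> measurable_fun setT (U h).
  move=> hc; apply: measurable_funB; first exact: mT hc.
  apply: measurable_funM; last exact: measurable_cst.
  by apply: measurable_funM; [exact: measurable_cst|exact: measurable_indic].
have supb x : (W x + kappa) / (1 - gamma) <= C * W x.
  rewrite /C mulrAC; apply: ler_wpM2r; first by rewrite invr_ge0.
  by rewrite mulrDl mul1r lerD2l ler_peMr.
have dsup : dominated W (fun y => (W y + kappa) / (1 - gamma)) C.
  split; first by apply: measurable_funM => //; exact: measurable_funD.
  by move=> x; rewrite ger0_norm// divr_ge0// addr_ge0.
have Sb n : [/\ measurable_fun setT (S n), forall x, 0 <= S n x &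
    forall x, S n x <= (W x + kappa) / (1 - gamma)].
  elim: n => [|n [mS S0 SW]].
    by split => //= x; rewrite divr_ge0// addr_ge0.
  have dS : dominated W (S n) C.
    by split => // x; rewrite ger0_norm//; apply: le_trans (SW x) (supb x).
  split => [|x|x] /=.
  - by apply: measurable_funD => //; exact: mU dS.
  - by rewrite addr_ge0//; exact: (U_ge0 _ dS).
  - have := U_le x dS dsup SW; have := U_super x; case/andP: (fW x) => _ h h1 h2.
    have e : (W x + kappa) / (1 - gamma) = W x + (gamma * W x + kappa) / (1 - gamma).
      by field; rewrite gt_eqF.
    by rewrite e lerD// (le_trans h2).
have dS n : dominated W (S n) C.
  have [mS S0 SW] := Sb n.
  by split => // x; rewrite ger0_norm//; apply: le_trans (SW x) (supb x).
have Snd n x : S n x <= S n.+1 x.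
  elim: n x => [|n IH] x; first by have [_ + _] := Sb 1%N; exact.
  rewrite [leLHS]/= [leRHS]/= lerD2l.
  by apply: U_le (dS n) (dS n.+1) _ => y; exact: IH.
have Sndx x : nondecreasing_seq (S ^~ x) by apply/nondecreasing_seqP => n; exact: Snd.
have Scvg x : cvgn (S ^~ x).
  apply: nondecreasing_is_cvgn => //.
  by exists ((W x + kappa) / (1 - gamma)) => _ [n _ <-]; have [] := Sb n.
pose g x := limn (S ^~ x).
have Sg x : S n x @[n --> \oo] --> g x by exact: Scvg.
have g0 x : 0 <= g x.
  by apply: limr_ge => //; apply: nearW => n; have [] := Sb n.
have mg : measurable_fun setT g.
  apply: (measurable_fun_cvg (h := S)) => [n|x _]; last exact: Sg.
  by have [] := Sb n.
have dg : dominated W g C.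
  split => // x; rewrite ger0_norm//; apply: limr_le => //.
  apply: nearW => n; apply: le_trans (supb x).
  by have [] := Sb n.
have intcvg (m : {measure set E -> \bar R}) : m.-integrable setT (EFin \o W) ->
    \int[m]_y S n y @[n --> \oo] --> \int[m]_y g y.
  move=> iW; apply: fine_cvg; rewrite fineK; last first.
    by apply: integrable_fin_num => //; exact: dominated_integrable dg.
  have -> : (\int[m]_y (g y)%:E = \int[m]_y limn (fun n => (S n y)%:E))%E.
    by apply: eq_integral => y _; apply/esym/cvg_lim => //; apply: cvg_EFin; [exact: nearW|exact: Sg].
  apply: cvg_monotone_convergence => //.
  - by move=> n; apply/measurable_EFinP; have [] := Sb n.
  - by move=> n y _; rewrite lee_fin; have [] := Sb n.
  - by move=> y _ n1 n2 n12; rewrite lee_fin; exact: Sndx.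
exists g; split => // x.
have h1 : S n.+1 x @[n --> \oo] --> g x by rewrite (@cvg_shiftS _ (S ^~ x)); exact: Sg.
have h2 : S n.+1 x @[n --> \oo] -->
    f x + \int[T x]_y g y - beta * \1_J x * \int[nu]_y g y.
  rewrite -addrA; apply: cvgD; first exact: cvg_cst.
  apply: cvgB; first exact: intcvg.
  by apply: cvgM; [exact: cvg_cst|exact: intcvg].
exact: (cvg_unique _ h1 h2).
Qed.

Lemma invariant_integral (f : E -> \bar R) : measurable_fun setT f ->
  (forall x, 0 <= f x)%E -> (\int[P]_x f x = \int[P]_x \int[T x]_y f y)%E.
Proof.
have mTe (h : E -> \bar R) : measurable_fun setT h -> (forall x, 0 <= h x)%E ->
    measurable_fun setT (fun x => \int[T x]_y h y)%E.
  by move=> mh h0; apply: measurable_fun_integral_kernel => // A mA; exact: measurable_kernel.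
apply: (@ge0_measurable_ind _ _ _
  (fun f => \int[P]_x f x = \int[P]_x \int[T x]_y f y)%E) => {f}.
- move=> A mA; rewrite integral_indic// setIT; apply: etrans (T_inv mA) _.
  by apply: eq_integral => x _; rewrite integral_indic// setIT.
- move=> k f k0 mf f0 IH; rewrite (ge0_integralZl P measurableT mf)// IH.
  rewrite -(ge0_integralZl P measurableT (mTe _ mf f0))//; last first.
    by move=> x _; exact: integral_ge0.
  by apply: eq_integral => x _; rewrite (ge0_integralZl (T x) measurableT mf).
- move=> f g mf mg f0 g0 IHf IHg.
  rewrite (ge0_integralD P measurableT (fun x _ => f0 x) mf (fun x _ => g0 x) mg) IHf IHg.
  rewrite -(ge0_integralD P measurableT (fun x _ => integral_ge0 (T x) (fun y _ => f0 y)) (mTe _ mf f0)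
    (fun x _ => integral_ge0 (T x) (fun y _ => g0 y)) (mTe _ mg g0)).
  apply: eq_integral => x _.
  by rewrite (ge0_integralD (T x) measurableT (fun x _ => f0 x) mf (fun x _ => g0 x) mg).
- move=> f mf f0 nd IH; rewrite monotone_convergence//.
  under eq_fun do rewrite IH.
  rewrite -monotone_convergence//; last 3 first.
  + move=> n; apply: measurable_fun_integral_kernel => // A mA; exact: measurable_kernel.
  + by move=> n x _; exact: integral_ge0.
  + by move=> x _ m n mn; apply: ge0_le_integral => // y _; exact: nd.
  by apply: eq_integral => x _; rewrite monotone_convergence.
Qed.

(** Formally P(W) = P(T W) <= gamma P(W) + c0 bounds P(W) by c0 / (1 - gamma), but the subtraction
    requires P(W) to be finite. Truncation at level n makes all the integrals finite, with a bound
    independent of n. *)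
Lemma invariant_drift_integrable : P.-integrable setT (EFin \o W).
Proof.
have g1 : 0 < 1 - gamma by rewrite subr_gt0.
have PT1 : (P : {measure set E -> \bar R}) [set: E] = 1%E by exact: (@probability_setT _ _ _ P).
apply: integrableW.
pose a (n : nat) x := Num.min (W x) n%:R.
pose b (n : nat) x := Num.min (gamma * W x + c0) n%:R.
pose w (n : nat) x := W x * \1_[set x | W x <= n%:R] x.
have ma n : measurable_fun setT (a n) by apply: measurable_minr.
have mb n : measurable_fun setT (b n).
  apply: measurable_minr => //; apply: measurable_funD => //.
  exact: measurable_funM.
have mw n : measurable_fun setT (w n).
  apply: measurable_funM => //; apply: measurable_indic.
  rewrite -[X in measurable X]setTI; exact: measurable_fun_ler.
have a0 n x : 0 <= a n x by rewrite le_min W0 ler0n.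
have b0 n x : 0 <= b n x by rewrite le_min ler0n andbT addr_ge0// mulr_ge0.
have w0 n x : 0 <= w n x by rewrite mulr_ge0.
have ab n : (\int[P]_x (a n x)%:E <= \int[P]_x (b n x)%:E)%E.
  rewrite invariant_integral; last 2 first.
  - exact/measurable_EFinP.
  - by move=> x; rewrite lee_fin.
  apply: ge0_le_integral_nonmeas => x; first by apply: integral_ge0 => y _; rewrite lee_fin.
  rewrite /b EFin_min le_min; apply/andP; split.
    apply: (@le_trans _ _ (\int[T x]_y (W y)%:E)%E).
      by apply: ge0_le_integral_nonmeas => y; rewrite lee_fin// /a ge_min lexx.
    apply: (le_trans (TW x)); by rewrite lee_fin lerD2l ler_piMr.
  apply: (@le_trans _ _ (\int[T x]_y (n%:R)%:E)%E).
    by apply: ge0_le_integral_nonmeas => y; rewrite lee_fin// /a ge_min lexx orbT.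
  rewrite integral_cst// -[leRHS]mule1.
  by rewrite lee_wpmul2l ?lee_fin// (@prob_kernel _ _ _ _ _ T x).
have bfin n : (\int[P]_x (b n x)%:E)%E \is a fin_num.
  rewrite ge0_fin_numE ?integral_ge0// => [|x _]; last by rewrite lee_fin.
  apply: (@le_lt_trans _ _ (\int[P]_x (n%:R)%:E)%E).
    by apply: ge0_le_integral_nonmeas => x; rewrite lee_fin// /b ge_min lexx orbT.
  by rewrite integral_cst// PT1 mule1 ltry.
(* Pointwise (1 - gamma) w + b <= c0 + a: where W <= n because b <= gamma W + c0, elsewhere because
   b <= n = a. Since the integral of a is at most that of b, which is finite, the latter cancels. *)
have key n : ((1 - gamma)%:E * \int[P]_x (w n x)%:E <= c0%:E)%E.
  rewrite -(leeD2rE _ _ (bfin n)).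
  rewrite -ge0_integralZl ?lee_fin ?(ltW g1)//; last 2 first.
  - exact/measurable_EFinP.
  - by move=> x _; rewrite lee_fin.
  rewrite -ge0_integralD//; last 4 first.
  - by move=> x _; rewrite -EFinM lee_fin mulr_ge0// ltW.
  - by apply/measurable_EFinP; exact: measurable_funM.
  - by move=> x _; rewrite lee_fin.
  - exact/measurable_EFinP.
  apply: (@le_trans _ _ (\int[P]_x (c0%:E + (a n x)%:E))%E).
    apply: ge0_le_integral_nonmeas => x.
      by rewrite -EFinM -EFinD lee_fin addr_ge0// mulr_ge0// ltW.
    rewrite -EFinM -!EFinD lee_fin /w /a /b indicE.
    have [xn|xn] := boolP (x \in _).
      move: xn; rewrite inE/= => xn; rewrite mulr1 (min_l xn).
      have : Num.min (gamma * W x + c0) n%:R <= gamma * W x + c0 by rewrite ge_min lexx.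
      lra.
    have {}xn : n%:R < W x by rewrite ltNge; apply: contra xn; rewrite inE.
    rewrite mulr0n !mulr0 add0r [in leRHS](min_r (ltW xn)).
    have : Num.min (gamma * W x + c0) n%:R <= n%:R by rewrite ge_min lexx orbT.
    by move=> h; rewrite (le_trans h)// lerDr.
  rewrite ge0_integralD//; last 2 first.
  - by move=> x _; rewrite lee_fin.
  - exact/measurable_EFinP.
  by rewrite leeD// integral_cst// PT1 mule1.
apply: (@le_lt_trans _ _ (c0 / (1 - gamma))%:E); last exact: ltry.
have -> : (\int[P]_x (W x)%:E = \int[P]_x limn (fun n => (w n x)%:E))%E.
  apply: eq_integral => x _; apply/esym/cvg_lim => //.
  apply: cvg_near_cst; exists (Num.truncn (W x)).+1 => // n /= nx.
  rewrite /w indicE mem_set ?mulr1//=.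
  apply: (le_trans (ltW (truncnS_gt _))).
  by rewrite ler_nat.
rewrite monotone_convergence//; last 3 first.
- by move=> n; exact/measurable_EFinP.
- by move=> n x _; rewrite lee_fin.
- move=> x _ m n mn; rewrite lee_fin /w; apply: ler_wpM2l => //.
  rewrite !indicE ler_nat; case: (boolP (x \in _)) => //.
  rewrite inE/= => xm; rewrite mem_set//=.
  by apply: (le_trans xm); rewrite ler_nat.
apply: lime_le.
  apply: ereal_nondecreasing_is_cvgn => m n mn.
  apply: ge0_le_integral_nonmeas => x; rewrite lee_fin// /w; apply: ler_wpM2l => //.
  rewrite !indicE ler_nat; case: (boolP (x \in _)) => //.
  rewrite inE/= => xm; rewrite mem_set//=.
  by apply: (le_trans xm); rewrite ler_nat.
by apply: nearW => n; rewrite mulrC EFinM lee_pdivlMl//; exact: key.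
Qed.

Let EPf f c : dominated W f c -> (\int[P]_y f y)%:E = (\int[P]_y (f y)%:E)%E.
Proof.
move=> fc; rewrite fineK//; apply: integrable_fin_num => //.
by apply: dominated_integrable fc; exact: invariant_drift_integrable.
Qed.

(* With [G f] the resolvent of [f], the solution is [G f - P f * G 1]. *)
Lemma poisson_equation : exists2 C, 0 <= C & forall f : E -> R,
  measurable_fun setT f -> (forall x, 0 <= f x <= W x) ->
  exists g, dominated W g C /\ forall x, g x = f x - \int[P]_y f y + \int[T x]_y g y.
Proof.
have g1 : 0 < 1 - gamma by rewrite subr_gt0.
pose C := (1 + kappa) / (1 - gamma).
have C0 : 0 <= C by apply: divr_ge0; [exact: addr_ge0|exact: ltW].
have PWi := invariant_drift_integrable.
pose PW := \int[P]_x W x.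
have PW0 : 0 <= PW by apply: Rintegral_ge0.
(* Both resolvents are bounded by C, and the coefficient P f of the second one is at most P W. *)
exists (C + PW * C) => [|f mf fW]; first by rewrite addr_ge0// mulr_ge0.
have df : dominated W f 1.
  by split => // x; have /andP[h1 h2] := fW x; rewrite mul1r ger0_norm.
have [g [dg g0 gE]] := resolvent mf fW.
have [|s [ds s0 sE]] := resolvent (measurable_cst (1 : R)).
  by move=> x; rewrite ler01 W1.
have PT h c : dominated W h c -> (forall x, 0 <= h x) ->
    \int[P]_x h x = \int[P]_x \int[T x]_y h y.
  move=> hc h0; apply: EFin_inj; rewrite (EPf hc) (EPf (domT hc)).
  rewrite invariant_integral; last 2 first.
  - by apply/measurable_EFinP; case: hc.
  - by move=> x; rewrite lee_fin.
  by apply: eq_integral => x _; rewrite (ETf x hc).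
have dJ : dominated W (fun x => \1_J x) 1.
  split; first exact: measurable_indic.
  move=> x; rewrite mul1r (le_trans _ (W1 x))// indicE; case: (_ \in _) => /=.
    by rewrite normr1.
  by rewrite normr0.
have iP h c : dominated W h c -> P.-integrable setT (EFin \o h).
  exact: dominated_integrable.
(* Integrate the resolvent equation against P: the terms P(h) and P(T h) cancel by invariance, which
   determines nu(h). *)
have regen h k : dominated W k 1 -> dominated W h C -> (forall x, 0 <= h x) ->
    (forall x, h x = k x + \int[T x]_y h y - beta * \1_J x * \int[nu]_y h y) ->
    beta * fine (P J) * \int[nu]_y h y = \int[P]_x k x.
  move=> dk dh h0 hE; have := PT _ _ dh h0.
  have dkh := dominatedD dk (domT dh).
  have dJh := dominatedZ (beta * \int[nu]_y h y) dJ.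
  have -> : \int[P]_x h x = \int[P]_x (k x + \int[T x]_y h y) -
      \int[P]_x (beta * (\int[nu]_y h y) * \1_J x).
    rewrite -RintegralB//; [|exact: iP dkh|exact: iP dJh].
    by apply: eq_Rintegral => x _; rewrite [LHS]hE mulrAC.
  rewrite RintegralD//; [|exact: iP dk|exact: iP (domT dh)].
  rewrite (RintegralZl (f := \1_J))//; last exact: iP dJ.
  have -> : \int[P]_x \1_J x = fine (P J).
    by rewrite /Rintegral integral_indic// setIT.
  by move=> e; lra.
have e1 := regen g f df dg g0 gE.
have e2 : beta * fine (P J) * \int[nu]_y s y = 1.
  rewrite (regen s (cst 1) _ ds s0 sE) ?Rintegral_cst//.
    by rewrite mul1r; exact: (congr1 fine (@probability_setT _ _ _ P)).
  by split => // x; rewrite normr1 mul1r.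
(* Hence nu(g - P f * s) = 0: in this combination the terms with 1_J cancel, and the equation for
   [U] becomes the one for [T]. *)
have nu_gs : \int[nu]_y g y = (\int[P]_y f y) * \int[nu]_y s y.
  by rewrite -e1 mulrAC e2 mul1r.
pose r := \int[P]_y f y.
have r0 : 0 <= r by apply: Rintegral_ge0 => x _; have /andP[] := fW x.
have rPW : r <= PW.
  apply: le_Rintegral => //; first exact: iP df.
  by move=> x _; have /andP[] := fW x.
exists (fun x => g x - r * s x); split.
  apply: le_dominated (dominatedB dg (dominatedZ r ds)) => //.
  by rewrite lerD2l ger0_norm// ler_wpM2r.
move=> x; rewrite RintegralB//; last 2 first.
- exact: dominated_integrable dg.
- exact: dominated_integrable (dominatedZ r ds).
rewrite RintegralZl//; last exact: dominated_integrable ds.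
rewrite [in LHS]gE [in LHS]sE nu_gs -/r /=; ring.
Qed.

End poisson.

(** * Variance of partial sums along the chain *)

Section markov_property.
Context {R : realType} d (E : measurableType d) d' (Omega : measurableType d').
Variables (Pr : probability Omega R) (Z : nat -> {RV Pr >-> E}).
Variables (mu1 : probability E R) (T : R.-pker E ~> E).
Hypothesis Z_chain : markov_chain Z mu1 T.

Let mZ k : measurable_fun setT (Z k). Proof. exact: measurable_funPT. Qed.

Let mTZ k (h : E -> \bar R) : measurable_fun setT h -> (forall x, 0 <= h x)%E ->
  measurable_fun setT (fun w => \int[T (Z k w)]_y h y)%E.
Proof.
move=> mh h0; apply: (measurableT_comp (f := fun x => (\int[T x]_y h y)%E)) => //.
by apply: measurable_fun_integral_kernel => // A mA; exact: measurable_kernel.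
Qed.

(** The event that Z j lies in B belongs to the past at every time k >= j, so the defining identity
    of the chain applies to it; it then passes from indicators to [g]. *)
Lemma markov_integral_event j k (B : set E) (g : E -> \bar R) :
  (j <= k)%N -> measurable B -> measurable_fun setT g -> (forall x, 0 <= g x)%E ->
  (\int[Pr]_(w in Z j @^-1` B) g (Z k.+1 w) =
   \int[Pr]_(w in Z j @^-1` B) \int[T (Z k w)]_y g y)%E.
Proof.
move=> jk mB.
have mF : measurable (Z j @^-1` B) by rewrite -[X in measurable X]setTI; exact: mZ.
have pF : past Z k (Z j @^-1` B).
  apply: sub_sigma_algebra; exists j => //.
  by exists B => //; rewrite setTI.
have mS n (h : E -> \bar R) : measurable_fun setT h ->
    measurable_fun (Z j @^-1` B) (fun w => h (Z n w)).
  by move=> mh; apply: measurable_funTS; exact: measurableT_comp.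
have mST (h : E -> \bar R) : measurable_fun setT h -> (forall x, 0 <= h x)%E ->
    measurable_fun (Z j @^-1` B) (fun w => \int[T (Z k w)]_y h y)%E.
  by move=> mh h0; apply: measurable_funTS; exact: mTZ.
move: g; apply: (@ge0_measurable_ind _ _ _ (fun g => _ = _)).
- move=> A mA; under [RHS]eq_integral do rewrite integral_indic// setIT.
  rewrite -(proj2 Z_chain)//.
  rewrite (_ : (fun w => _) = (fun w => (\1_(Z k.+1 @^-1` A) w)%:E))//.
  rewrite integral_indic//; first by rewrite setIC.
  by rewrite -[X in measurable X]setTI; exact: mZ.
- move=> c g c0 mg g0 IH.
  rewrite (ge0_integralZl Pr mF (mS k.+1 _ mg)) ?lee_fin// IH.
  rewrite -(ge0_integralZl Pr mF (mST _ mg g0)) ?lee_fin//; last first.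
    by move=> w _; exact: integral_ge0.
  by apply: eq_integral => w _; rewrite (ge0_integralZl (T (Z k w)) measurableT mg) ?lee_fin.
- move=> f g mf mg f0 g0 IHf IHg.
  rewrite (ge0_integralD Pr mF (fun x _ => f0 _) (mS k.+1 _ mf) (fun x _ => g0 _) (mS k.+1 _ mg)).
  rewrite IHf IHg.
  rewrite -(ge0_integralD Pr mF (fun w _ => integral_ge0 (T (Z k w)) (fun y _ => f0 y)) (mST _ mf f0)
    (fun w _ => integral_ge0 (T (Z k w)) (fun y _ => g0 y)) (mST _ mg g0)).
  apply: eq_integral => w _.
  by rewrite (ge0_integralD (T (Z k w)) measurableT (fun x _ => f0 x) mf (fun x _ => g0 x) mg).
- move=> f mf f0 nd IH.
  rewrite (monotone_convergence Pr mF (fun n => mS k.+1 _ (mf n)) (fun n x _ => f0 n _) (fun x _ => nd _)).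
  under eq_fun do rewrite IH.
  rewrite -(monotone_convergence Pr mF (fun n => mST _ (mf n) (f0 n))
    (fun n w _ => integral_ge0 (T (Z k w)) (fun y _ => f0 n y))); last first.
    by move=> w _ m n mn; apply: ge0_le_integral => // y _; exact: nd.
  apply: eq_integral => w _.
  by rewrite (monotone_convergence (T (Z k w)) measurableT mf (fun n x _ => f0 n x) (fun x _ => nd x)).
Qed.

End markov_property.

Section variance.
Context {R : realType} d (E : measurableType d) d' (Omega : measurableType d').
Variables (Pr : probability Omega R) (Z : nat -> {RV Pr >-> E}).
Variables (mu1 : probability E R) (T : R.-pker E ~> E).
Hypothesis Z_chain : markov_chain Z mu1 T.
Variables (W : E -> R) (v : R).
Hypotheses (mW : measurable_fun setT W) (W1 : forall x, 1 <= W x).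
Variable kappa : R.
Hypothesis TW : forall x, (\int[T x]_y (W y)%:E <= (kappa * W x)%:E)%E.
Hypothesis ZW : forall k, (\int[Pr]_w (W (Z k w) ^+ 2)%:E <= v%:E)%E.

Let mZ k : measurable_fun setT (Z k). Proof. exact: measurable_funPT. Qed.
Let W0 x : 0 <= W x. Proof. exact: le_trans (W1 x). Qed.
Let v0 : 0 <= v.
Proof.
rewrite -lee_fin; apply: le_trans (ZW 0).
by apply: integral_ge0 => w _; rewrite lee_fin sqr_ge0.
Qed.

(** The product is at most c c' (W(Z_i)^2 + W(Z_l)^2) / 2, and both squares have mean at most v. *)
Lemma dominated_product i l f g c c' : dominated W f c -> dominated W g c' ->
  0 <= c -> 0 <= c' ->
  Pr.-integrable setT (EFin \o (fun w => f (Z i w) * g (Z l w))) /\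
  `|\int[Pr]_w (f (Z i w) * g (Z l w))| <= c * c' * v.
Proof.
move=> [mf fc] [mg gc] c0 c'0.
have mfg : measurable_fun setT (fun w => f (Z i w) * g (Z l w)).
  by apply: measurable_funM; exact: measurableT_comp.
have mWW n : measurable_fun setT (fun w => (W (Z n w) ^+ 2)%:E : \bar R).
  by apply/measurable_EFinP; apply: measurable_funX; exact: measurableT_comp.
have mWW2 : measurable_fun setT (fun w => ((W (Z i w) ^+ 2)%:E + (W (Z l w) ^+ 2)%:E)%E).
  exact: emeasurable_funD.
have b : (\int[Pr]_w `|(f (Z i w) * g (Z l w))%:E| <= (c * c' * v)%:E)%E.
  apply: (@le_trans _ _ (\int[Pr]_w ((c * c' / 2)%:E *
      ((W (Z i w) ^+ 2)%:E + (W (Z l w) ^+ 2)%:E)))%E).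
    apply: ge0_le_integral_nonmeas => w //=.
    rewrite -EFinD -EFinM lee_fin normrM.
    apply: (@le_trans _ _ ((c * W (Z i w)) * (c' * W (Z l w)))); first exact: ler_pM.
    rewrite -subr_ge0.
    rewrite (_ : _ - _ = c * c' / 2 * (W (Z i w) - W (Z l w)) ^+ 2); last by field.
    by rewrite mulr_ge0 ?sqr_ge0// divr_ge0// mulr_ge0.
  rewrite (ge0_integralZl Pr measurableT mWW2); last 2 first.
  - by move=> w _; rewrite -EFinD lee_fin addr_ge0// sqr_ge0.
  - by rewrite lee_fin divr_ge0// mulr_ge0.
  rewrite (ge0_integralD Pr measurableT _ (mWW i) _ (mWW l)); last 2 first.
  - by move=> w _; rewrite lee_fin sqr_ge0.
  - by move=> w _; rewrite lee_fin sqr_ge0.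
  apply: (@le_trans _ _ ((c * c' / 2)%:E * (v%:E + v%:E))%E).
    apply: lee_wpmul2l; first by rewrite lee_fin divr_ge0// mulr_ge0.
    exact: leeD (ZW i) (ZW l).
  by rewrite -EFinD -EFinM lee_fin le_eqVlt; apply/orP; left; apply/eqP; field.
have ifg : Pr.-integrable setT (EFin \o (fun w => f (Z i w) * g (Z l w))).
  apply/integrableP; split; first exact/measurable_EFinP.
  exact: le_lt_trans b (ltry _).
split => //; rewrite -lee_fin EFin_normr_Rintegral//.
apply: le_trans b; apply: le_abse_integral => //.
exact/measurable_EFinP.
Qed.

Section markov_Rintegral.
Variables (j k : nat) (jk : (j <= k)%N).

(** The Markov property tested against a function of one earlier state: E[u(Z_j) g(Z_(k+1))] =
    E[u(Z_j) (T g)(Z_k)]. The mixed moments below need conditional expectations only in this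
    form. *)
Let Q u g := \int[Pr]_w (u (Z j w) * g (Z k.+1 w)) =
  \int[Pr]_w (u (Z j w) * \int[T (Z k w)]_y g y).

Let Q_ge0 u g c c' : dominated W u c -> dominated W g c' ->
  (forall x, 0 <= u x) -> (forall x, 0 <= g x) -> Q u g.
Proof.
move=> du dg u0 g0; rewrite /Q /Rintegral; congr fine.
have [mu _] := du; have [mg _] := dg.
under eq_integral do rewrite EFinM.
under [RHS]eq_integral do rewrite EFinM.
apply: (eq_integral_weighted (m1 := Pr) (m2 := Pr) (X1 := Z j) (X2 := Z j)
  (G1 := fun w => g (Z k.+1 w)) (G2 := fun w => \int[T (Z k w)]_y g y)
  (u := fun x => (u x)%:E)).
- by [].
- by [].
- exact: measurableT_comp.
- by apply: (measurableT_comp (f := fun x => \int[T x]_y g y)) => //;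
    exact: (measurable_kernel_Rintegral mW W1 TW dg).
- by [].
- by move=> w; apply: Rintegral_ge0.
- move=> B mB; rewrite (markov_integral_event Z_chain (g := fun x => (g x)%:E) jk mB).
  + by apply: eq_integral => w _; rewrite (EFin_kernel_Rintegral mW W1 TW _ dg).
  + exact/measurable_EFinP.
  + by move=> x; rewrite lee_fin.
- exact/measurable_EFinP.
- by move=> x; rewrite lee_fin.
Qed.

Lemma markov_Rintegral u g c c' : dominated W u c -> dominated W g c' ->
  0 <= c -> 0 <= c' -> 0 <= kappa -> Q u g.
Proof.
move=> du dg c0 c'0 k0.
have dT h a : dominated W h a -> dominated W (fun x => \int[T x]_y h y) (a * kappa).
  exact: dominated_kernel.
have dp h a (dh : dominated W h a) := dominated_funrpos dh.
have dn h a (dh : dominated W h a) := dominated_funrneg dh.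
have QB u1 u2 h a1 a2 : dominated W u1 a1 -> dominated W u2 a2 -> dominated W h c' ->
    0 <= a1 -> 0 <= a2 -> Q u1 h -> Q u2 h -> Q (fun x => u1 x - u2 x) h.
  move=> d1 d2 dh a10 a20 q1 q2; rewrite /Q.
  under eq_Rintegral do rewrite mulrBl.
  under [RHS]eq_Rintegral do rewrite mulrBl.
  have e1 n (h' : E -> R) b : dominated W h' b -> 0 <= b ->
    \int[Pr]_w (u1 (Z j w) * h' (Z n w) - u2 (Z j w) * h' (Z n w)) =
    \int[Pr]_w (u1 (Z j w) * h' (Z n w)) - \int[Pr]_w (u2 (Z j w) * h' (Z n w)).
    by move=> dh' b0; apply: RintegralB => //;
      [exact: (dominated_product _ _ d1 dh' a10 b0).1|exact: (dominated_product _ _ d2 dh' a20 b0).1].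
  rewrite (e1 _ _ _ dh)//.
  by rewrite (e1 _ _ _ (dT _ _ dh)) ?mulr_ge0// q1 q2.
have Qu h : dominated W h c' -> (forall x, 0 <= h x) -> Q u h.
  move=> dh h0; rewrite -[u]funrposBneg.
  apply: (QB _ _ _ c c) => //; [exact: dp|exact: dn| |].
    by apply: Q_ge0 (dp _ _ du) dh _ h0 => x; exact: funrpos_ge0.
  by apply: Q_ge0 (dn _ _ du) dh _ h0 => x; exact: funrneg_ge0.
have q1 := Qu _ (dp _ _ dg) (funrpos_ge0 g).
have q2 := Qu _ (dn _ _ dg) (funrneg_ge0 g).
have e2 n (g1 g2 : E -> R) b : dominated W g1 b -> dominated W g2 b -> 0 <= b ->
    \int[Pr]_w (u (Z j w) * (g1 (Z n w) - g2 (Z n w))) =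
    \int[Pr]_w (u (Z j w) * g1 (Z n w)) - \int[Pr]_w (u (Z j w) * g2 (Z n w)).
  move=> d1 d2 b0; under eq_Rintegral do rewrite mulrBr.
  by apply: RintegralB => //;
    [exact: (dominated_product _ _ du d1 c0 b0).1|exact: (dominated_product _ _ du d2 c0 b0).1].
have Tg x : \int[T x]_y g y = \int[T x]_y g^\+ y - \int[T x]_y g^\- y.
  rewrite -RintegralB//.
  - by apply: eq_Rintegral => y _; rewrite -[in LHS](funrposBneg g).
  - exact: dominated_integrable (kernel_integrable mW W1 TW x) (dp _ _ dg).
  - exact: dominated_integrable (kernel_integrable mW W1 TW x) (dn _ _ dg).
rewrite /Q.
rewrite -[in LHS](funrposBneg g).
rewrite (e2 _ _ _ c' (dp _ _ dg) (dn _ _ dg) c'0) q1 q2.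
under [RHS]eq_Rintegral do rewrite Tg.
rewrite (e2 _ _ _ (c' * kappa) (dT _ _ (dp _ _ dg)) (dT _ _ (dn _ _ dg)))//.
exact: mulr_ge0.
Qed.

End markov_Rintegral.

(* The sums of the moments E[f(Z_j) f(Z_k)] over [j <= k < n] telescope. *)
Lemma partial_sum_second_moment (f g : E -> R) (cf cg : R) :
  0 <= kappa -> 0 <= cf -> 0 <= cg ->
  dominated W f cf -> dominated W g cg ->
  (forall x, g x = f x + \int[T x]_y g y) ->
  forall N, (\int[Pr]_w ((\sum_(k < N) f (Z k w)) ^+ 2)%:E <=
    (2 * N%:R * (cf * (2 * cg + cf) * v))%:E)%E.
Proof.
move=> k0 cf0 cg0 df dg gE N.
(* By the Poisson equation g - f is T g. It is bounded here directly from [f] and [g]. *)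
have dTg : dominated W (fun x => g x - f x) (cg + cf) by exact: dominatedB.
pose m j k := \int[Pr]_w (f (Z j w) * f (Z k w)).
have imm j k : Pr.-integrable setT (EFin \o (fun w => f (Z j w) * f (Z k w))).
  exact: (dominated_product _ _ df df cf0 cf0).1.
pose a j k := \int[Pr]_w (f (Z j w) * g (Z k w)).
pose t j k := \int[Pr]_w (f (Z j w) * (g (Z k w) - f (Z k w))).
have at_ j k : (j <= k)%N -> a j k.+1 = t j k.
  move=> jk; rewrite /a (markov_Rintegral jk df dg)//.
  by apply: eq_Rintegral => w _; rewrite (gE (Z k w)) addrAC subrr add0r.
have mat j k : m j k = a j k - t j k.
  rewrite /m /a /t -RintegralB//.
  - by apply: eq_Rintegral => w _; ring.
  - exact: (dominated_product _ _ df dg cf0 cg0).1.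
  - exact: (dominated_product _ _ df dTg cf0 (addr_ge0 cg0 cf0)).1.
(* As f = g - T g, each moment is a j k - t j k, and a j (k+1) = t j k by the Markov property. Only
   the first [a] and the last [t] remain, so the tail is bounded independently of its length. *)
have tail j n : \sum_(j <= k < (j + n).+1) m j k = a j j - t j (j + n)%N.
  elim: n => [|n IH]; first by rewrite addn0 big_nat1 mat.
  rewrite addnS big_nat_recr/=; last by rewrite leqW// leq_addr.
  by rewrite IH mat at_ ?leq_addr//; ring.
have tail_le j n : (j < n)%N -> \sum_(j <= k < n) m j k <= cf * (2 * cg + cf) * v.
  move=> jn; have [l ->] : exists l, n = (j + l).+1.
    by exists (n - j).-1; rewrite -addnS prednK ?subn_gt0// subnKC// ltnW.
  rewrite tail.
  have h1 := proj2 (dominated_product j j df dg cf0 cg0).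
  have h2 := proj2 (dominated_product j (j + l) df dTg cf0 (addr_ge0 cg0 cf0)).
  have := ler_norm (a j j); have := ler_norm (- t j (j + l)%N); rewrite normrN.
  move: h1 h2; rewrite -/(a j j) -/(t j (j + l)%N) => h1 h2 h3 h4.
  have -> : cf * (2 * cg + cf) * v = cf * cg * v + cf * (cg + cf) * v by ring.
  by rewrite lerD ?(le_trans h4)// (le_trans h3).
pose S n w := \sum_(k < n) f (Z k w).
(* The square of the sum is expanded by induction on n. The bound counts the nonnegative diagonal
   terms m n n twice, whence an inequality. *)
have dS n : exists2 s : Omega -> R, s = S n &
    (Pr.-integrable setT (EFin \o (fun w => s w ^+ 2)) /\
     (forall k, Pr.-integrable setT (EFin \o (fun w => s w * f (Z k w))) /\
        \int[Pr]_w (s w * f (Z k w)) = \sum_(j < n) m j k)) /\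
     \int[Pr]_w (s w ^+ 2) <= 2 * \sum_(j < n) \sum_(j <= k < n) m j k.
  exists (S n) => //; elim: n => [|n [[IH1 IH2] IH3]].
    have S0 w : S 0 w = 0 by rewrite /S big_ord0.
    rewrite !big_ord0; split; first split.
    + rewrite (_ : EFin \o _ = cst 0%E); first exact: integrable0.
      by apply/funext => w /=; rewrite S0 expr0n.
    + move=> k; split.
        rewrite (_ : EFin \o _ = cst 0%E); first exact: integrable0.
        by apply/funext => w /=; rewrite S0 mul0r.
      under eq_Rintegral do rewrite S0 mul0r.
      by rewrite Rintegral_cst// mul0r big_ord0.
    + under eq_Rintegral do rewrite S0 expr0n.
      by rewrite Rintegral_cst// mul0r mulr0.
  have SS w : S n.+1 w = S n w + f (Z n w) by rewrite /S big_ord_recr.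
  have i1 k : Pr.-integrable setT (EFin \o (fun w => S n.+1 w * f (Z k w))).
    rewrite (_ : _ \o _ = ((EFin \o (fun w => S n w * f (Z k w))%R) \+
        (EFin \o (fun w => f (Z n w) * f (Z k w))%R))%E).
      by apply: integrableD => //; exact: (IH2 k).1.
    by apply/funext => w /=; rewrite SS mulrDl EFinD.
  have i2 k : \int[Pr]_w (S n.+1 w * f (Z k w)) = \sum_(j < n.+1) m j k.
    under eq_Rintegral do rewrite SS mulrDl.
    by rewrite RintegralD//; [rewrite (IH2 k).2 big_ord_recr|exact: (IH2 k).1].
  have i3 : Pr.-integrable setT (EFin \o (fun w => S n.+1 w ^+ 2)).
    rewrite (_ : _ \o _ = ((EFin \o (fun w => S n w ^+ 2)%R) \+
        (fun w => (2%:E * (S n w * f (Z n w))%:E)%E) \+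
        (EFin \o (fun w => f (Z n w) * f (Z n w))%R))%E).
      apply: integrableD => //; apply: integrableD => //.
      by apply: integrableZl => //; exact: (IH2 n).1.
    by apply/funext => w /=; rewrite SS -EFinM -!EFinD; congr (_%:E); ring.
  split; first by split => // k; split.
  have -> : \int[Pr]_w (S n.+1 w ^+ 2) = \int[Pr]_w (S n w ^+ 2) +
      2 * \sum_(j < n) m j n + m n n.
    rewrite -(IH2 n).2 -RintegralZl//; last exact: (IH2 n).1.
    have ih : Pr.-integrable setT (EFin \o (fun w => 2 * (S n w * f (Z n w)))).
      by apply: (integrableZl _ 2 (IH2 n).1).
    rewrite -RintegralD// -RintegralD//.
      by apply: eq_Rintegral => w _; rewrite SS; ring.
    exact: (integrableD _ IH1 ih).
  have -> : \sum_(j < n.+1) \sum_(j <= k < n.+1) m j k =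
      \sum_(j < n) \sum_(j <= k < n) m j k + \sum_(j < n) m j n + m n n.
    rewrite big_ord_recr/= big_nat1 -big_split/=; congr (_ + _).
    by apply: eq_bigr => j _; rewrite big_nat_recr//= ltnW.
  rewrite !mulrDr.
  have mnn : 0 <= m n n by apply: Rintegral_ge0 => w _; rewrite -expr2 sqr_ge0.
  by rewrite lerD// ?lerD// ler_peMl// ler1n.
have [_ -> [[iS _] hS]] := dS N.
have -> : (\int[Pr]_w (S N w ^+ 2)%:E = (\int[Pr]_w (S N w ^+ 2))%:E)%E.
  by rewrite fineK//; exact: integrable_fin_num.
rewrite lee_fin; apply: (le_trans hS); rewrite -mulrA; apply: ler_wpM2l => //.
rewrite mulr_natl -[X in _ *+ X]card_ord -sumr_const.
by apply: ler_sum => j _; exact: tail_le.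
Qed.

End variance.

(** * From the drift condition for [V] to the variance bound with weight [W] *)

Section drift_variance.
Context {R : realType} d (E : measurableType d) d' (Omega : measurableType d').
Variables (Pr : probability Omega R) (Z : nat -> {RV Pr >-> E}).
Variables (mu1 P nu : probability E R) (T : R.-pker E ~> E) (J : set E).
Variables (V : E -> R) (beta lambda b : R).
Hypothesis Z_chain : markov_chain Z mu1 T.
Hypothesis T_inv : invariant_distribution T P.
Hypothesis SSC : small_set T P J beta nu.
Hypothesis DC : drift T mu1 J V lambda b.

Let mV : measurable_fun setT V. Proof. by case: DC => -[]. Qed.
Let V1 x : 1 <= V x. Proof. by case: DC => -[]. Qed.
Let V0 x : 0 <= V x. Proof. exact: le_trans (V1 x). Qed.
Let l0 : 0 < lambda. Proof. by case: DC => _ /andP[]. Qed.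
Let l1 : lambda < 1. Proof. by case: DC => _ /andP[]. Qed.
Let b0 : 0 < b. Proof. by case: DC. Qed.

(** The value b / (1 - lambda) is the fixed point of v -> lambda v + b, so the bound assumed for the
    initial law propagates in time. *)
Lemma drift_moment k : (\int[Pr]_w (V (Z k w))%:E <= (b / (1 - lambda))%:E)%E.
Proof.
have [_ _ _ TV muV] := DC.
have mVe : measurable_fun setT (fun x => (V x)%:E : \bar R) by exact/measurable_EFinP.
have V0e x : (0 <= (V x)%:E)%E by rewrite lee_fin.
have mZ n : measurable_fun setT (Z n) by exact: measurable_funPT.
elim: k => [|k IH].
  apply: le_trans muV; rewrite le_eqVlt; apply/orP; left; apply/eqP.
  rewrite -[LHS](ge0_integral_pushforward (mZ 0%N) Pr (D := setT) (f := fun x => (V x)%:E))//.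
  by apply: eq_measure_integral => A mA _; exact: (proj1 Z_chain).
have := @markov_integral_event _ _ _ _ _ _ _ _ _ Z_chain k k setT
  (fun x => (V x)%:E) (leqnn k) measurableT mVe V0e.
rewrite preimage_setT => ->.
have mVZ : measurable_fun setT (fun w => (V (Z k w))%:E : \bar R).
  by apply/measurable_EFinP; exact: measurableT_comp.
apply: (@le_trans _ _ (\int[Pr]_w (lambda%:E * (V (Z k w))%:E + b%:E))%E).
  apply: ge0_le_integral_nonmeas => w; first exact: integral_ge0.
  apply: (le_trans (TV _)); rewrite -EFinM -EFinD lee_fin; apply: lerD.
    by rewrite ler_piMr// mulr_ge0// ltW.
  by rewrite ler_piMr// ltW.
have m1 : measurable_fun setT (fun w => lambda%:E * (V (Z k w))%:E : \bar R)%E.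
  exact: emeasurable_funM.
have p1 w : setT w -> (0 <= lambda%:E * (V (Z k w))%:E)%E.
  by move=> _; rewrite -EFinM lee_fin mulr_ge0// ltW.
have p2 (w : Omega) : setT w -> (0 <= b%:E)%E by move=> _; rewrite lee_fin ltW.
rewrite (ge0_integralD Pr measurableT p1 m1 p2 (measurable_cst _)).
rewrite (ge0_integralZl Pr measurableT mVZ)//; last by rewrite lee_fin ltW.
have PT1 : (Pr : {measure set Omega -> \bar R}) [set: Omega] = 1%E.
  exact: (@probability_setT _ _ _ Pr).
rewrite integral_cst// PT1 mule1.
apply: (@le_trans _ _ (lambda%:E * (b / (1 - lambda))%:E + b%:E)%E).
  by rewrite leeD2r// lee_wpmul2l// lee_fin ltW.
rewrite -EFinM -EFinD lee_fin le_eqVlt; apply/orP; left; apply/eqP.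
by field; rewrite gt_eqF// subr_gt0.
Qed.

Let W x := Num.sqrt (V x).

Let W1 x : 1 <= W x. Proof. by rewrite -sqrtr1 ler_wsqrtr. Qed.

Let mW : measurable_fun setT W.
Proof.
exact: (measurableT_comp (continuous_measurable_fun (@sqrt_continuous R)) mV).
Qed.

(** By Jensen (T W)^2 <= T V, and the drift bound of T V at x is at most the square of the right
    side, checked separately on [J] and off it. *)
Let TW x : (\int[T x]_y (W y)%:E <=
  (Num.sqrt lambda * W x + Num.sqrt b * \1_J x)%:E)%E.
Proof.
have [_ _ _ TV _] := DC.
have T1 : (T x : {measure set E -> \bar R}) [set: E] = 1%E by exact: (@prob_kernel _ _ _ _ _ T x).
have c1 : (\int[T x]_y (cst 1 y : R)%:E <= 1%:E)%E.
  by rewrite (_ : (fun y => (cst 1 y)%:E) = cst 1%E)// integral_cst// T1 mule1.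
have := @weighted_jensen R 2 _ _ (T x) W (cst 1) 1 isT mW (measurable_cst _)
  (fun y => sqrtr_ge0 _) (fun=> ler01) c1.
rewrite expr1n mul1e; under eq_integral do rewrite mulr1.
under [X in (_ <= X)%E -> _]eq_integral do rewrite /= mulr1 sqr_sqrtr//.
move=> /le_trans /(_ (TV x)).
set I := (\int[T x]_y _)%E; set B := Num.sqrt lambda * W x + _.
have I0 : (0 <= I)%E by apply: integral_ge0 => y _; rewrite lee_fin sqrtr_ge0.
have B0 : 0 <= B by rewrite addr_ge0// mulr_ge0// ?sqrtr_ge0.
have hB : lambda * V x * \1_(~` J) x + b * \1_J x <= B ^+ 2.
  rewrite /B !indicE in_setC; case: (x \in J) => /=.
    rewrite mulr0 mulr1 add0r mulr1 -{1}(sqr_sqrtr (ltW b0)) ler_sqr ?nnegrE.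
    - by rewrite lerDr mulr_ge0// sqrtr_ge0.
    - exact: sqrtr_ge0.
    - by rewrite addr_ge0// ?mulr_ge0// sqrtr_ge0.
  by rewrite mulr1 !mulr0 !addr0 exprMn !sqr_sqrtr// ltW.
move=> hI; have {hI hB} : (I ^+ 2 <= (B ^+ 2)%:E)%E by rewrite (le_trans hI)// lee_fin.
have [-> |Ifin] := eqVneq I +oo%E; first by rewrite expe2 gt0_mulye ?ltry// leye_eq.
have {}Ifin : I \is a fin_num by rewrite ge0_fin_numE// ltey.
rewrite -(fineK Ifin) -EFin_expe !lee_fin ler_sqr// nnegrE.
exact: fine_ge0.
Qed.

Let TWk x : (\int[T x]_y (W y)%:E <=
  ((Num.sqrt lambda + Num.sqrt b) * W x)%:E)%E.
Proof.
apply: (le_trans (TW x)); rewrite lee_fin mulrDl lerD2l.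
apply: ler_wpM2l; first exact: sqrtr_ge0.
by rewrite indicE (le_trans _ (W1 x))//; case: (_ \in _).
Qed.

Let sl0 : 0 <= Num.sqrt lambda. Proof. exact: sqrtr_ge0. Qed.
Let sl1 : Num.sqrt lambda < 1. Proof. by rewrite -[ltRHS]sqrtr1 ltr_sqrt. Qed.
Let sb0 : 0 <= Num.sqrt b. Proof. exact: sqrtr_ge0. Qed.

Lemma drift_integrable_sqrt : P.-integrable setT (EFin \o W).
Proof. exact: invariant_drift_integrable TW T_inv. Qed.

Lemma drift_variance : exists2 C, 0 <= C & forall (f : E -> R) (c : R),
  measurable_fun setT f -> 0 <= c -> (forall x, 0 <= f x <= c * W x) ->
  forall N, (\int[Pr]_w ((\sum_(k < N) (f (Z k w) - \int[P]_y f y)) ^+ 2)%:E <=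
    (C * c ^+ 2 * N%:R)%:E)%E.
Proof.
have [C C0 poi] := poisson_equation mW W1 sl0 sl1 sb0 TW SSC T_inv.
have PWi := drift_integrable_sqrt.
(* After division by c one has |f - P f| <= W + P W <= (1 + P W) W. *)
pose cf := 1 + \int[P]_y W y.
have PW0 : 0 <= \int[P]_y W y by apply: Rintegral_ge0 => y _; exact: sqrtr_ge0.
have cf0 : 0 <= cf by rewrite addr_ge0.
pose v := b / (1 - lambda).
have v0 : 0 <= v by rewrite divr_ge0 ?ltW// subr_gt0.
have ZW k : (\int[Pr]_w (W (Z k w) ^+ 2)%:E <= v%:E)%E.
  by under eq_integral do rewrite sqr_sqrtr//; exact: drift_moment.
exists (2 * (cf * (2 * C + cf) * v)) => [|f c mf c0 fW N].
  have h : 0 <= 2 * C + cf by apply: addr_ge0 => //; exact: mulr_ge0.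
  by do 2 (apply: mulr_ge0 => //); exact: mulr_ge0.
(* For c = 0 division is impossible, but then f vanishes identically. *)
have [cE|cN0] := eqVneq c 0.
  have f0 x : f x = 0.
    by apply/eqP; rewrite eq_le; have := fW x; rewrite cE mul0r andbC.
  rewrite cE expr0n/= mulr0 mul0r; under eq_integral => w _.
    under eq_bigr do rewrite f0; under eq_Rintegral do rewrite f0.
    rewrite Rintegral_cst// mul0r subr0 big1// expr0n.
    over.
  by rewrite integral0.
have cp : 0 < c by rewrite lt0r cN0.
have mfc : measurable_fun setT (fun x => c^-1 * f x) by exact: measurable_funM.
have fcW x : 0 <= c^-1 * f x <= W x.
  have /andP[h1 h2] := fW x.
  by rewrite mulr_ge0 ?invr_ge0 ?(ltW cp)//= ler_pdivrMl.
have [g [dg gE]] := poi _ mfc fcW.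
pose r := \int[P]_y (c^-1 * f y).
have dfc : dominated W (fun x => c^-1 * f x) 1.
  by split => // x; have /andP[h1 h2] := fcW x; rewrite mul1r ger0_norm.
have ifc := dominated_integrable PWi dfc.
have r0 : 0 <= r by apply: Rintegral_ge0 => x _; have /andP[] := fcW x.
have rPW : r <= \int[P]_y W y.
  by apply: le_Rintegral => // x _; have /andP[] := fcW x.
have df : dominated W (fun x => c^-1 * f x - r) cf.
  split; first exact: measurable_funB.
  move=> x; have /andP[h1 h2] := fcW x.
  rewrite (le_trans (ler_normB _ _))// mulrDl mul1r lerD//.
    by rewrite ger0_norm.
  by rewrite (ger0_norm r0) (le_trans rPW)// ler_peMr.
have rE : \int[P]_y f y = c * r.
  rewrite /r -RintegralZl//.
  by apply: eq_Rintegral => y _; rewrite mulrA divff// mul1r.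
have := partial_sum_second_moment Z_chain mW W1 TWk ZW (addr_ge0 sl0 sb0) cf0 C0 df dg gE N.
set S := fun w => \sum_(k < N) (c^-1 * f (Z k w) - r) => hS.
have mS : measurable_fun setT (fun w => (S w ^+ 2)%:E : \bar R).
  apply/measurable_EFinP; apply: measurable_funX; apply: measurable_sum => k.
  apply: measurable_funB => //; apply: measurable_funM => //.
  by apply: measurableT_comp => //; exact: measurable_funPT.
have -> : (\int[Pr]_w ((\sum_(k < N) (f (Z k w) - \int[P]_y f y)) ^+ 2)%:E =
    (c ^+ 2)%:E * \int[Pr]_w (S w ^+ 2)%:E)%E.
  rewrite -(ge0_integralZl Pr measurableT mS) ?lee_fin ?sqr_ge0//; last first.
    by move=> w _; rewrite lee_fin sqr_ge0.
  apply: eq_integral => w _; rewrite -EFinM -exprMn /S mulr_sumr; congr ((_ ^+ 2)%:E).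
  by apply: eq_bigr => k _; rewrite rE mulrBr mulrA divff// mul1r.
apply: (@le_trans _ _ ((c ^+ 2)%:E * (2 * N%:R * (cf * (2 * C + cf) * v))%:E)%E).
  by rewrite lee_wpmul2l// lee_fin sqr_ge0.
by rewrite -EFinM lee_fin le_eqVlt; apply/orP; left; apply/eqP; ring.
Qed.

End drift_variance.

(** * Test functions *)

Section smooth.
Context {R : realType}.
Implicit Types f g : R -> R.

Fixpoint kdiff (n : nat) f : Prop := if n is m.+1 then
  exists2 f' : R -> R, (forall x : R, is_derive x 1 f (f' x)) & kdiff m f' else True.

Lemma kdiffS n f : kdiff n.+1 f -> kdiff n f.
Proof.
elim: n f => [//|n IH] f [f' ff' kf']; exists f' => //.
exact: IH.
Qed.

Lemma kdiffD n f g : kdiff n f -> kdiff n g -> kdiff n (fun x => f x + g x).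
Proof.
elim: n f g => [//|n IH] f g [f' ff' kf'] [g' gg' kg'].
exists (fun x => f' x + g' x); last exact: IH.
by move=> x; exact: is_deriveD.
Qed.

Lemma kdiffZ n (c : R) f : kdiff n f -> kdiff n (fun x => c * f x).
Proof.
elim: n f => [//|n IH] f [f' ff' kf'].
exists (fun x => c * f' x); last exact: IH.
by move=> x; exact: is_deriveZ.
Qed.

Lemma kdiffM n f g : kdiff n f -> kdiff n g -> kdiff n (fun x => f x * g x).
Proof.
elim: n f g => [//|n IH] f g kf kg.
have kf0 := kdiffS kf; have kg0 := kdiffS kg.
case: kf => f' ff' kf'; case: kg => g' gg' kg'.
exists (fun x => f x * g' x + g x * f' x).
  by move=> x; exact: is_deriveM.
by apply: kdiffD; apply: IH.
Qed.

Lemma kdiff_affine n (a b : R) f : kdiff n f -> kdiff n (fun x => f (a * x + b)).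
Proof.
elim: n f => [//|n IH] f [f' ff' kf'].
exists (fun x => a * f' (a * x + b)); last by apply: kdiffZ; exact: IH.
move=> x; rewrite mulrC; apply: (@is_derive1_comp _ f (fun x => a * x + b)) => //.
have h : is_derive x 1 (fun y : R => a * y + b) (a * 1 + 0).
  apply: is_deriveD.
by move: h; rewrite mulr1 addr0.
Qed.

(* [x^-k exp (-1/x)] extended by 0 to [x <= 0]; these functions span a space
   stable under derivation. *)
Definition flat_exp (k : nat) (x : R) : R :=
  if 0 < x then x^-1 ^+ k * expR (- x^-1) else 0.

Lemma flat_exp_ge0 k x : 0 <= flat_exp k x.
Proof.
rewrite /flat_exp; case: ifP => // x0.
by rewrite mulr_ge0 ?expR_ge0// exprn_ge0// invr_ge0 ltW.
Qed.

(** With u = 1/x this is u^k <= k! exp(u), a single term of the exponential series. *)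
Lemma flat_exp_le k x : flat_exp k x <= k`!%:R.
Proof.
rewrite /flat_exp; case: ifP => x0; last exact: ler0n.
have u0 : 0 <= x^-1 by rewrite invr_ge0 ltW.
rewrite expRN ler_pdivrMr ?expR_gt0//.
case: k => [|k]; first by rewrite expr0 mul1r -expR0 ler_expR.
have f0 : 0 < (k.+1)`!%:R :> R by rewrite ltr0n fact_gt0.
have := expR_ge1Dxn k u0; rewrite -(ler_pM2l f0); apply: le_trans.
by rewrite mulrDr mulr1 mulrCA divff ?gt_eqF// mulr1 lerDr ltW.
Qed.

(** Together with [flat_exp_le], the factor x^2 bounds the difference quotient at 0 by |x| (k+2)!,
    so the derivative there is 0. *)
Lemma flat_exp_shift k x : flat_exp k x = x ^+ 2 * flat_exp k.+2 x.
Proof.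
rewrite /flat_exp; case: ifP => x0; last by rewrite mulr0.
rewrite mulrA; congr (_ * _); rewrite !exprS expr0; field.
by rewrite gt_eqF.
Qed.

Lemma is_derive_flat_exp k (x : R) :
  is_derive x 1 (flat_exp k) (flat_exp k.+2 x - k%:R * flat_exp k.+1 x).
Proof.
have [x0|x0|<-] := ltgtP 0 x.
- apply: (@near_eq_is_derive _ _ _ (fun y : R => y^-1 ^+ k * expR (- y^-1))).
    near=> y; rewrite /flat_exp ifT//.
    near: y; exact: lt_nbhsr.
  rewrite /flat_exp x0.
  have dV : is_derive x 1 (fun y : R => y^-1) (- x ^- 2).
    by apply: is_derive_eq; [apply: is_deriveV; rewrite ?gt_eqF|rewrite scaler1].
  have dX : is_derive x 1 (fun y : R => y^-1 ^+ k) (k%:R * x^-1 ^+ k.-1 * (- x ^- 2)).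
    rewrite (_ : (fun y : R => _) = (fun y : R => y^-1) ^+ k); last first.
      by apply/funext => y; rewrite exprfctE.
    exact: is_deriveX.
  have dE : is_derive x 1 (fun y : R => expR (- y^-1)) (expR (- x^-1) * x ^- 2).
    have dN : is_derive x 1 (fun y : R => - y^-1) (x ^- 2).
      by rewrite -[x ^- 2]opprK; exact: is_deriveN.
    exact: (is_derive1_comp (is_derive_expR _) dN).
  have dM := is_deriveM dX dE.
  apply: (@is_derive_eq _ _ _ _ _ _ _ _ dM).
  rewrite /GRing.scale/=.
  case: k {dX dM} => [|k] /=; rewrite -!exprVn ?expr0 !exprS; ring.
- have e l : flat_exp l x = 0 by rewrite /flat_exp ltNge (ltW x0).
  rewrite !e mulr0 subr0.
  apply: (@near_eq_is_derive _ _ _ (cst 0)).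
  near=> y; rewrite /flat_exp ifF//; apply/negbTE; rewrite -leNgt ltW//.
  near: y; exact: lt_nbhsl.
- have e l : flat_exp l (0 : R) = 0 by rewrite /flat_exp ltxx.
  rewrite !e mulr0 subr0.
  have hn : `|h| * k.+2`!%:R @[h --> (0 : R)^'] --> (0 : R).
    apply: cvg_within_filter.
    have : `|h| * k.+2`!%:R @[h --> (0 : R)] --> `|0 : R| * k.+2`!%:R.
      by apply: cvgM; [exact: norm_continuous|exact: cvg_cst].
    by rewrite normr0 mul0r.
  have h : h^-1 *: ((flat_exp k \o shift 0) (h *: 1) - flat_exp k 0) @[h --> (0 : R)^'] --> (0 : R).
    apply: (@squeeze_cvgr _ _ _ _ (fun h => - (`|h| * k.+2`!%:R)) (fun h => `|h| * k.+2`!%:R)).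
    + near=> h; rewrite -ler_norml /= addr0 /GRing.scale/= mulr1 e subr0.
      rewrite flat_exp_shift normrM normrV ?unitfE; last by near: h; exact: nbhs_dnbhs_neq.
      have h0 : h != 0 by near: h; exact: nbhs_dnbhs_neq.
      rewrite normrM normrX mulrA expr2 mulrA mulVf ?normr_eq0// mul1r.
      apply: ler_wpM2l => //; rewrite ger0_norm ?flat_exp_ge0//.
      exact: flat_exp_le.
    + by have := cvgN hn; rewrite oppr0; exact.
    + exact: hn.
  split; first by apply/cvg_ex; exists 0.
  exact: cvg_lim h.
Unshelve. all: by end_near. Qed.

Lemma kdiff_flat_exp n k : kdiff n (flat_exp k).
Proof.
elim: n k => [//|n IH] k.
exists (fun x => flat_exp k.+2 x - k%:R * flat_exp k.+1 x).
  exact: is_derive_flat_exp.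
rewrite (_ : (fun x => _) = (fun x => flat_exp k.+2 x + (- k%:R) * flat_exp k.+1 x)).
  by apply: kdiffD => //; exact: kdiffZ.
by apply/funext => x; rewrite mulNr.
Qed.

(** Listing all derivatives in one sequence reduces partial derivatives of products of such
    functions to a shift of indices. *)
Lemma kdiff_jet f : (forall n, kdiff n f) -> exists2 F : nat -> R -> R,
  F 0%N = f & forall n (x : R), is_derive x 1 (F n) (F n.+1 x).
Proof.
move=> kf; pose F n := iter n (@derive1 R R) f.
have FF n : forall m, kdiff m (F n).
  elim: n => [//|n IH] m.
  have [g Fg kg] := IH m.+1.
  rewrite /F iterS (_ : derive1 _ = g)//; apply/funext => x.
  by rewrite derive1E; exact: derive_val.
exists F => // n x; have [g Fg _] := FF n 1%N.
by rewrite /F iterS derive1E; apply: DeriveDef => //; exact: (ex_derive (Fg x)).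
Qed.

(** For y > 0, exp(-1/(m y)) tends to 1 as m grows, and [flat_exp] is 0 for y <= 0. These smooth
    functions, supported in [a, b], therefore tend to the indicator of the open interval without
    normalisation. *)
Definition smooth_bump (a b : R) (n : nat) (x : R) : R :=
  flat_exp 0 (n.+1%:R * (x - a)) * flat_exp 0 (n.+1%:R * (b - x)).

Lemma kdiff_smooth_bump a b n m : kdiff m (smooth_bump a b n).
Proof.
apply: kdiffM.
  rewrite (_ : (fun x => _) = (fun x => flat_exp 0 (n.+1%:R * x + - (n.+1%:R * a)))).
    by apply: kdiff_affine; exact: kdiff_flat_exp.
  by apply/funext => x; rewrite mulrBr.
rewrite (_ : (fun x => _) = (fun x => flat_exp 0 ((- n.+1%:R) * x + n.+1%:R * b))).
  by apply: kdiff_affine; exact: kdiff_flat_exp.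
by apply/funext => x; congr flat_exp; ring.
Qed.

Lemma smooth_bump_ge0 a b n x : 0 <= smooth_bump a b n x.
Proof. by rewrite mulr_ge0 ?flat_exp_ge0. Qed.

Lemma smooth_bump_le1 a b n x : smooth_bump a b n x <= 1.
Proof. by rewrite mulr_ile1 ?flat_exp_ge0// (flat_exp_le 0). Qed.

Lemma smooth_bump_out a b n x : x \notin `]a, b[ -> smooth_bump a b n x = 0.
Proof.
rewrite in_itv/= negb_and -!leNgt /smooth_bump /flat_exp => /orP[xa|bx].
  by rewrite ifF ?mul0r//; apply/negbTE; rewrite -leNgt pmulr_rle0// subr_le0.
by rewrite [X in _ * X]ifF ?mulr0//; apply/negbTE; rewrite -leNgt pmulr_rle0// subr_le0.
Qed.

Lemma smooth_bump_cvg a b x : smooth_bump a b n x @[n --> \oo] --> (\1_(`]a, b[%classic) x : R).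
Proof.
rewrite indicE; have [|xab] := boolP (x \in `]a, b[%classic); last first.
  rewrite /= (_ : (fun n => _) = cst 0); first exact: cvg_cst.
  apply/funext => n; apply: smooth_bump_out; apply: contra xab.
  by move=> h; exact: mem_set.
rewrite inE/= in_itv/= => /andP[ax xb].
have h (y : R) : 0 < y -> flat_exp 0 (n.+1%:R * y) @[n --> \oo] --> (1 : R).
  move=> y0; rewrite (_ : (fun n => _) = (fun n => expR (- (n.+1%:R^-1 * y^-1)))); last first.
    apply/funext => n; rewrite /flat_exp ifT ?mulr_gt0// expr0 mul1r invfM.
    by [].
  rewrite -[X in _ --> X]expR0; apply: continuous_cvg; first exact: continuous_expR.
  have hh : n.+1%:R^-1 * y^-1 @[n --> \oo] --> 0 * y^-1.
    by apply: cvgM; [exact: (@cvg_harmonic R)|exact: cvg_cst].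
  by have := cvgN hh; rewrite mul0r oppr0; exact.
rewrite -[X in _ --> X](mulr1 1); apply: cvgM; apply: h; by rewrite subr_gt0.
Qed.

End smooth.

(** * Products of one-dimensional test functions *)

Section product_test_functions.
Context {R : realType} {d : nat}.
Notation Rd := 'rV[R]_d.

Lemma is_derive_prod (I : eqType) (s : seq I) (G : I -> R -> R) (G' : I -> R) (t : R) :
  uniq s -> (forall i, is_derive t 1 (G i) (G' i)) ->
  is_derive t 1 (fun u => \prod_(i <- s) G i u)
    (\sum_(i <- s) \prod_(j <- s) if j == i then G' j else G j t).
Proof.
move=> + dG; elim: s => [_|i s IH /= /andP[iS uS]].
  rewrite big_nil; under eq_fun do rewrite big_nil.
  exact: is_derive_cst.
under eq_fun do rewrite big_cons.
have dM := is_deriveM (dG i) (IH uS).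
apply: (@is_derive_eq _ _ _ _ _ _ _ _ dM).
rewrite big_cons addrC /GRing.scale/=; congr (_ + _).
  rewrite big_cons eqxx mulrC; congr (_ * _).
  rewrite !big_seq; apply: eq_bigr => j js; rewrite ifF//.
  by apply/negbTE; apply: contraNneq iS => <-.
rewrite mulr_sumr !big_seq; apply: eq_bigr => j js; rewrite big_cons ifF//.
by apply/negbTE; apply: contraNneq iS => ->.
Qed.

(* [F i n] stands for the n-th derivative of [F i 0]. *)
Variable F : 'I_d -> nat -> R -> R.
Hypothesis dF : forall i n (x : R), is_derive x 1 (F i n) (F i n.+1 x).

Lemma continuous_jet i n : continuous (F i n).
Proof.
move=> x; apply: differentiable_continuous; apply/derivable1_diffP.
by case: (dF i n x) => h _; exact: h.
Qed.

Definition prodf (m : 'I_d -> nat) (x : Rd) : R := \prod_(i < d) F i (m i) (x 0 i).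

Definition incr_mult (m : 'I_d -> nat) (i : 'I_d) : 'I_d -> nat :=
  fun j => if j == i then (m j).+1 else m j.

Lemma is_derive_prodf_line m (x v : Rd) (t : R) :
  is_derive t 1 (fun u : R => prodf m (x + u *: v))
    (\sum_(i < d) v 0 i * prodf (incr_mult m i) (x + t *: v)).
Proof.
rewrite /prodf; have dG i : is_derive t 1 (fun u : R => F i (m i) ((x + u *: v) 0 i))
    (F i (m i).+1 ((x + t *: v) 0 i) * v 0 i).
  apply: (@is_derive1_comp _ (F i (m i)) (fun u : R => (x + u *: v) 0 i)).
  rewrite (_ : (fun u : R => _) = (fun u : R => x 0 i + v 0 i * u)); last first.
    by apply/funext => u; rewrite !mxE mulrC.
  have h : is_derive t 1 (fun u : R => x 0 i + v 0 i * u) (0 + v 0 i * 1).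
    apply: is_deriveD; exact: is_deriveZ.
  by move: h; rewrite add0r mulr1.
apply: (@is_derive_eq _ _ _ _ _ _ _ _ (is_derive_prod (index_enum_uniq 'I_d) dG)).
apply: eq_bigr => i _; rewrite (bigD1 i)//= eqxx [in RHS](bigD1 i)//= /incr_mult eqxx.
rewrite (mulrC (F _ _ _)) -mulrA; congr (_ * (_ * _)).
by apply: eq_bigr => j /negbTE ->.
Qed.

Lemma is_derive_prodf m (x v : Rd) :
  is_derive x v (prodf m) (\sum_(i < d) v 0 i * prodf (incr_mult m i) x).
Proof.
have := is_derive_prodf_line m x v 0; rewrite scale0r addr0 => -[].
have e : (fun h : R => h^-1 *: (((fun u : R => prodf m (x + u *: v)) \o shift 0) (h *: 1) -
      prodf m (x + 0 *: v))) =
    (fun h : R => h^-1 *: ((prodf m \o shift x) (h *: v) - prodf m x)).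
  apply/funext => h /=; rewrite scale0r !addr0 /GRing.scale/= mulr1.
  by rewrite [x + _]addrC.
rewrite /derivable /derive e => h1 h2; exact: DeriveDef.
Qed.

Lemma derive_prodf_delta m i :
  (fun x => 'D_(delta_mx 0 i) (prodf m) x) = prodf (incr_mult m i).
Proof.
apply/funext => x; rewrite (@derive_val _ _ _ _ _ _ _ (is_derive_prodf m x (delta_mx 0 i))).
rewrite (bigD1 i)//= mxE !eqxx mul1r big1 ?addr0// => j ji.
by rewrite mxE (negbTE ji) andbF mul0r.
Qed.

Lemma partials_prodf s m :
  partials s (prodf m) = prodf (fun i => (m i + count_mem i s)%N).
Proof.
elim: s => [|i s IH] /=; first by congr prodf; apply/funext => i; rewrite addn0.
rewrite IH derive_prodf_delta; congr prodf; apply/funext => j.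
rewrite /incr_mult eq_sym; case: eqP => // _.
by rewrite addnCA.
Qed.

Lemma continuous_prodf m : continuous (prodf m).
Proof.
rewrite /prodf; elim: (index_enum _) => [|i s IH].
  by under eq_fun do rewrite big_nil; exact: cst_continuous.
under eq_fun do rewrite big_cons.
move=> x; have h : {for x, continuous (F i (m i) \o (fun v : Rd => v 0 i))}.
  by apply: continuous_comp; [exact: coord_continuous|exact: continuous_jet].
exact: (continuousM h (IH x)).
Qed.

Variables a b : 'I_d -> R.
Hypothesis F0 : forall i x, x \notin `[a i, b i] -> F i 0 x = 0.

Let F0n i n x : x \notin `[a i, b i] -> F i n x = 0.
Proof.
elim: n x => [|n IH] x; first exact: F0.
move=> xab; rewrite -(@derive_val _ _ _ _ _ _ _ (dF i n x)).
rewrite -[RHS](derive_cst (0 : R) x 1).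
apply: near_eq_derive.
have : nbhs x (~` `[a i, b i]%classic).
  apply: open_nbhs_nbhs; split; last by move=> /= h; rewrite h in xab.
  by apply: closed_openC; exact: itv_closed.
by apply: filterS => y /= yab; apply: IH; apply/negP.
Qed.

Lemma prodf_out m (x : Rd) i : x 0 i \notin `[a i, b i] -> prodf m x = 0.
Proof. by move=> xi; rewrite /prodf (bigD1 i)//= F0n// mul0r. Qed.

Lemma test_function_prodf m : test_function (prodf m).
Proof.
split; first by move=> s; rewrite partials_prodf; exact: continuous_prodf.
split.
  move=> s i x; rewrite partials_prodf.
  by case: (is_derive_prodf (fun j => (m j + count_mem j s)%N) x (delta_mx 0 i)) => h _; exact: h.
have cbox : compact [set v : Rd | forall i, `[a i, b i]%classic (v ord0 i)].
  by apply: (rV_compact (A := fun i => `[a i, b i]%classic)) => i; exact: segment_compact.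
apply: (subclosed_compact _ cbox); first exact: closed_closure.
have clbox : closed [set v : Rd | forall i, `[a i, b i]%classic (v ord0 i)].
  by apply: compact_closed => //; exact: norm_hausdorff.
rewrite [X in _ `<=` X]((closure_id _).1 clbox).
apply: closureS => x /= + i; apply: contraNP => xi.
by rewrite (@prodf_out _ _ i)//; apply/negP.
Qed.

(** The support lies in a closed box while [box] is open; hence the margin 1. *)
Lemma prodf_bound m : exists2 M : R, 0 <= M &
  forall x, `|prodf m x| <= M * \1_(box (fun i => a i - 1) (fun i => b i + 1)) x.
Proof.
have /choice[M MP] i : exists M : R, 0 <= M /\ forall x, `|F i (m i) x| <= M.
  have [ab|ba] := leP (a i) (b i); last first.
    exists 0; split=> // x; rewrite F0n ?normr0// in_itv/=; apply/negP => /andP[h1 h2].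
    by have := le_lt_trans (le_trans h1 h2) ba; rewrite ltxx.
  have cF : {within `[a i, b i], continuous (fun x => `|F i (m i) x|)}.
    apply: continuous_subspaceT => x; apply: (continuous_comp _ (@norm_continuous _ _ _)).
    exact: continuous_jet.
  have [c cab cmax] := EVT_max ab cF.
  exists `|F i (m i) c|; split => // x.
  have [xab|xab] := boolP (x \in `[a i, b i]); first exact: cmax.
  by rewrite F0n// normr0.
exists (\prod_(i < d) M i); first by apply: prodr_ge0 => i _; have [] := MP i.
move=> x; rewrite indicE; have [xb|xb] := boolP (x \in _).
  rewrite mulr1 /prodf normr_prod; apply: ler_prod => i _.
  by rewrite normr_ge0/=; have [_] := MP i; exact.
rewrite mulr0; suff -> : prodf m x = 0 by rewrite normr0.
move: xb; rewrite notin_setE /box/= => /existsNP[i xi].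
apply: (@prodf_out _ _ i); apply/negP; rewrite in_itv/= => /andP[h1 h2].
by apply: xi; rewrite in_itv/=; apply/andP; split; lra.
Qed.

End product_test_functions.

(** * Fundamental lemma of the calculus of variations *)

Section fundamental_lemma.
Context {R : realType} {d : nat}.
Notation Rd := 'rV[R]_d.
Local Notation leb := (lebesgue_rV d : {measure set Rd -> \bar R}).

Definition ball_box (n : nat) : set Rd := box (fun=> - n%:R) (fun=> n%:R).

Lemma continuous_rV_measurable (f : Rd -> R) : continuous f -> measurable_fun setT f.
Proof.
move=> cf; apply: (measurability _ (RGenOpens.measurableE R)) => //.
move=> _ [_ [a [b ->] <-]]; rewrite setTI; apply: open_measurable_rV.
by move/continuousP : cf => /(_ `]a, b[%classic); apply; exact: interval_open.
Qed.

Lemma cvg_prod (I : Type) (s : seq I) (u : nat -> I -> R) (l : I -> R) :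
  (forall i, u n i @[n --> \oo] --> l i) ->
  \prod_(i <- s) u n i @[n --> \oo] --> \prod_(i <- s) l i.
Proof.
move=> ul; elim: s => [|i s IH].
  rewrite big_nil (_ : (fun n => _) = cst 1); first exact: cvg_cst.
  by apply/funext => n; rewrite big_nil.
rewrite big_cons (_ : (fun n => _) = (fun n => u n i * \prod_(j <- s) u n j)).
  exact: cvgM.
by apply/funext => n; rewrite big_cons.
Qed.

Lemma box_sub_ball_box a b : exists n, box a b `<=` ball_box n.
Proof.
exists (\max_(i < d) (Num.truncn (`|a i| + `|b i|)).+1)%N => v vab i.
have := vab i; rewrite !in_itv/= => /andP[h1 h2].
have h3 : `|a i| + `|b i| < (\max_(i < d) (Num.truncn (`|a i| + `|b i|)).+1)%:R.
  apply: (lt_le_trans (truncnS_gt _)).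
  by rewrite ler_nat (@leq_bigmax _ (fun i : 'I_d => (Num.truncn (`|a i| + `|b i|)).+1)).
have := ler_norm (- a i); have := ler_norm (b i); rewrite normrN.
have := normr_ge0 (a i); have := normr_ge0 (b i).
by move=> ? ? ? ?; apply/andP; split; lra.
Qed.

Lemma smooth_bump_jets (a b : 'I_d -> R) (n : nat) : exists F : 'I_d -> nat -> R -> R,
  [/\ forall i, F i 0%N = smooth_bump (a i) (b i) n,
      forall i k (x : R), is_derive x 1 (F i k) (F i k.+1 x) &
      forall i x, x \notin `[a i, b i] -> F i 0%N x = 0].
Proof.
have /choice[F FP] i : exists F : nat -> R -> R, F 0%N = smooth_bump (a i) (b i) n /\
    (forall k (x : R), is_derive x 1 (F k) (F k.+1 x)).
  have [F F0 dF] := kdiff_jet (kdiff_smooth_bump (a i) (b i) n).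
  by exists F.
exists F; split => [i|i|i x xab]; [by case: (FP i)|by case: (FP i)|].
have [-> _] := FP i; apply: smooth_bump_out; apply: contra xab; rewrite !in_itv/=.
by move=> /andP[/ltW -> /ltW ->].
Qed.

Variable D : Rd -> R.
Hypothesis mD : measurable_fun setT D.
Hypothesis iD : forall n, leb.-integrable (ball_box n) (EFin \o D).
Hypothesis D_test : forall (F : 'I_d -> nat -> R -> R) (a b : 'I_d -> R),
  (forall i k (x : R), is_derive x 1 (F i k) (F i k.+1 x)) ->
  (forall i x, x \notin `[a i, b i] -> F i 0%N x = 0) ->
  (\int[leb]_x (D x * prodf F (fun=> 0%N) x)%:E = 0)%E.

(** Products of bumps tend to the indicator of the box. They are at most 1 and vanish outside the
    box, so |D| on a large cube is an integrable majorant. *)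
Let integral_box a b : (\int[leb]_(x in box a b) (D x)%:E = 0)%E.
Proof.
have /choice[F FP] n := smooth_bump_jets a b n.
have phiE n x : prodf (F n) (fun=> 0%N) x = \prod_(i < d) smooth_bump (a i) (b i) n (x 0 i).
  by have [F0 _ _] := FP n; rewrite /prodf; apply: eq_bigr => i _; rewrite F0.
have mphi n : measurable_fun setT (prodf (F n) (fun=> 0%N)).
  by apply: continuous_rV_measurable; apply: continuous_prodf; have [] := FP n.
have phi_cvg x : prodf (F n) (fun=> 0%N) x @[n --> \oo] --> (\1_(box a b) x : R).
  under eq_fun do rewrite phiE.
  have -> : \1_(box a b) x = \prod_(i < d) (\1_(`]a i, b i[%classic) (x 0 i) : R).
    rewrite indicE; have [xab|xab] := boolP (x \in box a b).
      rewrite big1// => i _; rewrite indicE mem_set//=.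
      by move: xab; rewrite inE => /(_ i).
    move: xab; rewrite notin_setE /box/= => /existsNP[i xi].
    by rewrite (bigD1 i)//= indicE memNset ?mul0r//.
  by apply: cvg_prod => i; exact: smooth_bump_cvg.
have phi01 n x : 0 <= prodf (F n) (fun=> 0%N) x <= 1.
  rewrite phiE prodr_ge0/=; last by move=> i _; exact: smooth_bump_ge0.
  by apply: prodr_ile1 => i _; rewrite smooth_bump_ge0 smooth_bump_le1.
have phi_out n x : ~ box a b x -> prodf (F n) (fun=> 0%N) x = 0.
  move=> /existsNP[i xi]; rewrite phiE (bigD1 i)//= smooth_bump_out ?mul0r//.
  exact/negP.
have [N boxN] := box_sub_ball_box a b.
have mN : measurable (ball_box N) by exact: measurable_box.
have iDN : leb.-integrable setT ((EFin \o D) \_ (ball_box N)) by apply/(integrable_mkcond _ mN).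
have := @dominated_cvg _ _ _ leb setT measurableT
  (fun n x => (D x * prodf (F n) (fun=> 0%N) x)%:E)
  (fun x => (D x * \1_(box a b) x)%:E)
  (abse \o ((EFin \o D) \_ (ball_box N))).
have -> : (fun n => \int[leb]_x (D x * prodf (F n) (fun=> 0%N) x)%:E)%E = cst 0%E.
  by apply/funext => n; have [_ dF F0] := FP n; exact: D_test dF F0.
move=> h; have {h} : (cst 0%E : nat -> \bar R) @ \oo -->
    (\int[leb]_x (D x * \1_(box a b) x)%:E)%E.
  apply: h.
  - by move=> n; apply/measurable_EFinP; exact: measurable_funM.
  - move=> x _; apply: cvg_EFin; first exact: nearW.
    by apply: cvgM; [exact: cvg_cst|exact: phi_cvg].
  - by move=> x _ /=; rewrite patchE; case: ifP.
  - exact: integrable_abse.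
  - move=> n x _ /=; rewrite patchE; have [xN|xN] := boolP (x \in _).
      rewrite /= lee_fin normrM ler_piMr//; have /andP[h0 h1] := phi01 n x.
      by rewrite ger0_norm.
    rewrite phi_out ?mulr0 ?normr0//; first by rewrite abse0.
    by move=> /boxN xN'; rewrite mem_set in xN.
move=> /(cvg_unique _ (cvg_cst _)) -> //.
rewrite integral_mkcond; apply: eq_integral => x _; rewrite patchE indicE.
by case: (x \in _); rewrite ?mulr1 ?mulr0.
Qed.

(** Boxes are stable under intersection and generate the Borel sets, so vanishing integrals over
    boxes pass to all Borel sets. This is done on each cube separately, since [D] is only locally
    integrable. *)
Lemma ae_eq0_test : {ae leb, forall x, D x = 0}.
Proof.
have mball n : measurable (ball_box n) by exact: measurable_box.
have key n : {ae leb, forall x, ball_box n x -> D x = 0}.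
  have iDn : leb.-integrable setT ((EFin \o D) \_ (ball_box n)) by apply/(integrable_mkcond _ (mball n)).
  have h A : measurable A -> (\int[leb]_(x in A) ((EFin \o D) \_ (ball_box n)) x = 0)%E.
    have restr a b : (\int[leb]_(x in box a b) ((EFin \o D) \_ (ball_box n)) x = 0)%E.
      rewrite -integral_mkcondr.
      have [a' [b' ->]] : boxes (box a b `&` ball_box n).
        by apply: setI_closed_boxes; eexists; eexists.
      exact: integral_box.
    move=> mA; have sA : <<s (@boxes R d) >> A by rewrite -measurable_rV_boxes.
    apply: (@dynkin_induction _ _ (@boxes R d)
      (fun A => \int[leb]_(x in A) ((EFin \o D) \_ (ball_box n)) x = 0)%E
      measurable_rV_boxes (@setI_closed_boxes R d) _ _ _ _ A sA) => {A mA sA}.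
    - by rewrite -integral_mkcondr setTI integral_box.
    - by move=> _ [a [b ->]]; exact: restr.
    - move=> A mA A0.
      (* After the restriction of [D] to a cube, its integral over the whole space is one over a
         box. *)
      have e : (\int[leb]_(x in A `|` ~` A) ((EFin \o D) \_ (ball_box n)) x = 0)%E.
        by rewrite setUv -integral_mkcondr setTI integral_box.
      move: e; rewrite integral_setU//.
      + by rewrite A0 add0e.
      + exact: measurableC.
      + by rewrite setUv; exact: measurable_int iDn.
      + exact/disj_setPCl.
    - move=> B mB tB B0; rewrite integral_bigcup//.
      + by rewrite eseries0// => i _ _; exact: B0.
      + apply: (integrableS measurableT _ _ iDn) => //.
        exact: bigcup_measurable.
  have := @integral_ae_eq _ _ _ leb setT measurableT (cst 0%E) _ iDn (measurable_cst _).
  move=> /(_ _)[].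
    by move=> A _ mA; rewrite h// integral0.
  move=> N [mN N0 sub]; exists N; split => // x /= /not_implyP[xn Dx].
  apply: sub => /= /(_ Logic.I); rewrite patchE mem_set//=.
  by move=> [].
have : leb.-negligible (\bigcup_n [set x | ~ (ball_box n x -> D x = 0)]).
  exact: negligible_bigcup.
move=> [N [mN N0 sub]]; exists N; split => // x /= Dx; apply: sub.
have [n _ xn] : (\bigcup_n ball_box n) x by rewrite bigcup_box.
by exists n => //= /(_ xn).
Qed.

End fundamental_lemma.

(** * Taylor estimates for weak derivatives *)

Section translation.
Context {R : realType} {d : nat}.
Notation Rd := 'rV[R]_d.
Local Notation leb := (lebesgue_rV d).
Local Notation leb1 := (@lebesgue_measure R).

Definition Lpow (q : nat) (f : Rd -> R) : Prop :=
  measurable_fun setT f /\ (\int[leb]_x (`|f x| ^+ q)%:E < +oo)%E.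

(** Integrals over [0, 1] are written with this factor on the whole line, so that Fubini applies to
    full product spaces. *)
Definition unit_indic (t : R) : R := \1_(`[0, 1]%classic) t.

Lemma measurable_unit_indic : measurable_fun setT unit_indic.
Proof. exact: measurable_indic. Qed.

Lemma unit_indic_ge0 t : 0 <= unit_indic t.
Proof. by rewrite /unit_indic indicE. Qed.

Lemma integral_unit_indic : (\int[leb1]_t (unit_indic t)%:E = 1)%E.
Proof.
rewrite integral_indic// setIT; apply: etrans (lebesgue_measure_itv _) _.
by rewrite /= lte_fin ltr01 oppr0 adde0.
Qed.

Lemma measurable_translate d0 (T : measurableType d0) (X : T -> Rd) (c : T -> R) (v : Rd) :
  measurable_fun setT X -> measurable_fun setT c ->
  measurable_fun setT (fun z => X z + c z *: v).
Proof.
move=> mX mc; apply: measurable_fun_addrV => //.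
by apply: measurable_fun_scalerV => //; exact: measurable_cst.
Qed.

(** On [B] use |f| <= 1 + |f|^q. Translation does not change the integral of |f|^q, which makes the
    bound uniform in w. *)
Lemma integral_test_bound q (f : Rd -> R) (psi : Rd -> R) (M : R) (B : set Rd) :
  q \in [:: 1; 2]%N -> Lpow q f -> measurable_fun setT psi -> 0 <= M ->
  measurable B -> (leb B < +oo)%E -> (forall x, `|psi x| <= M * \1_B x) ->
  exists2 C : R, 0 <= C & forall w, (\int[leb]_x `|(f (x + w)%R * psi x)%:E| <= C%:E)%E.
Proof.
move=> hq [mf fq] mpsi M0 mB Boo psiB.
have q0 : (0 < q)%N by move: hq; rewrite !inE => /orP[]/eqP ->.
have Bfin : leb B \is a fin_num by rewrite ge0_fin_numE.
pose A := fine (\int[leb]_x (`|f x| ^+ q)%:E)%E.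
have AE : (\int[leb]_x (`|f x| ^+ q)%:E = A%:E)%E.
  rewrite fineK// ge0_fin_numE//; apply: integral_ge0 => x _.
  by rewrite lee_fin exprn_ge0.
have A0 : 0 <= A by apply: fine_ge0; apply: integral_ge0 => x _; rewrite lee_fin exprn_ge0.
exists (M * (fine (leb B) + A)) => [|w].
  by rewrite mulr_ge0// addr_ge0// fine_ge0.
have mI : measurable_fun setT (fun x : Rd => (\1_B x)%:E : \bar R).
  by apply/measurable_EFinP; exact: measurable_indic.
have mfq : measurable_fun setT (fun x : Rd => (`|f x| ^+ q)%:E : \bar R).
  by apply/measurable_EFinP; apply: measurable_funX; exact: measurableT_comp.
have mfqw : measurable_fun setT (fun x : Rd => (`|f (x + w)| ^+ q)%:E : \bar R).
  apply: (measurableT_comp mfq); apply: measurable_fun_addrV => //; exact: measurable_id.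
apply: (@le_trans _ _ (\int[leb]_x (M%:E * ((\1_B x)%:E + (`|f (x + w)%R| ^+ q)%:E)))%E).
  apply: ge0_le_integral_nonmeas => x //=.
  rewrite -EFinD -EFinM lee_fin normrM.
  apply: (@le_trans _ _ (`|f (x + w)| * (M * \1_B x))); first exact: ler_wpM2l.
  rewrite mulrCA; apply: ler_wpM2l => //.
  have h0 : 0 <= `|f (x + w)| ^+ q by rewrite exprn_ge0.
  rewrite indicE; case: (x \in B); last by rewrite mulr0 add0r.
  rewrite mulr1 /=; have [f1|f1] := leP `|f (x + w)| 1.
    by rewrite (le_trans f1)// lerDl.
  rewrite (@le_trans _ _ (`|f (x + w)| ^+ q))// ?lerDr//.
  by rewrite -[leLHS]expr1; apply: ler_weXn2l => //; exact: ltW.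
rewrite (ge0_integralZl leb measurableT (emeasurable_funD mI mfqw))//; last first.
  by move=> x _; rewrite -EFinD lee_fin addr_ge0// exprn_ge0.
rewrite (ge0_integralD leb measurableT _ mI _ mfqw)//.
rewrite integral_indic// setIT.
rewrite (integral_translate w mfq).
rewrite AE [X in (_ * (X + _))%E](_ : _ = (fine (leb B))%:E); last by rewrite fineK.
by rewrite -EFinD -EFinM.
Qed.

Lemma product_integrable (h : Rd * R -> R) (C : R) : measurable_fun setT h ->
  (forall t, (\int[leb]_x `|(h (x, t))%:E| <= (C * unit_indic t)%:E)%E) ->
  (leb \x leb1)%E.-integrable setT (EFin \o h).
Proof.
move=> mh hC; apply/integrable21ltyP; first exact/measurable_EFinP.
have C0 : 0 <= C.
  have := le_trans (integral_ge0 leb (fun x _ => abse_ge0 _)) (hC 0).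
  by rewrite /unit_indic indicE mem_set ?mulr1//= in_itv/= lexx ler01.
apply: (@le_lt_trans _ _ (\int[leb1]_t (C * unit_indic t)%:E)%E).
  by apply: ge0_le_integral_nonmeas => t; [exact: integral_ge0|exact: hC].
under eq_integral do rewrite EFinM.
have mU : measurable_fun setT (fun t => (unit_indic t)%:E : \bar R).
  by apply/measurable_EFinP; exact: measurable_unit_indic.
have U0 t : setT t -> (0 <= (unit_indic t)%:E)%E by rewrite lee_fin unit_indic_ge0.
have C0e : (0 <= C%:E)%E by rewrite lee_fin.
by rewrite (ge0_integralZl leb1 measurableT mU U0 C0e) integral_unit_indic mule1 ltry.
Qed.

Section shift_prodf.
Variables (F : 'I_d -> nat -> R -> R) (a b : 'I_d -> R) (w : Rd).
Hypothesis dF : forall i n (x : R), is_derive x 1 (F i n) (F i n.+1 x).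
Hypothesis F0 : forall i x, x \notin `[a i, b i] -> F i 0 x = 0.

Let G i n (x : R) := F i n (x - w 0 i).

Lemma test_function_prodf_shift m : test_function (fun x => prodf F m (x - w)) /\
  forall i, partials [:: i] (fun x => prodf F m (x - w)) =
    (fun x => prodf F (incr_mult m i) (x - w)).
Proof.
have dG i n (x : R) : is_derive x 1 (G i n) (G i n.+1 x).
  rewrite /G -[X in is_derive _ _ _ X]mulr1.
  apply: (@is_derive1_comp _ (F i n) (fun x => x - w 0 i)) => //.
  by rewrite -[X in is_derive _ _ _ X]addr0; apply: is_deriveD.
have GE k : (fun x => prodf F k (x - w)) = prodf G k.
  by apply/funext => x; rewrite /prodf /G; apply: eq_bigr => i _; rewrite !mxE.
have G0 i x : x \notin `[a i + w 0 i, b i + w 0 i] -> G i 0%N x = 0.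
  by move=> xab; apply: F0; apply: contra xab; rewrite !in_itv/= lerBrDr lerBlDr.
split=> [|i]; rewrite !GE; first exact: (test_function_prodf dG G0).
by rewrite /= derive_prodf_delta.
Qed.

End shift_prodf.

Section prodf_ftc.
Variable F : 'I_d -> nat -> R -> R.
Hypothesis dF : forall i n (x : R), is_derive x 1 (F i n) (F i n.+1 x).

(** The classical fundamental theorem of calculus on the segment from x to x - v. It is transferred
    to [f] below by moving the translations from [f] to the test function. *)
Lemma prodf_translate_ftc (x v : Rd) :
  let k t := unit_indic t *
     \sum_(i < d) v 0 i * prodf F (incr_mult (fun=> 0%N) i) (x - t *: v) in
  leb1.-integrable setT (EFin \o k) /\
  (\int[leb1]_t (k t)%:E =
   (prodf F (fun=> 0%N) x - prodf F (fun=> 0%N) (x - v))%:E)%E.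
Proof.
pose phi t := prodf F (fun=> 0%N) (x - t *: v).
pose H t := \sum_(i < d) v 0 i * prodf F (incr_mult (fun=> 0%N) i) (x - t *: v).
have dphi (t : R) : is_derive t 1 phi (- H t).
  have := is_derive_prodf_line dF (fun=> 0%N) x (- v) t.
  rewrite (_ : (fun u : R => _) = phi); last first.
    by apply/funext => u; rewrite /phi scalerN.
  move=> h; apply: (is_derive_eq h); rewrite /H -sumrN; apply: eq_bigr => i _.
  by rewrite mxE mulNr scalerN.
have cline : continuous (fun t : R => x - t *: v).
  move=> t; have c1 : {for t, continuous (fun t : R => t *: v)} by exact: scalel_continuous.
  have c0 : {for t, continuous (cst x : R -> Rd)} by exact: cst_continuous.
  exact: (continuousB c0 c1).
have cH : continuous H.
  rewrite /H; elim: (index_enum _) => [|i s IH].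
    rewrite (_ : (fun t => _) = cst 0); first exact: cst_continuous.
    by apply/funext => t; rewrite big_nil.
  rewrite (_ : (fun t => _) = (fun t => v 0 i * prodf F (incr_mult (fun=> 0%N) i) (x - t *: v) +
      \sum_(j <- s) v 0 j * prodf F (incr_mult (fun=> 0%N) j) (x - t *: v))); last first.
    by apply/funext => t; rewrite big_cons.
  move=> t; have c0 : {for t, continuous (cst (v 0 i) : R -> R)} by exact: cst_continuous.
  have c1 : {for t, continuous (prodf F (incr_mult (fun=> 0%N) i) \o (fun t : R => x - t *: v))}.
    by apply: continuous_comp; [exact: cline|exact: continuous_prodf].
  exact: (continuousD (continuousM c0 c1) (IH t)).
have cphi : continuous phi.
  move=> t; apply: differentiable_continuous; apply/derivable1_diffP.
  by case: (dphi t) => h _; exact: h.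
move=> k; have kE : EFin \o k = (EFin \o H) \_ `[0%R, 1%R].
  apply/funext => t; rewrite patchE /k /unit_indic /= indicE.
  by case: (t \in _); rewrite ?mul1r ?mul0r.
split.
  have mI : measurable (`[0%R, 1%R]%classic : set R) by exact: measurable_itv.
  rewrite kE; have [h1 _] := integrable_mkcond (mu:=leb1) (EFin \o H) mI. refine (h1 _).
  apply: continuous_compact_integrable; first exact: segment_compact.
  exact: continuous_subspaceT.
have := @continuous_FTC2 _ (fun t => H t) (fun t => - phi t) 0 1 ltr01.
move=> /(_ (continuous_subspaceT cH)) e.
transitivity (\int[leb1]_(t in `[0%R, 1%R]) (H t)%:E)%E.
  by rewrite [RHS]integral_mkcond -kE.
rewrite e.
- by rewrite -EFinB /phi scale1r scale0r subr0 opprK addrC.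
- split.
  + move=> t _; apply: derivableN; by case: (dphi t) => h _; exact: h.
  + by apply: cvgN; apply: cvg_at_right_filter; exact: cphi.
  + by apply: cvgN; apply: cvg_at_left_filter; exact: cphi.
- move=> t _; rewrite derive1E.
  have dN : is_derive t 1 (fun t => - phi t) (- - H t) by exact: is_deriveN.
  by rewrite (@derive_val _ _ _ _ _ _ _ dN) opprK.
Qed.

End prodf_ftc.

Lemma sum_pow_le q (I : Type) (s : seq I) : q \in [:: 1; 2]%N ->
  exists2 C : R, 0 <= C & forall a : I -> R,
    `|\sum_(i <- s) a i| ^+ q <= C * \sum_(i <- s) `|a i| ^+ q.
Proof.
move=> hq; elim: s => [|i s [C C0 IH]].
  exists 0 => // a; rewrite !big_nil mul0r normr0 expr0n.
  by move: hq; rewrite !inE => /orP[]/eqP ->.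
exists (2 * (1 + C)) => [|a]; first by rewrite mulr_ge0// addr_ge0.
rewrite !big_cons; have := IH a.
have S0 : 0 <= \sum_(j <- s) `|a j| ^+ q by apply: sumr_ge0 => j _; exact: exprn_ge0.
move: S0; set S := \sum_(j <- s) `|a j| ^+ q; set t := \sum_(j <- s) a j => S0 tS.
have t0 := normr_ge0 t; have a0 := normr_ge0 (a i).
have := ler_normD (a i) t; have := normr_ge0 (a i + t).
have CS : 0 <= C * S by rewrite mulr_ge0.
have Ca : 0 <= C * `|a i| ^+ q by rewrite mulr_ge0// exprn_ge0.
move: tS Ca CS S0; move: S t0 a0 => S; move: (`|a i|) (`|t|) (`|a i + t|) => x y z.
move: hq; rewrite !inE => /orP[]/eqP -> y0 x0 hy hC CS S0 z0 hz.
  by rewrite !expr1 in hC hy *; lra.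
have : z ^+ 2 <= (x + y) ^+ 2 by rewrite ler_pXn2r ?nnegrE// addr_ge0.
have := sqr_ge0 (x - y); rewrite sqrrB sqrrD !mulr2n => h1 h2.
have x2 : 0 <= x ^+ 2 by exact: sqr_ge0.
by lra.
Qed.

Lemma Lpow_sumZ q (c : 'I_d -> R) (g : 'I_d -> Rd -> R) : q \in [:: 1; 2]%N ->
  (forall i, Lpow q (g i)) -> Lpow q (fun x => \sum_(i < d) c i * g i x).
Proof.
move=> hq gq; split.
  apply: measurable_sum => i; apply: measurable_funM; first exact: measurable_cst.
  by case: (gq i).
have [C C0 CP] := sum_pow_le (index_enum 'I_d) hq.
have mi i : measurable_fun setT (fun x : Rd => (C * `|c i| ^+ q)%:E * (`|g i x| ^+ q)%:E : \bar R)%E.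
  apply: measurable_funeM; apply/measurable_EFinP; apply: measurable_funX.
  by apply: measurableT_comp => //; case: (gq i).
apply: (@le_lt_trans _ _ (\int[leb]_x \sum_(i < d) ((C * `|c i| ^+ q)%:E * (`|g i x| ^+ q)%:E))%E).
  apply: ge0_le_integral_nonmeas => x; first by rewrite lee_fin exprn_ge0.
  rewrite sumEFin lee_fin; apply: le_trans (CP _) _.
  rewrite mulr_sumr; apply: ler_sum => i _.
  by rewrite normrM exprMn mulrA.
have z0 i x : setT x -> (0 <= (C * `|c i| ^+ q)%:E * (`|g i x| ^+ q)%:E)%E.
  by rewrite -EFinM lee_fin !mulr_ge0// exprn_ge0.
rewrite (ge0_integral_sum leb measurableT mi)//.
apply: lte_sum_pinfty => i _.
have mgi : measurable_fun setT (fun x : Rd => (`|g i x| ^+ q)%:E : \bar R).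
  apply/measurable_EFinP; apply: measurable_funX.
  by apply: measurableT_comp => //; case: (gq i).
rewrite (ge0_integralZl leb measurableT mgi)//; last by rewrite lee_fin mulr_ge0// exprn_ge0.
by apply: lte_mul_pinfty => //; [rewrite lee_fin mulr_ge0// exprn_ge0|case: (gq i)].
Qed.

Lemma measurable_shift (w : Rd) (k : Rd -> R) : measurable_fun setT k -> measurable_fun setT (fun x : Rd => k (x + w)).
Proof.
move=> mk; apply: (measurableT_comp mk); apply: measurable_fun_addrV.
  exact: measurable_id.
exact: measurable_cst.
Qed.

Section translation_ftc.
Variables (q : nat) (f : Rd -> R) (g : 'I_d -> Rd -> R) (v : Rd).
Hypothesis hq : q \in [:: 1; 2]%N.
Hypotheses (fq : Lpow q f) (gq : forall i, Lpow q (g i)).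
Hypothesis fg : forall i, weak_partial [:: i] f (g i).

Let G (x : Rd) : R := \sum_(i < d) v 0 i * g i x.
Let h (z : Rd * R) : R := unit_indic z.2 * G (z.1 + z.2 *: v).

Let Gq : Lpow q G. Proof. exact: Lpow_sumZ. Qed.

Let mf : measurable_fun setT f. Proof. by case: fq. Qed.
Let mG : measurable_fun setT G. Proof. by case: Gq. Qed.

Let mh : measurable_fun setT h.
Proof.
apply: measurable_funM.
  by apply: measurableT_comp => //; exact: measurable_unit_indic.
by apply: (measurableT_comp mG); apply: measurable_translate.
Qed.

Let bounded_section (k : Rd -> R) (psi : Rd -> R) (M : R) B : Lpow q k ->
  measurable_fun setT psi -> 0 <= M ->
  measurable B -> (leb B < +oo)%E -> (forall x, `|psi x| <= M * \1_B x) ->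
  exists2 C : R, 0 <= C & forall w t,
   (\int[leb]_x `|(unit_indic t * k (x + w)%R * psi x)%:E| <= (C * unit_indic t)%:E)%E.
Proof.
move=> kq mpsi M0 mB Boo psiB.
have [C C0 CP] := integral_test_bound hq kq mpsi M0 mB Boo psiB.
exists C => // w t; under eq_integral do rewrite -mulrA EFinM abseM.
rewrite ge0_integralZl//.
- rewrite gee0_abs ?lee_fin ?unit_indic_ge0// mulrC EFinM.
  by apply: lee_wpmul2l; rewrite ?lee_fin ?unit_indic_ge0.
- apply: measurableT_comp => //; apply/measurable_EFinP; apply: measurable_funM => //.
  by apply: measurable_shift; case: kq.
Qed.

Let hpsi (psi : Rd -> R) (M : R) B : measurable_fun setT psi -> 0 <= M ->
  measurable B -> (leb B < +oo)%E -> (forall x, `|psi x| <= M * \1_B x) ->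
  (leb \x leb1)%E.-integrable setT (EFin \o (fun z : Rd * R => h z * psi z.1)).
Proof.
move=> mpsi M0 mB Boo psiB.
have [C C0 CP] := bounded_section Gq mpsi M0 mB Boo psiB.
apply: (@product_integrable (fun z => h z * psi z.1) C) => [|t]; last exact: (CP (t *: v) t).
by apply: measurable_funM => //; exact: measurableT_comp mpsi _.
Qed.

Let H x : R := fine (\int[leb1]_t (h (x, t))%:E)%E.

Let leb_box (a b : 'I_d -> R) : (leb (box a b) < +oo)%E.
Proof. by rewrite lebesgue_box ltry. Qed.

Let ball_bound n (x : Rd) : `|\1_(ball_box n) x : R| <= 1 * \1_(ball_box n) x.
Proof. by rewrite mul1r ger0_norm. Qed.

(** For q = 2 the function [h] need not be integrable on the product space. It is so over every
    cube, and Fubini is applied on countably many cubes. *)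
Let h_integrable : {ae leb, forall x, leb1.-integrable setT (fun t => (h (x, t))%:E)}.
Proof.
have : {ae leb, forall x, forall n,
    leb1.-integrable setT (fun t => (h (x, t) * \1_(ball_box n) x)%:E)}.
  apply: ae_foralln => n.
  have mI : measurable_fun setT (\1_(ball_box n) : Rd -> R).
    by apply: measurable_indic; exact: measurable_box.
  exact: (ae_integrable1 (hpsi mI ler01 (measurable_box _ _) (leb_box _ _) (@ball_bound n))).
apply: filterS => x xn.
have : (\bigcup_n box (fun=> - n%:R) (fun=> n%:R)) x by rewrite bigcup_box.
case=> n _ nx; have := xn n.
by under eq_fun do rewrite indicE mem_set// mulr1.
Qed.

Let psiH (psi : Rd -> R) (M : R) B : measurable_fun setT psi -> 0 <= M ->
  measurable B -> (leb B < +oo)%E -> (forall x, `|psi x| <= M * \1_B x) ->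
  leb.-integrable setT (fun x => (H x * psi x)%:E) /\
  (\int[leb]_x (H x * psi x)%:E = \int[leb1]_t \int[leb]_x (h (x, t) * psi x)%:E)%E.
Proof.
move=> mpsi M0 mB Boo psiB.
have ip := hpsi mpsi M0 mB Boo psiB.
have E : {ae leb, forall x, (\int[leb1]_t (h (x, t) * psi x)%:E = (H x * psi x)%:E)%E}.
  apply: filterS h_integrable => x ix.
  under eq_integral do rewrite EFinM.
  rewrite integralZr// EFinM /H fineK//; exact: integrable_fin_num.
have mHpsi : measurable_fun setT (fun x => (H x * psi x)%:E).
  by apply/measurable_EFinP; apply: measurable_funM => //; exact: measurable_section_integral.
have /integrableP[mF _] := integrable_fubini_F ip.
split.
  apply/integrableP; split=> //; have /integrableP[_] := integrable_fubini_F ip.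
  apply: le_lt_trans; rewrite le_eqVlt; apply/orP; left; apply/eqP.
  apply: ae_eq_integral => //; [exact: measurableT_comp|exact: measurableT_comp|].
  by apply: filterS E => x Ex _; rewrite -Ex.
rewrite -(Fubini ip); apply: ae_eq_integral => //.
by apply: filterS E => x Ex _.
Qed.

Section against_test_function.
Variables (F : 'I_d -> nat -> R -> R) (a b : 'I_d -> R).
Hypothesis dF : forall i n (x : R), is_derive x 1 (F i n) (F i n.+1 x).
Hypothesis F0 : forall i x, x \notin `[a i, b i] -> F i 0 x = 0.

Let phi := prodf F (fun=> 0%N).
Let Dphi (x : Rd) : R := \sum_(i < d) v 0 i * prodf F (incr_mult (fun=> 0%N) i) x.
Let B := box (fun i => a i - 1) (fun i => b i + 1).

Let mprodf m : measurable_fun setT (prodf F m).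
Proof. by apply: continuous_rV_measurable; exact: continuous_prodf. Qed.

Let mphi : measurable_fun setT phi. Proof. exact: mprodf. Qed.

Let mDphi : measurable_fun setT Dphi.
Proof.
apply: measurable_sum => i; apply: measurable_funM => //; exact: measurable_cst.
Qed.

Let test_integrable k m w : Lpow q k ->
  leb.-integrable setT (fun x => (k (x + w) * prodf F m x)%:E).
Proof.
move=> kq; have [M M0 MP] := prodf_bound dF F0 m.
have [C C0 CP] := integral_test_bound hq kq (mprodf m) M0 (measurable_box _ _) (leb_box _ _) MP.
apply/integrableP; split; last exact: le_lt_trans (CP w) (ltry _).
apply/measurable_EFinP; apply: measurable_funM => //.
by apply: measurable_shift; case: kq.
Qed.

Let weak_shift w : (\int[leb]_x (G (x + w)%R * phi x)%:E = - \int[leb]_x (f (x + w)%R * Dphi x)%:E)%E.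
Proof.
have -> : (\int[leb]_x (G (x + w)%R * phi x)%:E =
    \sum_(i < d) (v 0%R i)%:E * \int[leb]_x (g i (x + w)%R * phi x)%:E)%E.
  under eq_integral do rewrite mulr_suml -sumEFin.
  rewrite integral_sum//; last first.
    move=> i; under eq_fun do rewrite -mulrA EFinM.
    by apply: integrableZl => //; exact: test_integrable.
  apply: eq_bigr => i _; under eq_integral do rewrite -mulrA EFinM.
  by rewrite integralZl//; exact: test_integrable.
have -> : (\int[leb]_x (f (x + w)%R * Dphi x)%:E =
    \sum_(i < d) (v 0%R i)%:E * \int[leb]_x (f (x + w)%R * prodf F (incr_mult (fun=> 0%N) i) x)%:E)%E.
  under eq_integral do rewrite mulr_sumr -sumEFin.
  rewrite integral_sum//; last first.
    move=> i; under eq_fun do rewrite mulrCA EFinM.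
    by apply: integrableZl => //; exact: test_integrable.
  apply: eq_bigr => i _; under eq_integral do rewrite mulrCA EFinM.
  by rewrite integralZl//; exact: test_integrable.
have fin k m : Lpow q k -> (\int[leb]_x (k (x + w)%R * prodf F m x)%:E)%E \is a fin_num.
  by move=> kq; exact: integrable_fin_num (test_integrable m w kq).
rewrite -sumeN; last first.
  by move=> i j _ _; apply: fin_num_adde_defr; rewrite fin_numM//; exact: fin.
apply: eq_bigr => i _; rewrite -muleN; congr (_ * _)%E.
have [tphi Dphi'] := test_function_prodf_shift w dF F0 (fun=> 0%N).
have := @fg i _ tphi; rewrite Dphi' => e.
have shift k m : Lpow q k -> (\int[leb]_x (k (x + w)%R * prodf F m x)%:E =
    \int[leb]_x (k x * prodf F m (x - w)%R)%:E)%E.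
  move=> kq; have mk : measurable_fun setT (fun x : Rd => (k x * prodf F m (x - w))%:E : \bar R).
    apply/measurable_EFinP; apply: measurable_funM; first by case: kq.
    exact: measurable_shift.
  rewrite -(integral_translate w mk); apply: eq_integral => x _.
  by rewrite addrK.
by rewrite !shift// e expr1 EFinN mulN1e oppeK.
Qed.

(** The integrand f(x + t v) Dphi(x) after the substitution of x - t v for x. *)
Let k (z : Rd * R) : R := f z.1 * (unit_indic z.2 * Dphi (z.1 - z.2 *: v)).

Let Dphi_bound : exists2 M : R, 0 <= M & forall x, `|Dphi x| <= M * \1_B x.
Proof.
have /choice[M MP] i : exists M : R, 0 <= M /\
    forall x, `|prodf F (incr_mult (fun=> 0%N) i) x| <= M * \1_B x.
  by have [M M0 MP] := prodf_bound dF F0 (incr_mult (fun=> 0%N) i); exists M.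
exists (\sum_(i < d) `|v 0 i| * M i) => [|x].
  by apply: sumr_ge0 => i _; rewrite mulr_ge0//; case: (MP i).
apply: (le_trans (ler_norm_sum _ _ _)); rewrite mulr_suml; apply: ler_sum => i _.
by rewrite normrM -mulrA; apply: ler_wpM2l => //; case: (MP i).
Qed.

Let mk : measurable_fun setT k.
Proof.
apply: measurable_funM; first by exact: measurableT_comp mf _.
apply: measurable_funM.
  by apply: measurableT_comp => //; exact: measurable_unit_indic.
apply: (measurableT_comp mDphi).
rewrite (_ : (fun z : Rd * R => _) = fun z : Rd * R => z.1 + z.2 *: (- v)).
  exact: measurable_translate.
by apply/funext => z; rewrite scalerN.
Qed.

Let shift_k t (mu : R -> \bar R) : measurable_fun setT mu ->
  (\int[leb]_x mu (k (x, t)) = \int[leb]_x mu (f (x + t *: v)%R * (unit_indic t * Dphi x))%R)%E.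
Proof.
move=> mmu; have mkt : measurable_fun setT (fun x : Rd => mu (k (x, t))).
  by apply: measurableT_comp => //; apply: (measurableT_comp mk); exact: pair2_measurable.
rewrite -(integral_translate (t *: v) mkt); apply: eq_integral => x _.
by rewrite /k /= addrK.
Qed.

Let k_integrable : (leb \x leb1)%E.-integrable setT (EFin \o k).
Proof.
have [M M0 MP] := Dphi_bound.
have [C C0 CP] := bounded_section fq mDphi M0 (measurable_box _ _) (leb_box _ _) MP.
apply: (@product_integrable k C) => // t; apply: le_trans (CP (t *: v) t).
rewrite (@shift_k t (fun y => `|y%:E|%E)); last first.
  by apply: measurableT_comp => //; exact: EFin_measurable.
rewrite le_eqVlt; apply/orP; left; apply/eqP; apply: eq_integral => x _.
by rewrite mulrCA mulrA.
Qed.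

(** Fubini turns the left side into the t-integral of int G(x + t v) phi(x) dx. The weak derivative
    and a translation rewrite this as - int f(x) Dphi(x - t v) dx. Integrating over t first,
    [prodf_translate_ftc] leaves int f(x) (phi(x - v) - phi(x)) dx. *)
Let H_against : (\int[leb]_x (H x * phi x)%:E =
  \int[leb]_x (f (x + v)%R * phi x)%:E - \int[leb]_x (f x * phi x)%:E)%E.
Proof.
have [M M0 MP] := prodf_bound dF F0 (fun=> 0%N).
have [_ ->] := psiH (mprodf (fun=> 0%N)) M0 (measurable_box _ _) (leb_box _ _) MP.
have ih t : (\int[leb]_x (h (x, t) * phi x)%:E = \int[leb]_x (- k (x, t))%:E)%E.
  transitivity ((unit_indic t)%:E * \int[leb]_x (G (x + t *: v)%R * phi x)%:E)%E.
    have iG : leb.-integrable setT (fun x => (G (x + t *: v) * phi x)%:E) by exact: test_integrable.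
    by rewrite -integralZl//; apply: eq_integral => x _; rewrite -EFinM mulrA.
  have iD : leb.-integrable setT (fun x => (f (x + t *: v) * Dphi x)%:E).
    have [M' M'0 MP'] := Dphi_bound.
    have [C C0 CP] := integral_test_bound hq fq mDphi M'0 (measurable_box _ _) (leb_box _ _) MP'.
    apply/integrableP; split; last exact: le_lt_trans (CP _) (ltry _).
    by apply/measurable_EFinP; apply: measurable_funM => //; exact: measurable_shift.
  rewrite weak_shift (@shift_k t (fun y => (- y)%:E)); last first.
    by apply/measurable_EFinP; exact: oppr_measurable.
  rewrite muleN -mulNe -EFinN -integralZl//; apply: eq_integral => x _.
  by rewrite -EFinM mulNr mulrCA.
under eq_integral do rewrite ih.
have iNk : (leb \x leb1)%E.-integrable setT (EFin \o (fun z => - k z)).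
  rewrite (_ : _ \o _ = \- (EFin \o k))%E; first exact: integrableN k_integrable.
  by apply/funext => z /=; rewrite EFinN.
rewrite -(Fubini iNk).
have i1 : leb.-integrable setT (fun x => (f x * phi (x - v))%:E).
  have ip := test_integrable (fun=> 0%N) v fq.
  apply/integrableP; split.
    by apply/measurable_EFinP; apply: measurable_funM => //; exact: measurable_shift.
  have /integrableP[_] := ip; apply: le_lt_trans.
  rewrite -[leLHS](@integral_translate _ _ v); last first.
    by apply: measurableT_comp => //; apply/measurable_EFinP; apply: measurable_funM => //; exact: measurable_shift.
  rewrite le_eqVlt; apply/orP; left; apply/eqP; apply: eq_integral => x _.
  by rewrite addrK.
have i0 : leb.-integrable setT (fun x => (f x * phi x)%:E).
  have := test_integrable (fun=> 0%N) 0 fq.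
  by under eq_fun do rewrite addr0.
transitivity (\int[leb]_x ((f x * phi (x - v)%R)%:E - (f x * phi x)%:E))%E.
  apply: eq_integral => x _ /=.
  have [ix ex] := prodf_translate_ftc dF x v.
  transitivity ((- f x)%:E * \int[leb1]_t (unit_indic t * Dphi (x - t *: v)%R)%:E)%E.
    rewrite -integralZl//; apply: eq_integral => t _.
    by rewrite -EFinM mulNr.
  rewrite /Dphi ex -EFinM -EFinB; congr _%:E.
  by rewrite -/phi mulNr mulrBr opprB.
rewrite integralB//; congr (_ - _)%E.
rewrite -[LHS](@integral_translate _ _ v).
  by apply: eq_integral => x _; rewrite addrK.
by case/integrableP : i1.
Qed.

Lemma translation_test :
  (\int[leb]_x ((f (x + v) - f x - H x)%R * phi x)%:E = 0)%E.
Proof.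
have [M M0 MP] := prodf_bound dF F0 (fun=> 0%N).
have [iH _] := psiH (mprodf (fun=> 0%N)) M0 (measurable_box _ _) (leb_box _ _) MP.
have i1 := test_integrable (fun=> 0%N) v fq.
have i0 : leb.-integrable setT (fun x => (f x * phi x)%:E).
  have := test_integrable (fun=> 0%N) 0 fq.
  by under eq_fun do rewrite addr0.
under eq_integral do rewrite !mulrBl !EFinB.
rewrite integralB//; last exact: integrableB.
rewrite integralB// H_against subee//.
by rewrite fin_numB !(integrable_fin_num measurableT).
Qed.

End against_test_function.

Lemma translation_ftc : {ae leb, forall x,
  leb1.-integrable setT (fun t => (unit_indic t * \sum_(i < d) v 0 i * g i (x + t *: v))%:E) /\
  (\int[leb1]_t (unit_indic t * \sum_(i < d) v 0%R i * g i (x + t *: v)%R)%:E = (f (x + v)%R - f x)%:E)%E}.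
Proof.
have mH : measurable_fun setT H by exact: measurable_section_integral.
have mD : measurable_fun setT (fun x : Rd => f (x + v) - f x - H x).
  by apply: measurable_funB => //; apply: measurable_funB => //; exact: measurable_shift.
(* The difference is locally integrable and annihilates every product of bumps. The exceptional null
   set may depend on v. *)
have : {ae leb, forall x, f (x + v) - f x - H x = 0}.
  apply: ae_eq0_test => // [n|]; last exact: translation_test.
  have mI : measurable_fun setT (\1_(ball_box n) : Rd -> R).
    by apply: measurable_indic; exact: measurable_box.
  have [iH _] := psiH mI ler01 (measurable_box _ _) (leb_box _ _) (@ball_bound n).
  have [C C0 CP] := integral_test_bound hq fq mI ler01 (measurable_box _ _) (leb_box _ _) (@ball_bound n).
  have if_ w : leb.-integrable setT (fun x => (f (x + w) * \1_(ball_box n) x)%:E).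
    apply/integrableP; split; last exact: le_lt_trans (CP w) (ltry _).
    by apply/measurable_EFinP; apply: measurable_funM => //; exact: measurable_shift.
  apply/(integrable_mkcond _ (measurable_box _ _)).
  rewrite (_ : _ \_ _ = (fun x => (f (x + v) * \1_(ball_box n) x)%:E) \-
      (fun x => (f (x + 0) * \1_(ball_box n) x)%:E) \- (fun x => (H x * \1_(ball_box n) x)%:E))%E.
    by apply: integrableB => //; exact: integrableB.
  apply/funext => x; rewrite patchE /= addr0 indicE.
  by case: (x \in _); rewrite ?mulr1 ?mulr0 ?subee.
move=> aeD; apply: filterS2 h_integrable aeD => x ix Dx; split=> //.
have <- : H x = f (x + v) - f x by apply/eqP; rewrite eq_sym -subr_eq0 Dx.
by rewrite /H fineK//; exact: integrable_fin_num.
Qed.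

End translation_ftc.

End translation.

(** * Estimates for translations and Taylor remainders in L^q *)

Section translation_estimates.
Context {R : realType} {d : nat}.
Notation Rd := 'rV[R]_d.
Local Notation leb := (lebesgue_rV d).
Local Notation leb1 := (@lebesgue_measure R).

Lemma pow12_gt0 q : q \in [:: 1; 2]%N -> (0 < q)%N.
Proof. by rewrite !inE => /orP[]/eqP ->. Qed.

Lemma coord_le_enorm (u : Rd) i : `|u 0 i| <= enorm u.
Proof.
rewrite /enorm -sqrtr_sqr ler_wsqrtr// (bigD1 i)//= lerDl.
by apply: sumr_ge0 => j _; exact: sqr_ge0.
Qed.

Lemma enorm_ge0 (u : Rd) : 0 <= enorm u. Proof. exact: sqrtr_ge0. Qed.

Lemma enormZ (c : R) (u : Rd) : enorm (c *: u) = `|c| * enorm u.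
Proof.
rewrite /enorm -sqrtr_sqr -sqrtrM ?sqr_ge0//; congr Num.sqrt.
by rewrite mulr_sumr; apply: eq_bigr => i _; rewrite mxE exprMn.
Qed.

Lemma measurable_enorm : measurable_fun setT (@enorm R d).
Proof.
apply: (measurableT_comp (continuous_measurable_fun (@sqrt_continuous R))).
by apply: measurable_sum => i; apply: measurable_funX; exact: measurable_coord_rV.
Qed.

(** An average over t in [0, 1] has q-th power integral at most the uniform bound of its terms, by
    Jensen for the uniform law. *)
Lemma unit_average_pow_le q (D : Rd -> R) (Q : Rd * R -> R) (A : R) :
  q \in [:: 1; 2]%N -> measurable_fun setT D -> measurable_fun setT Q -> 0 <= A ->
  (forall t, 0 <= t <= 1 -> (\int[leb]_x (`|Q (x, t)| ^+ q)%:E <= A%:E)%E) ->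
  {ae leb, forall x, (`|D x|%:E <= \int[leb1]_t (unit_indic t * `|Q (x, t)|)%:E)%E} ->
  (\int[leb]_x (`|D x| ^+ q)%:E <= A%:E)%E.
Proof.
move=> hq mD mQ A0 QA DQ.
have q0 := pow12_gt0 hq.
pose g (z : Rd * R) := unit_indic z.2 * `|Q z|.
have mg : measurable_fun setT g.
  apply: measurable_funM; last exact: measurableT_comp.
  by apply: measurableT_comp => //; exact: measurable_unit_indic.
have g0 z : 0 <= g z by rewrite mulr_ge0// unit_indic_ge0.
have U1 : (\int[leb1]_t (unit_indic t)%:E <= 1%:E)%E by rewrite integral_unit_indic.
have gA t : (\int[leb]_x (g (x, t) ^+ q)%:E <= A%:E)%E.
  rewrite /g /unit_indic /= indicE; have [t01|t01] := boolP (t \in _); last first.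
    rewrite integral0_eq ?lee_fin// => x _.
    by rewrite mul0r expr0n (gtn_eqF q0).
  rewrite (_ : (fun x => _) = (fun x => (`|Q (x, t)| ^+ q)%:E)).
    by apply: QA; move: t01; rewrite inE/= in_itv.
  by apply/funext => x; rewrite mul1r.
have main := @integral_weighted_pow_le _ q _ _ _ _ leb leb1 g unit_indic (fun=> A) 1
  hq mg measurable_unit_indic g0 (@unit_indic_ge0 R) U1 gA.
(* An indicator equals its square, so [unit_indic] can be both a factor of [g] and the weight. *)
have UU x t : g (x, t) * unit_indic t = g (x, t).
  by rewrite /g /unit_indic /= indicE; case: (t \in _); rewrite ?mulr1// !mul0r.
have E : (\int[leb]_x (\int[leb1]_t (g (x, t))%:E) ^+ q <= A%:E)%E.
  move: main; under eq_integral do under eq_integral do rewrite UU.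
  move=> main; apply: le_trans main _; rewrite expr1n mul1e.
  under eq_integral do rewrite EFinM.
  have mU : measurable_fun setT (fun t : R => (unit_indic t)%:E : \bar R).
    by apply/measurable_EFinP; exact: measurable_unit_indic.
  have U0 (t : R) : setT t -> (0 <= (unit_indic t)%:E)%E by rewrite lee_fin unit_indic_ge0.
  rewrite (ge0_integralZl leb1 measurableT mU U0) ?lee_fin//.
  by rewrite integral_unit_indic mule1.
apply: le_trans E.
have mI : measurable_fun setT (fun x => \int[leb1]_t (g (x, t))%:E)%E.
  apply: (measurable_fun_fubini_tonelli_F (m2 := leb1) (EFin \o g)).
    exact/measurable_EFinP.
  by move=> z; rewrite lee_fin.
have I0 x : (0 <= \int[leb1]_t (g (x, t))%:E)%E by apply: integral_ge0 => t _; rewrite lee_fin.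
apply: ae_ge0_le_integral => //.
- by apply/measurable_EFinP; apply: measurable_funX; exact: measurableT_comp.
- by move=> x _; exact: expe_ge0.
- move: hq; rewrite !inE => /orP[]/eqP ->; first exact: mI.
  by under eq_fun do rewrite expe2; exact: emeasurable_funM.
apply: filterS DQ => x Dx _; rewrite EFin_expe.
by move: hq; rewrite !inE => /orP[]/eqP ->; [exact: Dx|rewrite !expe2; apply: lee_pmul].
Qed.

Section first_order.
Variables (q : nat) (f : Rd -> R) (g : 'I_d -> Rd -> R).
Hypothesis hq : q \in [:: 1; 2]%N.
Hypotheses (fq : Lpow q f) (gq : forall i, Lpow q (g i)).

Let mf : measurable_fun setT f. Proof. by case: fq. Qed.
Let mg i : measurable_fun setT (g i). Proof. by case: (gq i). Qed.

Lemma directional_pow_le : exists2 C : R, 0 <= C & forall (u : Rd -> 'I_d -> R) (A : R) (v : Rd),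
  (forall i, measurable_fun setT (u ^~ i)) ->
  (forall i, (\int[leb]_x (`|u x i| ^+ q)%:E <= A%:E)%E) ->
  (\int[leb]_x (`|(\sum_(i < d) v 0%R i * u x i)%R| ^+ q)%:E <= (C * enorm v ^+ q * A)%:E)%E.
Proof.
have [C C0 CP] := sum_pow_le (R := R) (index_enum 'I_d) hq.
exists (C * d%:R) => [|u A v mu uA]; first by rewrite mulr_ge0.
have mi i : measurable_fun setT (fun x : Rd => (C * enorm v ^+ q)%:E * (`|u x i| ^+ q)%:E : \bar R)%E.
  apply: measurable_funeM; apply/measurable_EFinP; apply: measurable_funX.
  exact: measurableT_comp.
have c0 : 0 <= C * enorm v ^+ q by rewrite mulr_ge0// exprn_ge0// enorm_ge0.
apply: (@le_trans _ _ (\int[leb]_x \sum_(i < d) ((C * enorm v ^+ q)%:E * (`|u x i| ^+ q)%:E))%E).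
  apply: ge0_le_integral_nonmeas => x; first by rewrite lee_fin exprn_ge0.
  rewrite sumEFin lee_fin; apply: le_trans (CP _) _.
  rewrite mulr_sumr; apply: ler_sum => i _.
  rewrite normrM exprMn mulrA; apply: ler_wpM2r; first exact: exprn_ge0.
  apply: ler_wpM2l => //; apply: lerXn2r; rewrite ?nnegrE ?enorm_ge0//.
  exact: coord_le_enorm.
rewrite (ge0_integral_sum leb measurableT mi); last first.
  by move=> i x _; rewrite -EFinM lee_fin mulr_ge0// exprn_ge0.
apply: (@le_trans _ _ (\sum_(i < d) (C * enorm v ^+ q * A)%:E)%E).
  apply: lee_sum => i _.
  have mui : measurable_fun setT (fun x : Rd => (`|u x i| ^+ q)%:E : \bar R).
    by apply/measurable_EFinP; apply: measurable_funX; exact: measurableT_comp.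
  rewrite (ge0_integralZl leb measurableT mui)//.
  by rewrite (EFinM (C * enorm v ^+ q) A); apply: lee_wpmul2l.
rewrite sumEFin lee_fin sumr_const card_ord -[leLHS]mulr_natl.
by rewrite le_eqVlt; apply/orP; left; apply/eqP; ring.
Qed.

Let Lpow_bound : exists2 A : R, 0 <= A & forall i w, (\int[leb]_x (`|g i (x + w)%R| ^+ q)%:E <= A%:E)%E.
Proof.
exists (\sum_(i < d) fine (\int[leb]_x (`|g i x| ^+ q)%:E)%E) => [|i w].
  by apply: sumr_ge0 => i _; apply: fine_ge0; apply: integral_ge0 => x _; rewrite lee_fin exprn_ge0.
have mgi : measurable_fun setT (fun x : Rd => (`|g i x| ^+ q)%:E : \bar R).
  by apply/measurable_EFinP; apply: measurable_funX; exact: measurableT_comp.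
rewrite (integral_translate w mgi).
have fin : (\int[leb]_x (`|g i x| ^+ q)%:E)%E \is a fin_num.
  rewrite ge0_fin_numE; first by case: (gq i).
  by apply: integral_ge0 => x _; rewrite lee_fin exprn_ge0.
rewrite -(fineK fin) lee_fin (bigD1 i)//= lerDl.
by apply: sumr_ge0 => j _; apply: fine_ge0; apply: integral_ge0 => x _; rewrite lee_fin exprn_ge0.
Qed.

Hypothesis fg : forall i, weak_partial [:: i] f (g i).

Lemma translation_pow_le : exists2 C : R, 0 <= C & forall v : Rd,
  (\int[leb]_x (`|f (x + v)%R - f x| ^+ q)%:E <= (C * enorm v ^+ q)%:E)%E.
Proof.
have [C C0 CP] := directional_pow_le; have [A A0 AP] := Lpow_bound.
exists (C * A) => [|v]; first exact: mulr_ge0.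
rewrite mulrAC.
apply: (unit_average_pow_le (Q := fun z => \sum_(i < d) v 0 i * g i (z.1 + z.2 *: v))) => //.
- by apply: measurable_funB => //; exact: measurable_shift.
- apply: measurable_sum => i; apply: measurable_funM => //.
  by apply: (measurableT_comp (mg i)); exact: measurable_translate.
- by rewrite !mulr_ge0// exprn_ge0// enorm_ge0.
- move=> t _; apply: (CP (fun x i => g i (x + t *: v))) => i; last exact: AP.
  exact: measurable_shift.
- apply: filterS (translation_ftc v hq fq gq fg) => x [ix ex].
  rewrite -abse_EFin -ex; apply: le_trans (le_abse_integral _ _ _) _ => //.
    by case/integrableP : ix.
  apply: ge0_le_integral_nonmeas => t //=.
  by rewrite lee_fin normrM (ger0_norm (unit_indic_ge0 _)).
Qed.

End first_order.

Section second_order.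
Variables (q : nat) (f : Rd -> R) (g : 'I_d -> Rd -> R) (gg : 'I_d -> 'I_d -> Rd -> R).
Hypothesis hq : q \in [:: 1; 2]%N.
Hypotheses (fq : Lpow q f) (gq : forall i, Lpow q (g i)) (ggq : forall i j, Lpow q (gg i j)).
Hypothesis fg : forall i, weak_partial [:: i] f (g i).
Hypothesis fgg : forall i j, weak_partial [:: j] (g i) (gg i j).

Definition taylor_rest (x v : Rd) : R := f (x + v) - f x - \sum_(i < d) v 0 i * g i x.

(** The remainder is the average over t of the sum of v_i (g_i(x + t v) - g_i(x)). One factor |v|^q
    comes from v_i, the other from [translation_pow_le] applied to each g_i. *)
Lemma taylor_pow_le : exists2 C : R, 0 <= C & forall v : Rd,
  (\int[leb]_x (`|taylor_rest x v| ^+ q)%:E <= (C * enorm v ^+ (2 * q))%:E)%E.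
Proof.
have [C C0 CP] := directional_pow_le hq.
have mf : measurable_fun setT f by case: fq.
have mg i : measurable_fun setT (g i) by case: (gq i).
have /choice[A AP] i : exists A : R, 0 <= A /\ forall v : Rd,
  (\int[leb]_x (`|g i (x + v)%R - g i x| ^+ q)%:E <= (A * enorm v ^+ q)%:E)%E.
  by have [A A0 AP] := translation_pow_le hq (gq i) (ggq i) (fgg i); exists A.
pose B := \sum_(i < d) A i.
have AB i : A i <= B.
  by rewrite /B (bigD1 i)//= lerDl; apply: sumr_ge0 => j _; case: (AP j).
have B0 : 0 <= B by apply: sumr_ge0 => j _; case: (AP j).
exists (C * B) => [|v]; first exact: mulr_ge0.
have v0 := enorm_ge0 v.
rewrite (_ : C * B * _ = C * enorm v ^+ q * (B * enorm v ^+ q)); last by rewrite mul2n -addnn exprD; ring.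
apply: (unit_average_pow_le (Q := fun z =>
    \sum_(i < d) v 0 i * (g i (z.1 + z.2 *: v) - g i z.1))) => //.
- apply: measurable_funB; first by apply: measurable_funB => //; exact: measurable_shift.
  by apply: measurable_sum => i; exact: measurable_funM.
- apply: measurable_sum => i; apply: measurable_funM => //; apply: measurable_funB.
    by apply: (measurableT_comp (mg i)); exact: measurable_translate.
  exact: measurableT_comp.
- by rewrite !mulr_ge0// exprn_ge0.
- move=> t /andP[t0 t1]; apply: (CP (fun x i => g i (x + t *: v) - g i x)) => i.
    by apply: measurable_funB => //; exact: measurable_shift.
  have [Ai0 /(_ (t *: v)) h] := AP i; apply: le_trans h _; rewrite lee_fin enormZ.
  apply: ler_pM => //; first by rewrite exprn_ge0// mulr_ge0.
  apply: lerXn2r; rewrite ?nnegrE ?mulr_ge0//.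
  by rewrite ger0_norm// ler_piMl.
- apply: filterS (translation_ftc v hq fq gq fg) => x [ix ex].
  pose c := \sum_(i < d) v 0 i * g i x.
  have iu : leb1.-integrable setT (fun t => (unit_indic t)%:E).
    apply/integrableP; split; first by apply/measurable_EFinP; exact: measurable_unit_indic.
    under eq_integral do rewrite gee0_abs ?lee_fin ?unit_indic_ge0//.
    by rewrite integral_unit_indic ltry.
  have ic : leb1.-integrable setT (fun t => (c%:E * (unit_indic t)%:E)%E).
    exact: integrableZl.
  have e : (\int[leb1]_t (unit_indic t * \sum_(i < d) v 0%R i * (g i (x + t *: v)%R - g i x))%:E =
      (taylor_rest x v)%:E)%E.
    rewrite /taylor_rest EFinB -ex -/c -[X in (_ - X)%E]mule1 -integral_unit_indic -integralZl//.
    rewrite -integralB//; apply: eq_integral => t _; rewrite -EFinM -EFinB.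
    congr _%:E; rewrite (mulrC c) -mulrBr; congr (_ * _).
    by rewrite /c -sumrB; apply: eq_bigr => i _; rewrite mulrBr.
  rewrite -abse_EFin -e; apply: le_trans (le_abse_integral _ _ _) _ => //.
    apply/measurable_EFinP; apply: measurable_funM; first exact: measurable_unit_indic.
    apply: measurable_sum => i; apply: measurable_funM => //; apply: measurable_funB => //.
    apply: (measurableT_comp (mg i)); apply: measurable_fun_addrV => //.
    by apply: measurable_fun_scalerV => //; exact: measurable_cst.
  apply: ge0_le_integral_nonmeas => t //=.
  by rewrite lee_fin normrM (ger0_norm (unit_indic_ge0 _)).
Qed.

End second_order.

End translation_estimates.

(** * Bias *)

Section bias.
Context {R : realType} {d : nat}.
Notation Rd := 'rV[R]_d.
Local Notation leb := (lebesgue_rV d).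
Implicit Types (K f p : Rd -> R).

Lemma Lfun_Lpow f : (f \in Lfun leb 1 -> Lpow 1 f) * (f \in Lfun leb 2%:E -> Lpow 2 f).
Proof.
have mE (r : \bar R) : f \in Lfun leb r -> measurable_fun setT f.
  by move=> /sub_Lfun_mfun; rewrite inE.
split=> fL; split; try exact: mE fL.
  have /integrableP[_] := (Lfun1_integrable leb f).1 fL.
  by under eq_integral do rewrite abse_EFin -[`|_|]expr1.
have /integrableP[_] := Lfun2_integrable_sqr fL.
by under eq_integral do rewrite abse_EFin normrX.
Qed.

Lemma partials_cat (s t : seq 'I_d) f : partials (s ++ t) f = partials s (partials t f).
Proof. by rewrite /partials foldr_cat. Qed.

Lemma test_function_partials t f : test_function f -> test_function (partials t f).
Proof.
move=> [cf [df suppf]]; split; first by move=> s; rewrite -partials_cat; exact: cf.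
split; first by move=> s i x; rewrite -partials_cat; exact: df.
apply: (subclosed_compact _ suppf); first exact: closed_closure.
rewrite [X in _ `<=` X](closure_id _).1; last exact: closed_closure.
apply: closureS => x /= fx; apply: contrapT => xf; move: fx; apply/negP; rewrite negbK; apply/eqP.
have : \forall y \near x, f y = 0.
  have : open (~` closure [set x | f x != 0]) by apply: closed_openC; exact: closed_closure.
  rewrite openE => /(_ x xf); apply: filterS => y yf; apply/eqP; apply: contrapT => /negP y0.
  by apply: yf; apply: subset_closure.
elim: t => [|i t IH] /= fx0; first exact: nbhs_singleton fx0.
have {}IH : \forall y \near x, partials t f y = 0.
  suff: forall y, (\forall z \near y, f z = 0) -> partials t f y = 0.
    move=> h; move/nbhs_interior : fx0; apply: filterS => y; exact: h.
  elim: t {IH} => [|j t IH] y fy; first exact: nbhs_singleton fy.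
  transitivity ('D_(delta_mx 0 j) (cst (0 : R)) y); last exact: derive_cst.
  apply: near_eq_derive; move/nbhs_interior : fy; apply: filterS => z; exact: IH.
transitivity ('D_(delta_mx 0 i) (cst (0 : R)) x); last exact: derive_cst.
exact: near_eq_derive.
Qed.

(** A Sobolev function comes with weak derivatives of itself only, while the Taylor estimate needs
    those of its first derivatives. Testing [f] with the derivative of a test function gives them;
    the sign (-1)^|t| appears twice and cancels. *)
Lemma weak_partial_iter (s t : seq 'I_d) f g k :
  weak_partial t f g -> weak_partial (t ++ s) f k -> weak_partial s g k.
Proof.
move=> fg fk phi tphi; have := fk _ tphi; rewrite partials_cat.
rewrite (fg _ (test_function_partials s tphi)) size_cat exprD EFinM -muleA.
have e : ((-1) ^+ size t)%:E \is a fin_num by [].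
move=> /(congr1 (mule ((-1) ^+ size t)%:E)).
by rewrite !muleA -!EFinM -!exprMn mulrNN mulr1 expr1n mul1r mul1e.
Qed.

Lemma sobolev_jets q (r : \bar R) p : (forall f, f \in Lfun leb r -> Lpow q f) ->
  sobolev 2 r p -> Lpow q p /\ exists g gg,
    [/\ forall i, Lpow q (g i), forall i j, Lpow q (gg i j),
        forall i, weak_partial [:: i] p (g i) &
        forall i j, weak_partial [:: j] (g i) (gg i j)].
Proof.
move=> rq [/rq pq W]; split=> //.
have /choice[g gP] i : exists g, Lpow q g /\ weak_partial [:: i] p g.
  by have [//|g /rq gq pg] := W [:: i]; exists g.
have /choice[gg ggP] (ij : 'I_d * 'I_d) :
    exists g, Lpow q g /\ weak_partial ([:: ij.1] ++ [:: ij.2]) p g.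
  by have [//|k /rq kq pk] := W ([:: ij.1] ++ [:: ij.2]); exists k.
exists g, (fun i j => gg (i, j)); split=> [i|i j|i|i j].
- by case: (gP i).
- by case: (ggP (i, j)).
- by case: (gP i).
- by apply: (weak_partial_iter (gP i).2 (ggP (i, j)).2).
Qed.

(** The bias under the invariant distribution: the P-mean of the rescaled kernel at x, minus p x. *)
Definition kernel_bias K p (h : R) (x : Rd) : R :=
  fine (\int[leb]_y (Kh K h y x * p y)%:E)%E - p x.

(** After y = x + h u the bias is the integral of K(u) (p(x + h u) - p(x)). As the first moments of
    [K] vanish, the difference may be replaced by the Taylor remainder in direction h u, whose L^q
    size is of order h^2 |u|^2. *)
Lemma bias_pow_le q K p g gg : q \in [:: 1; 2]%N -> kernel_condition K ->
  (forall x, 0 <= p x) -> Lpow q p ->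
  (forall i, Lpow q (g i)) -> (forall i j, Lpow q (gg i j)) ->
  (forall i, weak_partial [:: i] p (g i)) ->
  (forall i j, weak_partial [:: j] (g i) (gg i j)) ->
  exists2 B : R, 0 <= B & forall h : R, 0 < h ->
    (forall x, (\int[leb]_y (Kh K h y x * p y)%:E < +oo)%E) ->
    (\int[leb]_x (`|kernel_bias K p h x| ^+ q)%:E <= (B * h ^+ (2 * q))%:E)%E.
Proof.
move=> hq [K0 [KL1 _] intK momK secK] p0 pq gq ggq pg pgg.
have mp : measurable_fun setT p by case: pq.
have mg i : measurable_fun setT (g i) by case: (gq i).
have mK : measurable_fun setT K by case: ((Lfun_Lpow K).1 KL1).
have mcoord i : measurable_fun setT (fun u : Rd => u 0 i) by exact: measurable_coord_rV.
(* Jensen is applied to the measure with density [w], finite by the second moment condition; the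
   factor |u|^2 is taken from the remainder. *)
pose w (u : Rd) := K u * enorm u ^+ 2.
have mw : measurable_fun setT w.
  by apply: measurable_funM => //; apply: measurable_funX; exact: measurable_enorm.
have w0 u : 0 <= w u by rewrite mulr_ge0// exprn_ge0// enorm_ge0.
have wE : (\int[leb]_u (enorm u ^+ 2 * `|K u|)%:E = \int[leb]_u (w u)%:E)%E.
  by apply: eq_integral => u _; rewrite ger0_norm// mulrC.
pose M := fine (\int[leb]_u (w u)%:E)%E.
have wM : (\int[leb]_u (w u)%:E = M%:E)%E.
  rewrite fineK// ge0_fin_numE -?wE//; last by apply: integral_ge0 => u _; rewrite lee_fin mulr_ge0// exprn_ge0// enorm_ge0.
have M0 : 0 <= M by apply: fine_ge0; apply: integral_ge0 => u _; rewrite lee_fin.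
have iw : leb.-integrable setT (EFin \o w).
  apply/integrableP; split; first exact/measurable_EFinP.
  by under eq_integral do rewrite /= ger0_norm//; rewrite wM ltry.
have iK : leb.-integrable setT (EFin \o K) by apply/Lfun1_integrable.
(* Integrability follows from |u_i| <= 1 + |u|^2. It is what permits splitting off the linear
   term. *)
have iKi i : leb.-integrable setT (fun u => (u 0 i * K u)%:E).
  apply: (le_integrable measurableT _ _ (integrableD measurableT iK iw)).
    by apply/measurable_EFinP; exact: measurable_funM.
  move=> u _; rewrite /= lee_fin (ger0_norm (addr_ge0 _ _))// /w.
  have -> : K u + K u * enorm u ^+ 2 = K u * (1 + enorm u ^+ 2) by ring.
  rewrite normrM (ger0_norm (K0 u)) mulrC; apply: ler_wpM2l => //.
  apply: le_trans (coord_le_enorm u i) _.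
  by have := sqr_ge0 (enorm u - 2^-1); rewrite sqrrB; have := enorm_ge0 u; nra.
have [C C0 CP] := taylor_pow_le hq pq gq ggq pg pgg.
exists (M ^+ q.-1 * (C * M)) => [|h h0 fin]; first by rewrite !mulr_ge0// exprn_ge0.
pose Q (z : Rd * Rd) := `|taylor_rest p g z.1 (h *: z.2)| / enorm z.2 ^+ 2.
have Q0 z : 0 <= Q z by rewrite divr_ge0// exprn_ge0// enorm_ge0.
have msnd : measurable_fun setT (fun z : Rd * Rd => h *: z.2).
  by apply: measurable_fun_scalerV => //; exact: measurable_cst.
have mT : measurable_fun setT (fun z : Rd * Rd => taylor_rest p g z.1 (h *: z.2)).
  apply: measurable_funB.
    apply: measurable_funB; last exact: measurableT_comp.
    by apply: (measurableT_comp mp); exact: measurable_fun_addrV.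
  apply: measurable_sum => i; apply: measurable_funM; last exact: measurableT_comp.
  exact: (measurableT_comp (mcoord i)).
have mQ : measurable_fun setT Q.
  apply: measurable_funM; first exact: measurableT_comp.
  under eq_fun do rewrite -powR_inv1 ?exprn_ge0 ?enorm_ge0//.
  apply: (measurableT_comp (measurable_powR _)); apply: measurable_funX.
  exact: (measurableT_comp measurable_enorm).
have QC u : (\int[leb]_x (Q (x, u) ^+ q)%:E <= (C * h ^+ (2 * q))%:E)%E.
  (* At u = 0 the quotient is 0, since the inverse of 0 is 0. *)
  have [u0|u0] := eqVneq (enorm u) 0.
    rewrite integral0_eq ?lee_fin ?mulr_ge0 ?exprn_ge0 ?(ltW h0)// => x _.
    by rewrite /Q /= u0 expr0n /= invr0 mulr0 expr0n (gtn_eqF (pow12_gt0 hq)).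
  pose e := (enorm u ^+ 2)^-1 ^+ q.
  have e0 : 0 <= e by rewrite exprn_ge0// invr_ge0 exprn_ge0// enorm_ge0.
  rewrite (_ : (fun x => _) = fun x => (e%:E * (`|taylor_rest p g x (h *: u)| ^+ q)%:E)%E); last first.
    by apply/funext => x; rewrite /Q exprMn mulrC EFinM.
  have mTu : measurable_fun setT (fun x : Rd => (`|taylor_rest p g x (h *: u)| ^+ q)%:E : \bar R).
    apply/measurable_EFinP; apply: measurable_funX; apply: measurableT_comp => //.
    exact: (measurableT_comp mT (pair2_measurable u)).
  rewrite (ge0_integralZl leb measurableT mTu) ?lee_fin//.
  apply: (@le_trans _ _ (e%:E * (C * enorm (h *: u) ^+ (2 * q))%:E)%E).
    by apply: lee_wpmul2l.
  rewrite -EFinM lee_fin enormZ (gtr0_norm h0) exprMn /e -exprVn -exprM.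
  rewrite mulrCA (mulrCA _ (h ^+ (2 * q))) [leLHS]mulrA.
  by rewrite -exprMn mulVf// expr1n mulr1.
have main := @integral_weighted_pow_le _ q _ _ _ _ leb leb Q w (fun=> C * h ^+ (2 * q)) M
  hq mQ mw Q0 w0 _ QC.
have {main} : (\int[leb]_x (\int[leb]_u (Q (x, u) * w u)%:E) ^+ q <=
    (M ^+ q.-1 * (C * M) * h ^+ (2 * q))%:E)%E.
  apply: le_trans (main _) _; first by rewrite wM.
  under eq_integral do rewrite EFinM.
  have mew : measurable_fun setT (fun u => (w u)%:E) by exact/measurable_EFinP.
  have w0e (u : Rd) : setT u -> (0 <= (w u)%:E)%E by rewrite lee_fin.
  rewrite (ge0_integralZl leb measurableT mew w0e); last by rewrite lee_fin mulr_ge0// exprn_ge0// ltW.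
  by rewrite wM -!EFinM lee_fin le_eqVlt; apply/orP; left; apply/eqP; ring.
apply: le_trans; apply: ge0_le_integral_nonmeas => x; first by rewrite lee_fin exprn_ge0.
suff le1 : (`|kernel_bias K p h x|%:E <= \int[leb]_u (Q (x, u) * w u)%:E)%E.
  rewrite EFin_expe; move: hq; rewrite !inE => /orP[]/eqP ->; first exact: le1.
  by rewrite !expe2; apply: lee_pmul; rewrite ?lee_fin.
pose f1 (u : Rd) := K u * p (x + h *: u).
have mf1 : measurable_fun setT f1.
  by apply: measurable_funM => //; apply: (measurableT_comp mp); apply: measurable_fun_addrV => //;
    apply: measurable_fun_scalerV => //; exact: measurable_cst.
(* Substitute y = x + h u: the Jacobian h^d cancels the normalisation of the kernel. *)
have E1 : (\int[leb]_u (f1 u)%:E = \int[leb]_y (Kh K h y x * p y)%:E)%E.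
  pose f2 (y : Rd) := K (h^-1 *: (y - x)) * p y.
  have f20 y : 0 <= f2 y by rewrite mulr_ge0.
  have mf2 : measurable_fun setT (fun y => (f2 y)%:E).
    apply/measurable_EFinP; apply: measurable_funM => //; apply: (measurableT_comp mK).
    apply: measurable_fun_scalerV; first exact: measurable_cst.
    by apply: measurable_fun_addrV => //; exact: measurable_cst.
  have hd0 : 0 <= (h ^+ d)^-1 by rewrite invr_ge0 exprn_ge0// ltW.
  transitivity ((h ^+ d)^-1%:E * \int[leb]_y (f2 y)%:E)%E.
    rewrite -(ge0_integral_affine x h0 mf2)//; apply: eq_integral => u _.
    by rewrite /f1 /f2 addrK scalerA mulVf ?gt_eqF// scale1r addrC.
  have f20e (y : Rd) : setT y -> (0 <= (f2 y)%:E)%E by rewrite lee_fin.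
  rewrite -(ge0_integralZl leb measurableT mf2 f20e) ?lee_fin//.
  by apply: eq_integral => y _; rewrite -EFinM /f2 mulrA.
have if1 : leb.-integrable setT (EFin \o f1).
  apply/integrableP; split; first exact/measurable_EFinP.
  under eq_integral do rewrite /= ger0_norm ?mulr_ge0//.
  by rewrite E1.
have iKT : leb.-integrable setT (fun u => (K u * taylor_rest p g x (h *: u))%:E) /\
    (\int[leb]_u (K u * taylor_rest p g x (h *: u))%:E = (kernel_bias K p h x)%:E)%E.
  have i2 : leb.-integrable setT (fun u => ((p x)%:E * (K u)%:E)%E) by exact: integrableZl.
  have i3 i : leb.-integrable setT (fun u => ((h * g i x)%:E * (u 0%R i * K u)%:E)%E) by exact: integrableZl.
  have i4 : leb.-integrable setT (fun u => (\sum_(i < d) ((h * g i x)%:E * (u 0%R i * K u)%:E))%E).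
    exact: integrable_sum.
  have E (u : Rd) : ((K u * taylor_rest p g x (h *: u))%:E = (f1 u)%:E - (p x)%:E * (K u)%:E -
       \sum_(i < d) ((h * g i x)%:E * (u 0%R i * K u)%:E))%E.
    rewrite /taylor_rest sumEFin -EFinM -!EFinB; congr _%:E.
    rewrite !mulrBr (mulrC (p x)); congr (_ - _); rewrite mulr_sumr; apply: eq_bigr => i _.
    by rewrite !mxE; ring.
  under eq_fun do rewrite E; split.
    by apply: integrableB => //; exact: integrableB.
  rewrite integralB//; last exact: integrableB.
  rewrite integralB// integralZl// intK mule1 integral_sum//.
  rewrite [X in (_ - X)%E]big1 ?sube0; last first.
    by move=> i _; rewrite integralZl// momK mule0.
  rewrite E1 /kernel_bias EFinB fineK// -E1.
  exact: (integrable_fin_num measurableT if1).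
case: iKT => iKT eKT.
rewrite -abse_EFin -eKT; apply: le_trans (le_abse_integral _ _ _) _ => //.
  by case/integrableP : iKT.
apply: ge0_le_integral_nonmeas => u //=.
rewrite lee_fin normrM (ger0_norm (K0 u)) /Q /w /=.
have [u0|u0] := eqVneq (enorm u) 0; last first.
  rewrite le_eqVlt; apply/orP; left; apply/eqP; field.
  by rewrite u0.
(* At the origin the product of [Q] and [w] no longer equals the integrand by cancellation, but the
   remainder vanishes there. *)
have ui i : u 0 i = 0 by apply/eqP; rewrite -normr_le0 -u0; exact: coord_le_enorm.
have -> : h *: u = 0 by apply/rowP => i; rewrite !mxE ui mulr0.
rewrite /taylor_rest addr0 subrr big1 ?subr0 ?normr0 ?mulr0 ?mul0r//.
by move=> i _; rewrite mxE mul0r.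
Qed.

End bias.

(** * Bandwidth asymptotics *)

Section asymptotics.
Context {R : realType}.
Implicit Types (a b h q r : nat -> R).

Lemma bigO_natP a b : a =O_\oo b <->
  exists M N0, forall N, (N0 <= N)%N -> `|a N| <= M * `|b N|.
Proof.
split=> [/eqOP [M0 [_ H]]|[M [N0 H]]].
  have [|N0 _ HN] := H (M0 + 1) _; first by rewrite ltrDl.
  by exists (M0 + 1), N0 => N NN; exact: HN.
apply/eqOP; exists M; split; first exact: num_real.
by move=> k Mk; exists N0 => // N /= NN; apply: le_trans (H _ NN) _; apply: ler_wpM2r => //; exact: ltW.
Qed.

(** Symmetric under inversion of [q], which suits powers of both h / rate and rate / h. *)
Definition sandwiched q : Prop := exists M, 0 < M /\ forall N, (0 < N)%N -> q N <= M /\ (q N)^-1 <= M.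

Lemma sandwichedP q : (forall N, (0 < N)%N -> 0 < q N) ->
  sandwiched q <-> exists c C, [/\ 0 < c, 0 < C & forall N, (0 < N)%N -> c <= q N <= C].
Proof.
move=> q0; split=> [[M [M0 qM]]|[c [C [c0 C0 qcC]]]].
  exists M^-1, M; split; rewrite ?invr_gt0// => N N0; have [-> qVM] := qM N N0.
  by rewrite andbT -[leRHS]invrK lef_pV2 ?posrE ?invr_gt0 ?q0.
exists (C + c^-1); split; first by rewrite addr_gt0 ?invr_gt0.
move=> N N0; have /andP[cq qC] := qcC N N0; split.
  by rewrite (le_trans qC)// lerDl ltW// invr_gt0.
apply: (@le_trans _ _ c^-1); last by rewrite lerDr ltW.
by rewrite lef_pV2 ?posrE ?q0.
Qed.

(** Roots are avoided: for positive x, a bound on x^m bounds x by x <= 1 + x^m. *)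
Lemma sandwiched_expV m q : (0 < m)%N -> (forall N, (0 < N)%N -> 0 < q N) ->
  sandwiched (fun N => (q N)^-1 ^+ m) <-> sandwiched q.
Proof.
move=> m0 q0.
have root (x M : R) : 0 < x -> x ^+ m <= M -> x <= 1 + M.
  move=> x0 xM; have [x1|x1] := leP x 1.
    by rewrite (le_trans x1)// lerDl (le_trans _ xM)// exprn_ge0// ltW.
  rewrite (@le_trans _ _ (x ^+ m))// ?(le_trans xM) ?lerDr//.
  by rewrite -[leLHS]expr1; apply: ler_weXn2l => //; exact: ltW.
split=> [[M [M0 H]]|[M [M0 H]]].
  exists (1 + M); split; first by rewrite addr_gt0.
  move=> N N0; have [h1 h2] := H N N0; split; apply: root; rewrite ?invr_gt0 ?q0//.
  by move: h2; rewrite exprVn invrK.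
exists (M ^+ m); split; first exact: exprn_gt0.
move=> N N0; have [h1 h2] := H N N0; have qN := q0 N N0; split.
  by apply: lerXn2r => //; rewrite nnegrE ?invr_ge0 ltW.
by rewrite exprVn invrK; apply: lerXn2r => //; rewrite nnegrE ltW.
Qed.

Lemma asymp_sandwiched a b q : (forall N, (0 < N)%N -> 0 < q N) ->
  (forall N, (0 < N)%N -> a N / b N = q N) -> asymp a b <-> sandwiched q.
Proof.
move=> q0 e; rewrite sandwichedP//; split=> -[c [C [c0 C0 H]]]; exists c, C; split=> // N N0.
  by rewrite -e// H.
by rewrite e// H.
Qed.

(** * Optimality of the balanced bandwidth *)

Section balance.
Variables (r : nat -> R) (B : nat -> R -> R) (k m n : nat).
Hypotheses (r0 : forall N, (0 < N)%N -> 0 < r N) (m0 : (0 < m)%N) (n0 : (0 < n)%N).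
Hypothesis BE : forall N (x : R), (0 < N)%N -> 0 < x ->
  B N x = r N ^+ k * ((r N / x) ^+ m + (x / r N) ^+ n).

Lemma balance_le h M N : (0 < N)%N -> 0 < h N -> h N / r N <= M -> (h N / r N)^-1 <= M ->
  0 <= B N (h N) <= (M ^+ m + M ^+ n) * r N ^+ k.
Proof.
move=> N0 hN h1 h2; have rN := r0 N0; rewrite BE// mulrC.
have a0 : 0 <= r N / h N by rewrite divr_ge0// ltW.
have b0 : 0 <= h N / r N by rewrite divr_ge0// ltW.
have M0 : 0 <= M by exact: le_trans h1.
have rk0 : 0 <= r N ^+ k by rewrite exprn_ge0// ltW.
apply/andP; split; first by rewrite mulr_ge0// addr_ge0// exprn_ge0.
apply: ler_wpM2r => //.
by apply: lerD; apply: lerXn2r; rewrite ?nnegrE// -invf_div.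
Qed.

(** One of x / r and r / x is at least 1, so the bracket in [BE] is at least 1. *)
Lemma balance_ge N x : (0 < N)%N -> 0 < x -> r N ^+ k <= B N x.
Proof.
move=> N0 x0; have rN := r0 N0; rewrite BE//.
have rk0 : 0 <= r N ^+ k by rewrite exprn_ge0// ltW.
apply: ler_peMr => //.
have a0 : 0 < r N / x by rewrite divr_gt0.
have b0 : 0 < x / r N by rewrite divr_gt0.
have [h1|h1] := leP 1 (x / r N).
  by rewrite (le_trans (exprn_ege1 n h1))// lerDr exprn_ge0// ltW.
have h2 : 1 <= r N / x by rewrite -invf_div invf_ge1// ltW.
by rewrite (le_trans (exprn_ege1 m h2))// lerDl exprn_ge0// ltW.
Qed.

Lemma rate_optimal_sandwiched h : positive_seq h ->
  sandwiched (fun N => h N / r N) <-> rate_optimal B h.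
Proof.
move=> h0; split=> [[M [M0 H]] h' h'0|opt].
  apply/bigO_natP; exists (M ^+ m + M ^+ n), 1%N => N N0; have [h1 h2] := H N N0.
  have /andP[B0 BM] := balance_le N0 (h0 N N0) h1 h2.
  rewrite ger0_norm// (le_trans BM)//; apply: ler_wpM2l.
    by rewrite addr_ge0// exprn_ge0// ltW.
  by rewrite (le_trans (balance_ge N0 (h'0 N N0)))// ler_norm.
(* An optimal [h] is compared with the balanced bandwidth [r] itself, where the bound equals 2 r^k;
   hence t = M * 2 below. *)
have /bigO_natP [M [N0 H]] := opt r r0.
pose q N := h N / r N.
have q0 N : (0 < N)%N -> 0 < q N by move=> ?; rewrite divr_gt0 ?h0 ?r0.
have root j (x t : R) : (0 < j)%N -> 0 < x -> x ^+ j <= t -> x <= 1 + `|t|.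
  move=> j0 x0 xt; have t0 : 0 <= t by rewrite (le_trans _ xt)// exprn_ge0// ltW.
  rewrite ger0_norm//; have [x1|x1] := leP x 1; first by rewrite (le_trans x1)// lerDl.
  rewrite (@le_trans _ _ (x ^+ j))// ?(le_trans xt) ?lerDr//.
  by rewrite -[leLHS]expr1; apply: ler_weXn2l => //; exact: ltW.
pose t := M * 2.
have tail N : (N0 <= N)%N -> (0 < N)%N -> q N <= 1 + `|t| /\ (q N)^-1 <= 1 + `|t|.
  move=> NN N1; have rN := r0 N1; have hN := h0 N N1; have qN := q0 N N1.
  have rk : 0 < r N ^+ k by exact: exprn_gt0.
  have qm : 0 <= (q N)^-1 ^+ m by rewrite exprn_ge0// invr_ge0 ltW.
  have qn : 0 <= q N ^+ n by rewrite exprn_ge0// ltW.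
  have le2 : (q N)^-1 ^+ m + q N ^+ n <= t.
    have := H N NN; rewrite [B N (h N)]BE// [B N (r N)]BE// divff ?gt_eqF// !expr1n.
    rewrite -[r N / h N]invf_div -/(q N).
    rewrite !normrM (gtr0_norm rk) mulrCA (ler_pM2l rk).
    by rewrite (ger0_norm (addr_ge0 qm qn)) (ger0_norm (_ : 0 <= 1 + 1 :> R)) ?addr_ge0.
  split; [apply: (root n (q N) t) => //|apply: (root m (q N)^-1 t) => //].
  - by rewrite (le_trans _ le2)// lerDr.
  - by rewrite invr_gt0.
  - by rewrite (le_trans _ le2)// lerDl.
(* The comparison holds only from N0 on, whereas [sandwiched] concerns all N >= 1. The sum absorbs
   the finitely many earlier terms. *)
exists (1 + `|t| + \sum_(i < N0) (`|q i| + `|(q i)^-1|)).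
have S0 : 0 <= \sum_(i < N0) (`|q i| + `|(q i)^-1|) by apply: sumr_ge0 => i _; rewrite addr_ge0.
split; first by rewrite ltr_wpDr// ltr_pwDl.
move=> N N1; have [NN|NN] := leqP N0 N.
  have [h1 h2] := tail N NN N1.
  by split; [rewrite (le_trans h1)// lerDl|rewrite (le_trans h2)// lerDl].
have SN : `|q N| + `|(q N)^-1| <= \sum_(i < N0) (`|q i| + `|(q i)^-1|).
  rewrite (bigD1 (Ordinal NN))//= lerDl; apply: sumr_ge0 => i _; exact: addr_ge0.
have a1 : 0 <= 1 + `|t| by rewrite addr_ge0.
rewrite -/(q N); move: S0 SN a1 (ler_norm (q N)) (ler_norm (q N)^-1) (normr_ge0 (q N)) (normr_ge0 (q N)^-1).
set S := \sum_(i < N0) _; move: (q N)^-1 (q N) (`|t|) => x y z S0 SN a1 *; split; lra.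
Qed.

End balance.

Lemma bigO_erealP (u : nat -> \bar R) b : (exists M N0, forall N, (N0 <= N)%N ->
    (0 <= u N <= (M * b N)%:E)%E /\ 0 <= b N) -> bigO_ereal u b.
Proof.
move=> [M [N0 H]]; split.
  exists N0 => // N /= NN; have [/andP[u0 uM] _] := H N NN.
  by rewrite ge0_fin_numE// (le_lt_trans uM)// ltry.
apply/bigO_natP; exists M, N0 => N NN; have [/andP[u0 uM] b0] := H N NN.
rewrite ger0_norm ?fine_ge0// ger0_norm// -lee_fin fineK//.
by rewrite ge0_fin_numE// (le_lt_trans uM)// ltry.
Qed.

Section optimal_rate.
Variable d : nat.
Local Notation rate := (optimal_rate (R := R) d).

Lemma optimal_rate_gt0 N : (0 < N)%N -> 0 < rate N.
Proof. by move=> N0; rewrite powR_gt0// ltr0n. Qed.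

(** Used to eliminate N: the variance term 1 / (N x^(2d)) becomes rate^4 (rate / x)^(2d), which
    brings both risk bounds into the form [BE]. *)
Lemma optimal_rate_pow N : (0 < N)%N -> rate N ^+ (2 * d + 4) = N%:R^-1.
Proof.
move=> N0; rewrite -powR_mulrn ?ltW ?optimal_rate_gt0// /optimal_rate -powRrM.
by rewrite mulNr mulVf ?pnatr_eq0 ?addn_eq0 ?andbF// powR_inv1 ?ler0n.
Qed.

Lemma optimal_rate_sqr N : rate N ^+ 2 = N%:R `^ (- (d + 2)%:R^-1).
Proof.
rewrite -powR_mulrn ?powR_ge0// /optimal_rate -powRrM; congr (_ `^ _).
have -> : (2 * d + 4)%:R = 2 * (d + 2)%:R :> R by rewrite -natrM; congr _%:R; lia.
have two0 : (2 : R) != 0 by rewrite pnatr_eq0.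
by rewrite mulNr invfM mulrAC mulVf// mul1r.
Qed.

Lemma optimal_rate_pow4 N : rate N ^+ 4 = N%:R `^ (- (2 / (d + 2)%:R)).
Proof.
rewrite (_ : 4 = 2 * 2)%N// exprM optimal_rate_sqr -powR_mulrn ?powR_ge0// -powRrM.
by congr (_ `^ _); rewrite mulNr mulrC.
Qed.

Lemma MISE_variance_ratio N x : (0 < N)%N -> 0 < x ->
  (N%:R * x ^+ (2 * d))^-1 = rate N ^+ 4 * (rate N / x) ^+ (2 * d).
Proof.
move=> N0 x0; rewrite invfM -(optimal_rate_pow N0) exprD expr_div_n.
by rewrite mulrAC mulrC mulrA.
Qed.

Lemma MIAE_variance_ratio N x : (0 < N)%N -> 0 < x ->
  (Num.sqrt (N%:R * x ^+ (2 * d)))^-1 = rate N ^+ 2 * (rate N / x) ^+ d.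
Proof.
move=> N0 x0; have rN := optimal_rate_gt0 N0.
have NR : (0 : R) <= N%:R * x ^+ (2 * d) by rewrite mulr_ge0// exprn_ge0// ltW.
rewrite -sqrtrV// MISE_variance_ratio//.
rewrite (_ : _ * _ = (rate N ^+ 2 * (rate N / x) ^+ d) ^+ 2).
  by rewrite sqrtr_sqr ger0_norm// mulr_ge0// exprn_ge0// ?divr_ge0// ltW.
by rewrite [RHS]exprMn -!exprM mulnC.
Qed.

Lemma MISE_boundE N x : (0 < N)%N -> 0 < x ->
  MISE_bound d N x = rate N ^+ 4 * ((rate N / x) ^+ (2 * d) + (x / rate N) ^+ 4).
Proof.
move=> N0 x0; have rN := optimal_rate_gt0 N0.
rewrite /MISE_bound MISE_variance_ratio// mulrDr; congr (_ + _).
by rewrite -exprMn mulrC divfK// gt_eqF.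
Qed.

Lemma MIAE_boundE N x : (0 < N)%N -> 0 < x ->
  MIAE_bound d N x = rate N ^+ 2 * ((rate N / x) ^+ d + (x / rate N) ^+ 2).
Proof.
move=> N0 x0; have rN := optimal_rate_gt0 N0.
rewrite /MIAE_bound MIAE_variance_ratio// mulrDr; congr (_ + _).
by rewrite -exprMn mulrC divfK// gt_eqF.
Qed.

Lemma optimal_rate_cvg0 : rate @ \oo --> 0.
Proof.
apply/cvgr0Pnorm_lt => e e0; have e1 : 0 < e ^+ (2 * d + 4) by exact: exprn_gt0.
exists (Num.truncn (e ^+ (2 * d + 4))^-1).+1 => // N /= NN.
have N0 : (0 < N)%N by exact: leq_ltn_trans NN.
have rN := optimal_rate_gt0 N0; rewrite gtr0_norm// ltNge; apply/negP => er.
have : e ^+ (2 * d + 4) <= N%:R^-1.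
  by rewrite -(optimal_rate_pow N0); apply: lerXn2r; rewrite ?nnegrE // ltW.
rewrite leNgt => /negP; apply; rewrite -[ltRHS]invrK ltf_pV2 ?posrE ?invr_gt0 ?ltr0n//.
by rewrite (lt_le_trans (truncnS_gt _))// ler_nat.
Qed.

Lemma optimal_rate_bandwidth h : positive_seq h ->
  sandwiched (fun N => h N / rate N) -> bandwidth_condition d h.
Proof.
move=> h0 [M [M0 H]]; split=> //.
  have cM : M * rate N @[N --> \oo] --> 0.
    by have := cvgM (cvg_cst M) optimal_rate_cvg0; rewrite mulr0; exact.
  apply: (@squeeze_cvgr _ _ _ _ (cst 0) (fun N => M * rate N)) => //; last exact: cvg_cst.
  exists 1%N => // N /= N0; have rN := optimal_rate_gt0 N0; rewrite ltW ?h0//=.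
  by rewrite -ler_pdivrMr//; case: (H N N0).
apply/cvgryPge => A.
(* With h >= rate / M, M^d N h^d is at least rate^-(d+4), hence at least 1 / rate once rate <= 1.
   For rate < e <= 1 this exceeds A M^d. *)
pose e := (1 + `|A| * M ^+ d)^-1.
have e0 : 0 < e by rewrite invr_gt0 ltr_wpDr// mulr_ge0// exprn_ge0// ltW.
have /cvgr0Pnorm_lt/(_ e e0) [N1 _ HN1] := optimal_rate_cvg0.
exists (maxn 1 N1) => // N /=; rewrite geq_max => /andP[N0 /HN1 /= rNe].
have rN := optimal_rate_gt0 N0; rewrite gtr0_norm// in rNe; have hN := h0 N N0.
have [_ hV] := H N N0.
have AM0 : 0 <= `|A| * M ^+ d by rewrite mulr_ge0// exprn_ge0// ltW.
have e1 : e <= 1 by rewrite invf_le1 ?lerDl// ltr_wpDr.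
have r1 : rate N <= 1 by rewrite ltW// (lt_le_trans rNe).
have hMr : rate N <= M * h N by rewrite -ler_pdivrMr// -invf_div.
have NV : N%:R = (rate N ^+ (2 * d + 4))^-1 by rewrite optimal_rate_pow// invrK.
have Md : 0 < M ^+ d by exact: exprn_gt0.
rewrite -(ler_pM2l Md) NV mulrCA -exprMn.
apply: (@le_trans _ _ (rate N)^-1).
  apply: (@le_trans _ _ e^-1).
    by rewrite /e invrK; have := ler_norm A; have := Md; nra.
  by rewrite lef_pV2 ?posrE// ltW.
apply: (@le_trans _ _ ((rate N ^+ (2 * d + 4))^-1 * rate N ^+ d)).
  rewrite ler_pdivlMl ?exprn_gt0//.
  rewrite (_ : (2 * d + 4 = (d + (d + 3)).+1)%N); last by lia.
  rewrite exprSr mulfK ?gt_eqF// exprD; apply: ler_piMr; first by rewrite exprn_ge0// ltW.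
  by apply: exprn_ile1 => //; exact: ltW.
apply: ler_wpM2l; first by rewrite invr_ge0 exprn_ge0// ltW.
by apply: lerXn2r; rewrite ?nnegrE ?(ltW rN)// mulr_ge0// ltW.
Qed.

End optimal_rate.

End asymptotics.

(** * Risk bounds *)

Section density.
Context {R : realType} {d : nat}.
Notation Rd := 'rV[R]_d.
Local Notation leb := (lebesgue_rV d).
Implicit Types (K p V : Rd -> R).

Lemma density_integral (P : probability Rd R) p (u : Rd -> \bar R) :
  has_density P p -> measurable_fun setT p -> (forall x, 0 <= p x) ->
  measurable_fun setT u -> (forall x, (0 <= u x)%E) ->
  (\int[P]_x u x = \int[leb]_x (u x * (p x)%:E))%E.
Proof.
move=> Pp mp p0 mu u0.
have := eq_integral_weighted (m1 := P) (m2 := leb) (X1 := id) (X2 := id)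
  (G1 := cst 1) (G2 := p) (u := u) (@measurable_id _ _ _) (@measurable_id _ _ _)
  (measurable_cst _) mp (fun=> ler01) p0.
move=> <- //; first by apply: eq_integral => x _; rewrite mule1.
move=> B mB; rewrite !preimage_id -Pp//.
by apply: etrans (integral_cst P mB 1%E) _; rewrite mul1e.
Qed.

Lemma integral_gt0_support K : measurable_fun setT K -> (forall u, 0 <= K u) ->
  (0 < \int[leb]_u (K u)%:E)%E -> (0 < leb [set u | (0 < K u)%R])%E.
Proof.
move=> mK K0; apply: contraTT; rewrite -!leNgt => A0.
have mA : measurable [set u | (0 < K u)%R].
  rewrite -[X in measurable X]setTI.
  rewrite (_ : [set u | _] = K @^-1` `]0, +oo[%classic).
    by apply: mK => //; exact: measurable_itv.
  by apply/seteqP; split => u; rewrite /= in_itv/= andbT.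
have -> : (\int[leb]_u (K u)%:E = \int[leb]_(u in setT) cst 0 u)%E.
  apply: ae_eq_integral => //; first exact/measurable_EFinP.
  exists [set u | (0 < K u)%R]; split=> //.
    by apply/eqP; rewrite eq_le A0 measure_ge0.
  move=> u /= Ku; rewrite lt_neqAle K0 andbT; apply/negP => /eqP e; apply: Ku => _.
  by rewrite -e.
by rewrite integral0.
Qed.

Lemma kernel_moment_envelope K V : kernel_condition K -> kernel_moment_condition K V ->
  measurable_fun setT V -> (forall x, 1 <= V x) ->
  exists2 C : R, 0 <= C & forall h, 0 < h <= 1 -> exists Phi : Rd -> R,
    [/\ measurable_fun setT Phi, forall x, 0 <= Phi x, forall x, Phi x <= C,
        (\int[leb]_x (Phi x)%:E <= C%:E)%E &
        forall x y, K (h^-1 *: (y - x)) <= Phi x * Num.sqrt (V y)].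
Proof.
move=> [K0 [KL1 _] intK _ _] [_ KMC] mV V1.
have mK : measurable_fun setT K by case: ((Lfun_Lpow K).1 KL1).
have [B B0 /(_ 1)] := KMC 1%N isT; rewrite ltr01 lexx expr1n divr1 => /(_ isT) HB.
(* The supremum itself is taken as [F], for which no measurability is required. *)
apply: (kernel_envelope mK _ K0 _ _ _ HB).
- exact: (measurableT_comp (continuous_measurable_fun (@sqrt_continuous R)) mV).
- by move=> x; rewrite sqrtr_gt0 (lt_le_trans ltr01).
- by apply: integral_gt0_support => //; rewrite intK.
move=> x y; apply: ereal_sup_ubound; exists y => //.
rewrite /Kh expr1n !invr1 mul1r scale1r expr1 ger0_norm//; congr (_ * _)%:E.
by rewrite powRN div1r powR12_sqrt// (le_trans ler01).
Qed.

End density.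

Section risk.
Context {R : realType} {d : nat} {disp : measure_display} {Omega : measurableType disp}.
Notation Rd := 'rV[R]_d.
Local Notation leb := (lebesgue_rV d).
Variables (P mu1 nu : probability Rd R) (p K V : Rd -> R).
Variables (Pr : probability Omega R) (Z : nat -> {RV Pr >-> Rd}).
Variables (T : R.-pker Rd ~> Rd) (J : set Rd) (beta lambda b : R).
Hypotheses (p_pos : forall x, 0 < p x) (p_dens : has_density P p).
Hypotheses (p_cond : density_condition p) (K_cond : kernel_condition K).
Hypotheses (Z_chain : markov_chain Z mu1 T) (T_inv : invariant_distribution T P).
Hypotheses (SSC : small_set T P J beta nu) (DC : drift T mu1 J V lambda b).
Hypothesis KMC : kernel_moment_condition K V.

Let p0 x : 0 <= p x. Proof. exact: ltW. Qed.

Let mp : measurable_fun setT p.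
Proof. by case: p_cond => -[/((Lfun_Lpow p).1) [+ _]]. Qed.

Let mK : measurable_fun setT K.
Proof. by case: K_cond => _ [/((Lfun_Lpow K).1) [+ _]]. Qed.

Let K0 u : 0 <= K u. Proof. by case: K_cond. Qed.

Let mZ k : measurable_fun setT (Z k). Proof. exact: measurable_funPT. Qed.

Let bias : exists2 B : R, 0 <= B & forall h : R, 0 < h ->
    (forall x, (\int[leb]_y (Kh K h y x * p y)%:E < +oo)%E) ->
    (\int[leb]_x (`|kernel_bias K p h x|)%:E <= (B * h ^+ 2)%:E)%E /\
    (\int[leb]_x (kernel_bias K p h x ^+ 2)%:E <= (B * h ^+ 4)%:E)%E.
Proof.
have [S1 S2] := p_cond.
have [p1 [g1 [gg1 [g1q gg1q pg1 pgg1]]]] := sobolev_jets (fun f => (Lfun_Lpow f).1) S1.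
have [p2 [g2 [gg2 [g2q gg2q pg2 pgg2]]]] := sobolev_jets (fun f => (Lfun_Lpow f).2) S2.
have [B1 B10 HB1] := bias_pow_le (q := 1) isT K_cond p0 p1 g1q gg1q pg1 pgg1.
have [B2 B20 HB2] := bias_pow_le (q := 2) isT K_cond p0 p2 g2q gg2q pg2 pgg2.
exists (B1 + B2) => [|h h0 fin]; first exact: addr_ge0.
split.
  under eq_integral do rewrite -[`|_|]expr1.
  apply: le_trans (HB1 h h0 fin) _; rewrite lee_fin; apply: ler_wpM2r; last by rewrite lerDl.
  by rewrite exprn_ge0// ltW.
under eq_integral do rewrite -real_normK ?num_real//.
apply: le_trans (HB2 h h0 fin) _; rewrite lee_fin; apply: ler_wpM2r; last by rewrite lerDr.
by rewrite exprn_ge0// ltW.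
Qed.

Let mKh d0 (X : measurableType d0) (h : R) (f g : X -> Rd) : measurable_fun setT f ->
  measurable_fun setT g -> measurable_fun setT (fun z => Kh K h (f z) (g z)).
Proof.
move=> mf mg; rewrite /Kh; apply: measurable_funM => //; apply: (measurableT_comp mK).
apply: measurable_fun_scalerV; first exact: measurable_cst.
by apply: measurable_fun_addrV => //; exact: measurable_fun_opprV.
Qed.

Section fixed_bandwidth.
Variables (h : nat -> R) (N : nat) (C1 C2 B : R) (Phi : Rd -> R).
Hypotheses (N0 : (0 < N)%N) (h0 : 0 < h N) (C10 : 0 <= C1) (C20 : 0 <= C2).
Hypothesis var : forall (f : Rd -> R) (c : R),
  measurable_fun setT f -> 0 <= c -> (forall x, 0 <= f x <= c * Num.sqrt (V x)) ->
  forall N, (\int[Pr]_w ((\sum_(k < N) (f (Z k w) - \int[P]_y f y)) ^+ 2)%:E <=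
    (C1 * c ^+ 2 * N%:R)%:E)%E.
Hypotheses (mPhi : measurable_fun setT Phi) (Phi0 : forall x, 0 <= Phi x).
Hypotheses (PhiC : forall x, Phi x <= C2) (intPhi : (\int[leb]_x (Phi x)%:E <= C2%:E)%E).
Hypothesis KPhi : forall x y, K ((h N)^-1 *: (y - x)) <= Phi x * Num.sqrt (V y).
Hypothesis biasB : (forall x, (\int[leb]_y (Kh K (h N) y x * p y)%:E < +oo)%E) ->
    (\int[leb]_x (`|kernel_bias K p (h N) x|)%:E <= (B * h N ^+ 2)%:E)%E /\
    (\int[leb]_x (kernel_bias K p (h N) x ^+ 2)%:E <= (B * h N ^+ 4)%:E)%E.

Let r x := kernel_bias K p (h N) x.
(** The multiple of [W] that dominates y -> K_h(y, x), and thus the constant given to the variance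
    bound at the point x. *)
Let c x := (h N ^+ d)^-1 * Phi x.
Let hd0 : 0 <= (h N ^+ d)^-1. Proof. by rewrite invr_ge0 exprn_ge0// ltW. Qed.
Let c0 x : 0 <= c x. Proof. exact: mulr_ge0. Qed.

Let f_ge0 x y : 0 <= Kh K (h N) y x. Proof. exact: mulr_ge0. Qed.

Let f_le x y : Kh K (h N) y x <= c x * Num.sqrt (V y).
Proof. by rewrite /Kh /c -mulrA; apply: ler_wpM2l. Qed.

Let mf x : measurable_fun setT (fun y => Kh K (h N) y x).
Proof. exact: mKh. Qed.

Let fP x : P.-integrable setT (fun y => (Kh K (h N) y x)%:E).
Proof.
have iW : P.-integrable setT (fun y => ((c x)%:E * (Num.sqrt (V y))%:E)%E).
  by apply: integrableZl => //; exact: (drift_integrable_sqrt T_inv DC).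
apply: (le_integrable measurableT _ _ iW).
  exact/measurable_EFinP.
move=> y _; rewrite /= lee_fin ger0_norm// ger0_norm ?f_le//.
by rewrite mulr_ge0// sqrtr_ge0.
Qed.

Let meanE x : (\int[P]_y (Kh K (h N) y x)%:E = \int[leb]_y (Kh K (h N) y x * p y)%:E)%E.
Proof.
rewrite (density_integral p_dens mp p0).
- by apply: eq_integral => y _; rewrite EFinM.
- exact/measurable_EFinP.
- by move=> y; rewrite lee_fin.
Qed.

Let bias_fin x : (\int[leb]_y (Kh K (h N) y x * p y)%:E < +oo)%E.
Proof.
rewrite -meanE; have /(integrable_fin_num measurableT) := fP x.
by rewrite fin_numElt => /andP[].
Qed.

(** The bias cancels [p], so this is the estimator at x minus the P-mean of the kernel, an average
    of centred terms along the chain. *)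
Let D (z : Omega * Rd) : R := kde K h Z N z.1 z.2 - p z.2 - r z.2.

Let mkde : measurable_fun setT (fun z : Omega * Rd => kde K h Z N z.1 z.2).
Proof.
rewrite /kde; apply: measurable_funM => //; apply: measurable_sum => k.
apply: mKh; last exact: measurable_snd.
exact: (measurableT_comp (mZ k)).
Qed.

Let mr : measurable_fun setT r.
Proof.
apply: measurable_funB => //.
apply: (measurable_section_integral leb (k := fun z : Rd * Rd => Kh K (h N) z.2 z.1 * p z.2)).
apply: measurable_funM; first exact: mKh.
exact: measurableT_comp.
Qed.

Let mD : measurable_fun setT D.
Proof.
apply: measurable_funB; last exact: measurableT_comp.
by apply: measurable_funB => //; exact: measurableT_comp.
Qed.

Let mDx x : measurable_fun setT (fun w => D (w, x)).
Proof. exact: (measurableT_comp mD (pair2_measurable x)). Qed.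

Let s : R := Num.sqrt (C1 / N%:R).

Let D_second_moment x : (\int[Pr]_w (D (w, x) ^+ 2)%:E <= ((s * c x) ^+ 2)%:E)%E.
Proof.
have NR : (N%:R : R) != 0 by rewrite pnatr_eq0 -lt0n.
have DE w : D (w, x) = N%:R^-1 *
    \sum_(k < N) (Kh K (h N) (Z k w) x - \int[P]_y Kh K (h N) y x).
  rewrite sumrB mulrBr sumr_const card_ord -[X in _ - _ * X]mulr_natl mulKf// /D /kde /=.
  by rewrite /r /kernel_bias /Rintegral meanE; ring.
have bound w : 0 <= Kh K (h N) w x <= c x * Num.sqrt (V w) by rewrite f_ge0 f_le.
have := var (mf x) (c0 x) bound N.
have mS : measurable_fun setT (fun w =>
    ((\sum_(k < N) (Kh K (h N) (Z k w) x - \int[P]_y Kh K (h N) y x)) ^+ 2)%:E : \bar R).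
  apply/measurable_EFinP; apply: measurable_funX; apply: measurable_sum => k.
  by apply: measurable_funB => //; exact: (measurableT_comp (mf x) (mZ k)).
have S0 w : setT w -> (0 <= ((\sum_(k < N) (Kh K (h N) (Z k w) x -
    \int[P]_y Kh K (h N) y x)) ^+ 2)%:E :> \bar R)%E by rewrite lee_fin sqr_ge0.
have n0 : (0 <= (N%:R^-1 ^+ 2)%:E :> \bar R)%E by rewrite lee_fin sqr_ge0.
move=> /(lee_wpmul2l n0); rewrite -(ge0_integralZl Pr measurableT mS S0 n0).
under eq_integral do rewrite -EFinM -exprMn -DE.
move=> h1; apply: le_trans h1 _; rewrite -EFinM lee_fin [leRHS]exprMn sqr_sqrtr; last by rewrite divr_ge0.
by rewrite le_eqVlt; apply/orP; left; apply/eqP; field.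
Qed.

Let s0 : 0 <= s. Proof. exact: sqrtr_ge0. Qed.

Let D_first_moment x : (\int[Pr]_w (`|D (w, x)|)%:E <= (s * c x)%:E)%E.
Proof.
have Pr1 : (\int[Pr]_w (cst 1 w)%:E <= 1%:E)%E.
  apply: le_trans (_ : (1 * (Pr : {measure set Omega -> \bar R}) setT <= _)%E).
    by rewrite le_eqVlt; apply/orP; left; apply/eqP; exact: (integral_cst Pr measurableT 1%E).
  rewrite mul1e.
  by rewrite (_ : (Pr : {measure set Omega -> \bar R}) [set: Omega] = 1%E)//; exact: (@probability_setT _ _ _ Pr).
have mN : measurable_fun setT (fun w => `|D (w, x)|) by exact: measurableT_comp.
have mc1 : measurable_fun setT (cst (1 : R) : Omega -> R) by exact: measurable_cst.
have := weighted_jensen (q := 2) isT mN mc1 (fun w => normr_ge0 _) (fun=> ler01) Pr1.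
under eq_integral do rewrite mulr1.
under [X in (_ <= _ * X)%E]eq_integral do rewrite mulr1 real_normK ?num_real//.
rewrite expr1 mul1e => /le_trans /(_ (D_second_moment x)).
set I := (\int[Pr]_w _)%E; have I0 : (0 <= I)%E by apply: integral_ge0 => w _; rewrite lee_fin.
rewrite EFin_expe !expe2 => II; rewrite leNgt; apply/negP => lt.
have sc0 : (0 <= (s * c x)%:E)%E by rewrite lee_fin mulr_ge0.
have : ((s * c x)%:E * (s * c x)%:E < I * I)%E.
  by apply: lte_pmul.
by rewrite ltNge II.
Qed.

Let int_c : (\int[leb]_x (c x)%:E <= ((h N ^+ d)^-1 * C2)%:E)%E.
Proof.
under eq_integral do rewrite EFinM.
have mP : measurable_fun setT (fun x => (Phi x)%:E) by exact/measurable_EFinP.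
have P0 (x : Rd) : setT x -> (0 <= (Phi x)%:E)%E by rewrite lee_fin.
rewrite (ge0_integralZl leb measurableT mP P0) ?lee_fin// EFinM.
by apply: lee_wpmul2l; rewrite ?lee_fin.
Qed.

Let mc : measurable_fun setT c. Proof. exact: measurable_funM. Qed.

(** At each x the error is at most |D| + |r|. The first moment of D is at most s * c x, and [c] has
    integral of order h^(-d), which yields 1 / sqrt(N h^(2d)). *)
Lemma MIAE_fixed_le : (MIAE K p h Z N <= ((s * ((h N ^+ d)^-1 * C2)) + B * h N ^+ 2)%:E)%E.
Proof.
rewrite /MIAE (fubini_tonelli (m1 := Pr) (m2 := leb)
  (fun z : Omega * Rd => `|kde K h Z N z.1 z.2 - p z.2|%:E)); last 2 first.
- by apply/measurable_EFinP; apply: measurableT_comp => //; apply: measurable_funB => //; exact: measurableT_comp.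
- by move=> z; rewrite lee_fin.
have mce : measurable_fun setT (fun x => (s * c x)%:E) by apply/measurable_EFinP; exact: measurable_funM.
have mre : measurable_fun setT (fun x => `|r x|%:E) by apply/measurable_EFinP; exact: measurableT_comp.
have sc0 (x : Rd) : setT x -> (0 <= (s * c x)%:E)%E by rewrite lee_fin mulr_ge0.
have r0 (x : Rd) : setT x -> (0 <= `|r x|%:E)%E by rewrite lee_fin.
apply: (@le_trans _ _ (\int[leb]_x ((s * c x)%:E + `|r x|%:E))%E).
  apply: ge0_le_integral_nonmeas => x; first by apply: integral_ge0 => w _; rewrite lee_fin.
  apply: (@le_trans _ _ (\int[Pr]_w (`|D (w, x)|%:E + `|r x|%:E))%E).
    apply: ge0_le_integral_nonmeas => w; first by rewrite lee_fin.
    by rewrite -EFinD lee_fin -[in leLHS](subrK (r x) (_ - _)); exact: ler_normD.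
  have mN : measurable_fun setT (fun w => `|D (w, x)|%:E).
    by apply/measurable_EFinP; exact: measurableT_comp.
  have mcst : measurable_fun [set: Omega] (fun=> `|r x|%:E) by exact: measurable_cst.
  rewrite (ge0_integralD Pr measurableT (fun w _ => abse_ge0 (D (w, x))%:E) mN (fun w _ => abse_ge0 (r x)%:E) mcst).
  apply: leeD; first exact: D_first_moment.
  rewrite integral_cst//.
  rewrite (_ : (Pr : {measure set Omega -> \bar R}) [set: Omega] = 1%E) ?mule1//.
  exact: (@probability_setT _ _ _ Pr).
rewrite (ge0_integralD leb measurableT sc0 mce r0 mre) EFinD.
apply: leeD; last by have [] := biasB bias_fin.
under eq_integral do rewrite EFinM.
have mcc : measurable_fun setT (fun x => (c x)%:E) by exact/measurable_EFinP.
have cc0 (x : Rd) : setT x -> (0 <= (c x)%:E)%E by rewrite lee_fin.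
rewrite (ge0_integralZl leb measurableT mcc cc0) ?lee_fin// EFinM.
by apply: lee_wpmul2l; rewrite ?lee_fin.
Qed.

Lemma MISE_fixed_le : (MISE K p h Z N <=
  (2 * (C1 / N%:R * ((h N ^+ d)^-1 * C2) ^+ 2 + B * h N ^+ 4))%:E)%E.
Proof.
rewrite /MISE (fubini_tonelli (m1 := Pr) (m2 := leb)
  (fun z : Omega * Rd => ((kde K h Z N z.1 z.2 - p z.2) ^+ 2)%:E)); last 2 first.
- by apply/measurable_EFinP; apply: measurable_funX; apply: measurable_funB => //; exact: measurableT_comp.
- by move=> z; rewrite lee_fin sqr_ge0.
(* The square of Phi is bounded by C2 * Phi, so that the integral of Phi suffices. Both factors
   h^(-d) remain. *)
pose a := C1 / N%:R * ((h N ^+ d)^-1 * C2).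
have a0 : 0 <= a by rewrite !mulr_ge0// divr_ge0.
have mce : measurable_fun setT (fun x => ((h N ^+ d)^-1 * a * Phi x)%:E).
  by apply/measurable_EFinP; exact: measurable_funM.
have mre : measurable_fun setT (fun x => (r x ^+ 2)%:E) by apply/measurable_EFinP; exact: measurable_funX.
have sc0 (x : Rd) : setT x -> (0 <= ((h N ^+ d)^-1 * a * Phi x)%:E)%E by rewrite lee_fin !mulr_ge0.
have r0 (x : Rd) : setT x -> (0 <= (r x ^+ 2)%:E)%E by rewrite lee_fin sqr_ge0.
apply: (@le_trans _ _ (\int[leb]_x (2%:E * (((h N ^+ d)^-1 * a * Phi x)%:E + (r x ^+ 2)%:E)))%E).
  apply: ge0_le_integral_nonmeas => x; first by apply: integral_ge0 => w _; rewrite lee_fin sqr_ge0.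
  have mN : measurable_fun setT (fun w => (D (w, x) ^+ 2)%:E).
    by apply/measurable_EFinP; exact: measurable_funX.
  have N0' (w : Omega) : setT w -> (0 <= (D (w, x) ^+ 2)%:E)%E by rewrite lee_fin sqr_ge0.
  have mcst : measurable_fun [set: Omega] (fun=> (r x ^+ 2)%:E) by exact: measurable_cst.
  have cst0 (w : Omega) : setT w -> (0 <= (r x ^+ 2)%:E)%E by rewrite lee_fin sqr_ge0.
  apply: (@le_trans _ _ (\int[Pr]_w (2%:E * ((D (w, x) ^+ 2)%:E + (r x ^+ 2)%:E)))%E).
    apply: ge0_le_integral_nonmeas => w; first by rewrite lee_fin sqr_ge0.
    rewrite -EFinD -EFinM lee_fin /D /=.
    move: (kde K h Z N w x - p x) (r x) => y t.
    (* This square is the gap in y^2 <= 2 ((y - t)^2 + t^2). *)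
    have := sqr_ge0 (y - 2 * t); nra.
  have mND : measurable_fun setT (fun w => ((D (w, x) ^+ 2)%:E + (r x ^+ 2)%:E)%E) by exact: emeasurable_funD.
  rewrite (ge0_integralZl Pr measurableT mND)//; last by move=> w _; rewrite -EFinD lee_fin addr_ge0// sqr_ge0.
  rewrite (ge0_integralD Pr measurableT N0' mN cst0 mcst).
  apply: lee_wpmul2l => //; apply: leeD.
    apply: le_trans (D_second_moment x) _; rewrite lee_fin [leLHS]exprMn sqr_sqrtr ?divr_ge0//.
    rewrite /a /c exprMn expr2 (expr2 (Phi x)).
    rewrite (_ : (h N ^+ d)^-1 * _ * _ = C1 / N%:R * ((h N ^+ d)^-1 * (h N ^+ d)^-1 * (C2 * Phi x))); last by ring.
    apply: ler_wpM2l; first by rewrite divr_ge0.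
    by apply: ler_wpM2l; [exact: mulr_ge0|exact: ler_wpM2r].
  rewrite integral_cst//.
  rewrite (_ : (Pr : {measure set Omega -> \bar R}) [set: Omega] = 1%E) ?mule1//.
  exact: (@probability_setT _ _ _ Pr).
have mS : measurable_fun setT (fun x => (((h N ^+ d)^-1 * a * Phi x)%:E + (r x ^+ 2)%:E)%E) by exact: emeasurable_funD.
have S0 (x : Rd) : setT x -> (0 <= ((h N ^+ d)^-1 * a * Phi x)%:E + (r x ^+ 2)%:E)%E.
  by rewrite -EFinD lee_fin addr_ge0 ?sqr_ge0// !mulr_ge0.
rewrite (ge0_integralZl leb measurableT mS S0)// (ge0_integralD leb measurableT sc0 mce r0 mre).
rewrite [leRHS]EFinM; apply: lee_wpmul2l => //.
rewrite EFinD; apply: leeD; last by have [] := biasB bias_fin.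
under eq_integral do rewrite EFinM.
have mP : measurable_fun setT (fun x => (Phi x)%:E) by exact/measurable_EFinP.
have P0 (x : Rd) : setT x -> (0 <= (Phi x)%:E)%E by rewrite lee_fin.
rewrite (ge0_integralZl leb measurableT mP P0) ?lee_fin ?mulr_ge0//.
apply: (@le_trans _ _ (((h N ^+ d)^-1 * a)%:E * C2%:E)%E).
  by apply: lee_wpmul2l => //; rewrite lee_fin mulr_ge0.
by rewrite -EFinM lee_fin /a le_eqVlt; apply/orP; left; apply/eqP; ring.
Qed.

End fixed_bandwidth.

Lemma kde_risk : exists2 C : R, 0 <= C & forall (h : nat -> R) N, (0 < N)%N -> 0 < h N <= 1 ->
  (MIAE K p h Z N <= (C * MIAE_bound d N (h N))%:E)%E /\
  (MISE K p h Z N <= (C * MISE_bound d N (h N))%:E)%E.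
Proof.
have [[mV V1] _ _ _ _] := DC.
have [C1 C10 var] := drift_variance Z_chain T_inv SSC DC.
have [C2 C20 env] := kernel_moment_envelope K_cond KMC mV V1.
have [B B0 HB] := bias.
(* The sum of the constants from the two fixed bandwidth bounds, so that one C serves both risks. *)
exists (Num.sqrt C1 * C2 + B + 2 * (C1 * C2 ^+ 2 + B)) => [|h N N0 /andP[h0 h1]].
  by rewrite !addr_ge0// ?mulr_ge0// ?addr_ge0// ?mulr_ge0// ?sqrtr_ge0// sqr_ge0.
have [Phi [mPhi Phi0 PhiC intPhi KPhi]] : exists Phi : Rd -> R,
    [/\ measurable_fun setT Phi, forall x, 0 <= Phi x, forall x, Phi x <= C2,
        (\int[leb]_x (Phi x)%:E <= C2%:E)%E &
        forall x y, K ((h N)^-1 *: (y - x)) <= Phi x * Num.sqrt (V y)].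
  by apply: env; rewrite h0 h1.
have NR : 0 < N%:R :> R by rewrite ltr0n.
have hd0 : 0 < h N ^+ d by rewrite exprn_gt0.
have hdE : Num.sqrt (N%:R * h N ^+ (2 * d)) = Num.sqrt N%:R * h N ^+ d.
  by rewrite sqrtrM ?ltW// mulnC exprM sqrtr_sqr ger0_norm// ltW.
have s2 : Num.sqrt (N%:R : R) ^+ 2 = N%:R by rewrite sqr_sqrtr// ltW.
have sN0 : 0 < Num.sqrt (N%:R : R) by rewrite sqrtr_gt0.
have h2 : 0 <= h N ^+ 2 by rewrite sqr_ge0.
have h4 : 0 <= h N ^+ 4 by rewrite exprn_ge0// ltW.
have C2s : 0 <= C2 ^+ 2 by rewrite sqr_ge0.
have sC := sqrtr_ge0 C1.
have comb (a y a' u t : R) : 0 <= a -> 0 <= y -> 0 <= a' -> 0 <= u -> 0 <= t ->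
    a * u + y * t <= (a + y + 2 * (a' + y)) * (u + t) /\
    2 * (a' * u + y * t) <= (a + y + 2 * (a' + y)) * (u + t).
  move=> a0 y0 a'0 u0 t0.
  have := (mulr_ge0 a0 u0, mulr_ge0 a0 t0, mulr_ge0 y0 u0, mulr_ge0 y0 t0, mulr_ge0 a'0 u0, mulr_ge0 a'0 t0).
  by move=> [[[[[? ?] ?] ?] ?] ?]; split; lra.
split.
  apply: le_trans (MIAE_fixed_le N0 h0 C10 var mPhi Phi0 intPhi KPhi (HB _ h0)) _.
  rewrite lee_fin /MIAE_bound hdE sqrtrM// (sqrtrV (ltW NR)) invfM.
  set u := _^-1 * (_ ^+ d)^-1.
  have u0 : 0 <= u by rewrite mulr_ge0// invr_ge0 ltW.
  have -> : Num.sqrt C1 * (Num.sqrt N%:R)^-1 * ((h N ^+ d)^-1 * C2) = Num.sqrt C1 * C2 * u.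
    by rewrite /u; move: (h N ^+ d)^-1 => k; ring.
  have a1 : 0 <= Num.sqrt C1 * C2 by exact: mulr_ge0.
  have a2 : 0 <= C1 * C2 ^+ 2 by exact: mulr_ge0.
  exact: (comb _ _ _ _ _ a1 B0 a2 u0 h2).1.
apply: le_trans (MISE_fixed_le N0 h0 C10 C20 var mPhi Phi0 PhiC intPhi KPhi (HB _ h0)) _.
rewrite lee_fin /MISE_bound mulnC exprM invfM.
set u := _^-1 * (_ ^+ 2)^-1.
have u0 : 0 <= u by rewrite mulr_ge0// invr_ge0 ?sqr_ge0// ltW.
have -> : C1 / N%:R * ((h N ^+ d)^-1 * C2) ^+ 2 = C1 * C2 ^+ 2 * u.
  by rewrite /u -exprVn; move: (h N ^+ d)^-1 => k; ring.
have a1 : 0 <= Num.sqrt C1 * C2 by exact: mulr_ge0.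
have a2 : 0 <= C1 * C2 ^+ 2 by exact: mulr_ge0.
exact: (comb _ _ _ _ _ a1 B0 a2 u0 h4).2.
Qed.

End risk.

Lemma MIAE_ge0 {R : realType} {d : nat} {disp : measure_display} {Omega : measurableType disp}
  {Pr : probability Omega R} (K p : 'rV[R]_d -> R) h (Z : nat -> {RV Pr >-> 'rV[R]_d}) N :
  (0 <= MIAE K p h Z N)%E.
Proof. by apply: integral_ge0 => w _; apply: integral_ge0 => x _; rewrite lee_fin. Qed.

Lemma MISE_ge0 {R : realType} {d : nat} {disp : measure_display} {Omega : measurableType disp}
  {Pr : probability Omega R} (K p : 'rV[R]_d -> R) h (Z : nat -> {RV Pr >-> 'rV[R]_d}) N :
  (0 <= MISE K p h Z N)%E.
Proof. by apply: integral_ge0 => w _; apply: integral_ge0 => x _; rewrite lee_fin sqr_ge0. Qed.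

Theorem corollary5p11 (R : realType) (d : nat) (hd : (0 < d)%N)
  (P : probability 'rV[R]_d R) (p : 'rV[R]_d -> R)
  (p_pos : forall x, 0 < p x) (p_dens : has_density P p)
  (p_cond : density_condition p)
  (K : 'rV[R]_d -> R) (K_cond : kernel_condition K)
  (disp : measure_display) (Omega : measurableType disp)
  (Pr : probability Omega R) (Z : nat -> {RV Pr >-> 'rV[R]_d})
  (mu1 : probability 'rV[R]_d R) (T : R.-pker 'rV[R]_d ~> 'rV[R]_d)
  (Z_chain : markov_chain Z mu1 T)
  (T_inv : invariant_distribution T P) (T_irr : irreducible_kernel T P)
  (T_aper : aperiodic_kernel T P) (T_harris : harris_recurrent T P)
  (J : set 'rV[R]_d) (beta : R) (nu : probability 'rV[R]_d R)
  (SSC : small_set T P J beta nu)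
  (V : 'rV[R]_d -> R) (lambda b : R) (DC : drift T mu1 J V lambda b)
  (KMC : kernel_moment_condition K V) :
  [/\ forall h : nat -> R, bandwidth_condition d h ->
        bigO_ereal (MIAE K p h Z) (fun N => MIAE_bound d N (h N)) /\
        bigO_ereal (MISE K p h Z) (fun N => MISE_bound d N (h N)),
      forall h : nat -> R, positive_seq h ->
        [/\ asymp h (optimal_rate d) <->
              asymp (fun N => (Num.sqrt (N%:R * h N ^+ (2 * d)))^-1)
                    (fun N => h N ^+ 2),
            asymp h (optimal_rate d) <->
              asymp (fun N => (N%:R * h N ^+ (2 * d))^-1) (fun N => h N ^+ 4),
            asymp h (optimal_rate d) <-> rate_optimal (MIAE_bound d) h &
            asymp h (optimal_rate d) <-> rate_optimal (MISE_bound d) h] &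
      forall h : nat -> R, positive_seq h -> asymp h (optimal_rate d) ->
        [/\ bandwidth_condition d h,
            bigO_ereal (MIAE K p h Z)
              (fun N => N%:R `^ (- (d + 2)%:R^-1)) &
            bigO_ereal (MISE K p h Z)
              (fun N => N%:R `^ (- (2 / (d + 2)%:R)))]].
Proof.
have [C C0 risk] := kde_risk p_pos p_dens p_cond K_cond Z_chain T_inv SSC DC KMC.
(* The envelope exists for h <= 1, which holds eventually as h tends to 0. *)
have small (h : nat -> R) : bandwidth_condition d h -> exists N1, forall N, (N1 <= N)%N -> (0 < N)%N /\ 0 < h N <= 1.
  move=> [h0 /cvgr0Pnorm_lt /(_ 1 ltr01) [N1 _ HN1] _]; exists (maxn 1 N1) => N.
  rewrite geq_max => /andP[N0 /HN1 /= hN]; split=> //; rewrite h0//=.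
  by rewrite (le_trans (ler_norm _))// ltW.
split.
- move=> h hb; have [N1 HN1] := small h hb.
  split; apply: bigO_erealP; exists C, N1 => N /HN1 [N0 hN]; have /andP[h0 _] := hN.
    have [+ _] := risk h N N0 hN; rewrite MIAE_ge0 => ->; split=> //.
    by rewrite /MIAE_bound addr_ge0 ?invr_ge0 ?sqrtr_ge0 ?sqr_ge0.
  have [_ +] := risk h N N0 hN; rewrite MISE_ge0 => ->; split=> //.
  by rewrite /MISE_bound addr_ge0 ?invr_ge0 ?mulr_ge0 ?exprn_ge0// ltW.
- move=> h h0; pose q N := h N / optimal_rate d N.
  have r0 N : (0 < N)%N -> 0 < optimal_rate d N :> R by exact: optimal_rate_gt0.
  have q0 N : (0 < N)%N -> 0 < q N by move=> N0; rewrite divr_gt0 ?h0 ?r0.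
  have qV N : (q N)^-1 = optimal_rate d N / h N by rewrite invf_div.
  have aq : asymp h (optimal_rate d) <-> sandwiched q by exact: asymp_sandwiched.
  (* In both risk bounds the ratio of the variance term to the bias term is a power of rate / h,
     with exponent d + 2 or 2d + 4. It stays between positive constants exactly when h / rate
     does. *)
  have powq m (x y : nat -> R) : (0 < m)%N -> (forall N, (0 < N)%N -> x N / y N = (q N)^-1 ^+ m) ->
      asymp h (optimal_rate d) <-> asymp x y.
    move=> m0 abq; apply: iff_trans aq _; apply: iff_sym.
    apply: iff_trans (asymp_sandwiched _ abq) (sandwiched_expV m0 q0) => N N0.
    by rewrite exprn_gt0// invr_gt0 q0.
  split.
  + apply: (powq (d + 2)%N) => [|N N0]; first by rewrite addn2.
    have hN := h0 N N0; rewrite MIAE_variance_ratio// qV exprD mulrAC mulrC; congr (_ * _).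
    by rewrite expr_div_n.
  + apply: (powq (2 * d + 4)%N) => [|N N0]; first by rewrite addn4.
    have hN := h0 N N0; rewrite MISE_variance_ratio// qV exprD mulrAC mulrC; congr (_ * _).
    by rewrite expr_div_n.
  + apply: iff_trans aq _; apply: (rate_optimal_sandwiched (k := 2) (m := d) (n := 2)) => //.
    by move=> N x; exact: MIAE_boundE.
  + apply: iff_trans aq _; apply: (rate_optimal_sandwiched (k := 4) (m := 2 * d) (n := 4)) => //.
      by rewrite muln_gt0.
    by move=> N x; exact: MISE_boundE.
move=> h h0 /asymp_sandwiched => /(_ _ _ (fun N _ => erefl)) sw.
have r0 N : (0 < N)%N -> 0 < optimal_rate d N :> R by exact: optimal_rate_gt0.
have {}sw : sandwiched (fun N => h N / optimal_rate d N).
  by apply: sw => N N0; rewrite divr_gt0 ?h0 ?r0.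
have hb := optimal_rate_bandwidth h0 sw; have [N1 HN1] := small h hb.
have [M [M0 HM]] := sw.
split=> //; apply: bigO_erealP.
- exists (C * (M ^+ d + M ^+ 2)), N1 => N /HN1 [N0 hN]; have [h1 h2] := HM N N0.
  rewrite powR_ge0 MIAE_ge0 -optimal_rate_sqr; split=> //=.
  have [+ _] := risk h N N0 hN => /le_trans; apply; rewrite lee_fin -mulrA; apply: ler_wpM2l => //.
  have hN0 := h0 N N0.
  by have /andP[] := balance_le r0 (fun N x => @MIAE_boundE _ d N x) N0 hN0 h1 h2.
- exists (C * (M ^+ (2 * d) + M ^+ 4)), N1 => N /HN1 [N0 hN]; have [h1 h2] := HM N N0.
  rewrite powR_ge0 MISE_ge0 -optimal_rate_pow4; split=> //=.
  have [_ +] := risk h N N0 hN => /le_trans; apply; rewrite lee_fin -mulrA; apply: ler_wpM2l => //.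
  have hN0 := h0 N N0.
  by have /andP[] := balance_le r0 (fun N x => @MISE_boundE _ d N x) N0 hN0 h1 h2.
Qed.
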